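(* Let $M$ be a closed surface endowed with an area form $\omega$, and let $\zeta$ be a representable quasi-state on $M$. Then for any $F,G\in C^\infty(M)$, $$|\zeta(F+G)-\zeta(F)-\zeta(G)|^2\ \le\ \mathrm{area}(M)\,\|\{F,G\}\|,$$ where $\mathrm{area}(M)=\int_M\omega$, $\{\cdot,\cdot\}$ is the Poisson bracket defined by $\omega$, and $\|\cdot\|$ is the supremum norm.
   Context: A closed surface is a compact smooth two-dimensional manifold without boundary, oriented by the area form $\omega$. The Poisson bracket of $F,G\in C^\infty(M)$ is the function $\{F,G\}$ determined by $-dF\wedge dG=\{F,G\}\,\omega$. For a compact Hausdorff space $X$, $C(X)$ is the algebra of real-valued continuous functions on $X$, and for $F\in C(X)$, $C(F)=\{\varphi\circ F \mid \varphi\in C(F(X))\}$. A quasi-state on $X$ is a (not necessarily linear) functional $\zeta: C(X)\to\mathbb{R}$ such that (i) $\zeta(F)\ge 0$ whenever $F\ge 0$; (ii) $\zeta$ is linear on $C(F)$ for every $F\in C(X)$; (iii) $\zeta(1)=1$. A quasi-state is simple if it is multiplicative on $C(F)$ for every $F\in C(X)$. The set of quasi-states on $X$ is convex and carries the topology of pointwise convergence: $\zeta_\nu\to\zeta$ iff $\zeta_\nu(H)\to\zeta(H)$ for every $H\in C(X)$. A quasi-state is representable if it lies in the closed convex hull of the set of simple quasi-states. *)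

(* Defs.v *)
From HB Require Import structures.
From mathcomp Require Import all_boot all_order all_algebra.
From mathcomp Require Import finmap.
From mathcomp Require Import all_classical all_reals all_analysis.

Set Implicit Arguments.
Unset Strict Implicit.
Unset Printing Implicit Defensive.

Import Order.TTheory GRing.Theory Num.Theory.
Import numFieldNormedType.Exports.

Local Open Scope classical_set_scope.
Local Open Scope ring_scope.

Section plane_calculus.
Context {R : realType}.
Implicit Types (U : set (R * R)) (f g : R * R -> R) (T : R * R -> R * R).

Definition axis (b : bool) : R * R := if b then (0, 1) else (1, 0).

Definition partial (b : bool) f : R * R -> R := fun p => 'D_(axis b) f p.

Definition partials (s : seq bool) f : R * R -> R := foldr partial f s.

(* C^oo on the open set U: all partial derivatives of all orders exist and are continuous. *)
Definition smooth_on U f : Prop :=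
  forall (s : seq bool) (p : R * R), U p ->
    {for p, continuous (partials s f)} /\
    forall b, derivable (partials s f) p (axis b).

(* [jacobian f g] is the coefficient of df /\ dg with respect to dx /\ dy. *)
Definition jacobian f g : R * R -> R := fun p =>
  partial false f p * partial true g p - partial true f p * partial false g p.

Definition smooth_map_on U T : Prop :=
  smooth_on U (fun p => (T p).1) /\ smooth_on U (fun p => (T p).2).

Definition jacobian_map T : R * R -> R :=
  jacobian (fun p => (T p).1) (fun p => (T p).2).

End plane_calculus.

Record chart (R : realType) (M : topologicalType) := Chart {
  dom : set M;
  img : set (R * R);
  to_plane : M -> R * R;
  of_plane : R * R -> M;
  open_dom : open dom;
  open_img : open img;
  to_planeP : forall x, dom x -> img (to_plane x);
  of_planeP : forall p, img p -> dom (of_plane p);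
  to_planeK : forall x, dom x -> of_plane (to_plane x) = x;
  of_planeK : forall p, img p -> to_plane (of_plane p) = p;
  to_plane_continuous : {in dom, continuous to_plane};
  of_plane_continuous : {in img, continuous of_plane}
}.

Definition overlap (R : realType) (M : topologicalType) (c c' : chart R M) :
  set (R * R) := [set p | img c p /\ dom c' (of_plane c p)].

Definition transition (R : realType) (M : topologicalType) (c c' : chart R M) :
  R * R -> R * R := to_plane c' \o of_plane c.

(* Second countability follows from compactness; connectedness is not assumed. *)
Record closed_surface (R : realType) := ClosedSurface {
  carrier :> topologicalType;
  surface_hausdorff : hausdorff_space carrier;
  surface_compact : compact [set: carrier];
  atlas : set (chart R carrier);
  atlas_cover : forall x, exists2 c, atlas c & dom c x;
  atlas_smooth : forall c c', atlas c -> atlas c' ->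
    smooth_map_on (overlap c c') (transition c c')
}.

(* A nowhere vanishing smooth 2-form, given by its coefficient [form c] with   *)
(* respect to dx /\ dy in each chart [c] of the atlas; charts need not be      *)
(* positively oriented, so that the coefficients may be negative.              *)
Record area_form (R : realType) (M : closed_surface R) := AreaForm {
  form :> chart R M -> R * R -> R;
  form_smooth : forall c, atlas c -> smooth_on (img c) (form c);
  form_neq0 : forall c p, atlas c -> img c p -> form c p != 0;
  form_transition : forall c c' p, atlas c -> atlas c' -> overlap c c' p ->
    form c p =
      form c' (transition c c' p) * jacobian_map (transition c c') p
}.

Section surface.
Context {R : realType} (M : closed_surface R).

Definition smooth (F : M -> R) : Prop :=
  forall c, atlas c -> smooth_on (img c) (F \o of_plane c).

Definition chart_at (x : M) : chart R M := s2val (cid2 (atlas_cover x)).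

Lemma atlas_chart_at x : atlas (chart_at x).
Proof. exact: (s2valP (cid2 (atlas_cover x))). Qed.

Lemma dom_chart_at x : dom (chart_at x) x.
Proof. exact: (s2valP' (cid2 (atlas_cover x))). Qed.

(* The coefficient of dF /\ dG in the chart [c]. *)
Definition d_wedge_d (F G : M -> R) (c : chart R M) : R * R -> R :=
  jacobian (F \o of_plane c) (G \o of_plane c).

(* - dF /\ dG = {F, G} omega, solved for {F, G} at [x] in a chart around [x]:  *)
(* both 2-forms change by the same jacobian, so any chart gives the same value. *)
Definition poisson (omega : area_form M) (F G : M -> R) (x : M) : R :=
  let c := chart_at x in
  - d_wedge_d F G c (to_plane c x) / omega c (to_plane c x).

(* The integral of omega over the part of the domains of [s] outside [B], cut  *)
(* into the Borel pieces on which each chart of [s] comes first. The absolute  *)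
(* value accounts for the orientation of M by omega.                           *)
Fixpoint area_outside (omega : area_form M) (B : set M) (s : seq (chart R M)) :
    \bar R :=
  if s is c :: s' then
    (\int[lebesgue_measure \x lebesgue_measure]_(p in
        [set p | img c p /\ ~ B (of_plane c p)]) `|omega c p|%:E
     + area_outside omega (B `|` dom c) s')%E
  else 0%E.

Lemma finite_subatlas : exists s : seq M,
  [set: M] `<=` \bigcup_(x in [set` s]) dom (chart_at x).
Proof.
have [[x0 _]|M0] := pselect ([set: M] !=set0); last first.
  by exists [::] => x _; case: M0; exists x.
pose pM := isPointed.Build (carrier M) x0.
pose M' : ptopologicalType := HB.pack (carrier M) pM.
have cM : @cover_compact M' [set: M'].
  by rewrite -compact_cover; exact: surface_compact.
have [|x _|D' _ D'M] := cM M' [set: M'] (fun x => dom (chart_at x)).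
- by move=> x _; exact: open_dom.
- by exists x => //; exact: dom_chart_at.
- by exists (enum_fset D').
Qed.

(* By the transformation law of omega and the change of variables formula, the *)
(* value is the same for every finite family of charts of the atlas covering M. *)
Definition area (omega : area_form M) : \bar R :=
  area_outside omega set0 (map chart_at (sval (cid finite_subatlas))).

Definition sup_norm (H : M -> R) : \bar R :=
  ereal_sup [set `|H x|%:E | x in [set: M]].

End surface.

Section quasi_states.
Context {R : realType} (X : topologicalType).

Local Notation C := (continuousType X R).

Let cts_add (F G : C) : continuous (F \+ G).
Proof. by move=> x; apply: continuousD; exact: cts_fun. Qed.

HB.instance Definition _ (F G : C) := isContinuous.Build X R (F \+ G) (@cts_add F G).

Let cts_mul (F G : C) : continuous (F \* G).
Proof. by move=> x; apply: continuousM; exact: cts_fun. Qed.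

HB.instance Definition _ (F G : C) := isContinuous.Build X R (F \* G) (@cts_mul F G).

(* C(F), the functions phi \o F with phi in C(F(X)). *)
Definition generated_by (F : C) : set C :=
  [set H | exists2 phi : R -> R,
    {within range F, continuous phi} & forall x, H x = phi (F x)].

Record quasi_state (zeta : C -> R) : Prop := QuasiState {
  quasi_state_ge0 : forall F : C, (forall x, 0 <= F x) -> 0 <= zeta F;
  quasi_state_linear : forall F H K : C, forall a : R,
    generated_by F H -> generated_by F K ->
    zeta (cst a \* H \+ K) = a * zeta H + zeta K;
  quasi_state1 : zeta (cst 1) = 1
}.

Definition simple_quasi_state (zeta : C -> R) : Prop :=
  quasi_state zeta /\
  forall F H K : C, generated_by F H -> generated_by F K ->
    zeta (H \* K) = zeta H * zeta K.

Definition closed_convex_hull (S : set (C -> R)) : set (C -> R) :=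
  smallest [set A | closed (A : set {ptws C -> R}) /\
                    convex_set (A : set (convex_lmodType (C -> R^o)))] S.

(* The quasi-states form a closed convex set of functionals, so that the hull  *)
(* may be taken among all functionals.                                         *)
Definition representable (zeta : C -> R) : Prop :=
  quasi_state zeta /\ closed_convex_hull simple_quasi_state zeta.

End quasi_states.

(* Main.v *)
From HB Require Import structures.
Require Import Defs.
From mathcomp Require Import all_boot all_order all_algebra.
From mathcomp Require Import all_classical all_reals all_analysis.
From mathcomp Require Import measurable_realfun.
From mathcomp Require Import ring lra.
Set Implicit Arguments.
Unset Strict Implicit.
Unset Printing Implicit Defensive.
Import Order.TTheory GRing.Theory Num.Theory.
Import numFieldNormedType.Exports.
Import HBNNSimple.
Local Open Scope classical_set_scope.
Local Open Scope ring_scope.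

(* By convexity and continuity it suffices to treat a simple quasi-state zeta. Put     *)
(* Phi = (F, G) : M -> R^2 and a = zeta(F + G) - zeta(F) - zeta(G). The lines          *)
(* x = zeta(F), y = zeta(G), x + y = zeta(F + G) bound a triangle T of area a^2 / 2,   *)
(* and Phi takes every value in T: otherwise Phi avoids a point of T, and zeta would   *)
(* induce a simple quasi-state on a circle that is not a point evaluation. As Phi has  *)
(* degree 0, each regular value in T is taken both at a point where {F, G} > 0 and at  *)
(* a point where {F, G} < 0. Hence, by the area inequality applied to both regions,    *)
(* a^2 = 2 |T| is at most the integral of |{F, G}| omega. The degree argument is       *)
(* replaced by the remark that {f, G} omega is exact: if {F, G} > 0 on the fibre of p, *)
(* a cut-off f = alpha(F) eta(G) supported near that fibre has {f, G} >= 0, not        *)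
(* identically 0, although its integral vanishes.                                      *)

(** * Simple quasi-states and triangles *)

(** The defect of additivity is linear and continuous in the functional, so a bound on its square
    passes from simple quasi-states to their closed convex hull
    ([closed_convex_hull_additivity_defect]). For a simple [zeta], the proof plays three estimates
    against each other, all about one triangle T in the plane whose doubled area is the squared
    defect ([triangle_ge], [cotriangle_ge]).

    Topology: T lies in the image of (F, G). A simple quasi-state behaves like a point evaluation on
    disjoint functions, and [simple_quasi_state_common_zero] turns this into the existence of a
    point over each element of T ([simple_quasi_state_triangle], [simple_quasi_state_cotriangle]).

    Stokes: a bracket {f, g} that is nonnegative everywhere vanishes ([poisson_ge0_eq0]). Localized
    by cut-offs, this says that {F, G} has no strict constant sign on a fibre of (F, G)
    ([fiber_not_positive], [fiber_not_negative]). Up to critical values, T is therefore covered by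
    the image of the region where {F, G} is positive, and once more by the image of the region where
    it is negative.

    Measure: the area of an image is at most the integral of the absolute jacobian
    ([image_le_integral]). Applied chart by chart to both regions, it bounds twice the area of T by
    the integral of |{F, G}| against the area, hence by [sup_norm] times [area]
    ([image_measure_le]); the critical values are null by the same inequality. Images are measured
    by the outer measure [mu_ext], as the image of a Borel set need not be Borel.

    The area inequality also yields one half of the change of variables formula
    ([change_of_variables_le]). Used for a transition map and for its inverse, it makes chart
    integrals independent of the chart, on which Stokes' formula with a partition of unity relies.
    Cut-offs are only of class C^1, so that squares of positive parts can serve to build them. *)

Lemma continuous_max0 (R : realType) (T : topologicalType) (f : T -> R) :
  continuous f -> continuous (fun x => Num.max 0 (f x)).
Proof.
by move=> cf x; apply: (@continuous_max _ _ (fun=> 0) f); [exact: cvg_cst|exact: cf].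
Qed.

Lemma max0N_ge0 (R : realDomainType) (x : R) : 0 <= x -> Num.max 0 (- x) = 0.
Proof. by move=> x0; rewrite max_l// oppr_le0. Qed.

Lemma max0N_lt0 (R : realDomainType) (x : R) : x < 0 -> Num.max 0 (- x) = - x.
Proof. by move=> x0; rewrite max_r// oppr_ge0 ltW. Qed.

(** The negative parts of three numbers of sum 0 add up to [N / 2]. Divided by [N] they add up to
    [2^-1], so that [2^-1 - k] is the sum of those of [b] and [c]. *)
Lemma hexagon_split (R : realFieldType) (a b c : R) : a + b + c = 0 ->
  let N := `|a| + `|b| + `|c| in 0 < N ->
  let k := Num.max 0 (- a) / N in
  k * (2^-1 - k) =
    Num.max 0 (- a) / N * (Num.max 0 (- c) / N) +
    Num.max 0 (- a) / N * (Num.max 0 (- b) / N).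
Proof.
move=> abc N N0 k; rewrite /k -mulrDr -mulrDl.
have [a0|a0] := leP 0 a; first by rewrite max0N_ge0// !mul0r.
congr (_ * _); rewrite max0N_lt0//.
apply: (mulIf (lt0r_neq0 N0)); rewrite mulrBl !divfK ?lt0r_neq0//.
rewrite /N (ltr0_norm a0).
have [b0|b0] := leP 0 b; have [c0|c0] := leP 0 c.
- by rewrite !max0N_ge0// (ger0_norm b0) (ger0_norm c0); lra.
- by rewrite (max0N_ge0 b0) (max0N_lt0 c0) (ger0_norm b0) (ltr0_norm c0); lra.
- by rewrite (max0N_lt0 b0) (max0N_ge0 c0) (ltr0_norm b0) (ger0_norm c0); lra.
- by exfalso; lra.
Qed.

Section simple_quasi_states.
Context {R : realType} {X : topologicalType}.
Local Notation C := (continuousType X R).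
Variable zeta : C -> R.
Hypothesis zs : simple_quasi_state zeta.
Implicit Types f g : X -> R.

(* [zeta] on bare functions, with junk value 0 off the continuous ones. *)
Definition on_functions f : R :=
  if pselect (continuous f) is left cf then zeta (mkcts cf) else 0.
Local Notation z := on_functions.

Lemma on_functionsE (F : C) : z F = zeta F.
Proof.
rewrite /on_functions; case: pselect => [cF|]; last by case; exact: cts_fun.
by congr zeta; apply/continuousEP.
Qed.

Lemma on_functions_ge0 f : continuous f -> (forall x, 0 <= f x) -> 0 <= z f.
Proof.
move=> cf f0; rewrite -[f]/(mkcts cf : X -> R) on_functionsE.
exact: (quasi_state_ge0 zs.1).
Qed.

Lemma on_functions_linear f (a : R) (phi psi : R -> R) : continuous f ->
  continuous phi -> continuous psi ->
  z (fun x => a * phi (f x) + psi (f x)) = a * z (phi \o f) + z (psi \o f).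
Proof.
move=> cf cphi cpsi.
have cphif : continuous (phi \o f) by move=> x; apply: continuous_comp; [exact: cf|exact: cphi].
have cpsif : continuous (psi \o f) by move=> x; apply: continuous_comp; [exact: cf|exact: cpsi].
have gen (h : R -> R) : continuous h -> forall chf : continuous (h \o f),
    generated_by (mkcts cf) (mkcts chf).
  by move=> ch chf; exists h; [exact: continuous_subspaceT|].
have /= := quasi_state_linear zs.1 a (gen _ cphi cphif) (gen _ cpsi cpsif).
by rewrite -!on_functionsE.
Qed.

Lemma on_functionsM f (phi psi : R -> R) : continuous f ->
  continuous phi -> continuous psi ->
  z (fun x => phi (f x) * psi (f x)) = z (phi \o f) * z (psi \o f).
Proof.
move=> cf cphi cpsi.
have cphif : continuous (phi \o f) by move=> x; apply: continuous_comp; [exact: cf|exact: cphi].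
have cpsif : continuous (psi \o f) by move=> x; apply: continuous_comp; [exact: cf|exact: cpsi].
have gen (h : R -> R) : continuous h -> forall chf : continuous (h \o f),
    generated_by (mkcts cf) (mkcts chf).
  by move=> ch chf; exists h; [exact: continuous_subspaceT|].
have /= := zs.2 _ _ _ (gen _ cphi cphif) (gen _ cpsi cpsif).
by rewrite -!on_functionsE.
Qed.

Lemma on_functions1 : z (fun=> 1) = 1.
Proof. by have := quasi_state1 zs.1; rewrite -on_functionsE. Qed.

Lemma on_functions_cst (c : R) : z (fun=> c) = c.
Proof.
have c0 : continuous (fun _ : X => 0 : R) by move=> x; exact: cvg_cst.
have ck k : continuous (fun _ : R => k : R) by move=> x; exact: cvg_cst.
have h0 := on_functions_linear 1 c0 (ck 0) (ck 0).
have hc := on_functions_linear c c0 (ck 1) (ck 0).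
rewrite !mul1r !addr0 in h0; rewrite mulr1 addr0 in hc.
rewrite hc /comp on_functions1 mulr1.
have : z (fun _ : X => 0) = z (fun _ : X => 0) + z (fun _ : X => 0) by exact: h0.
by move/(congr1 (fun y => y - z (fun=> 0))); rewrite subrr addrK => <-; rewrite addr0.
Qed.

Lemma on_functions_affine f (a b : R) : continuous f ->
  z (fun x => a * f x + b) = a * z f + b.
Proof.
move=> cf; rewrite (@on_functions_linear f a id (fun=> b))//; last first.
- by move=> x; exact: cvg_cst.
- by move=> x; exact: cvg_id.
- exact: (congr1 (+%R (a * z f)) (on_functions_cst b)).
Qed.

(** Multiplicativity enters here: [zeta] of the square of [f] is the square both of [zeta] of [f]
    and of [zeta] of its absolute value, and the latter is nonnegative. *)
Lemma on_functions_norm f : continuous f -> z (fun x => `|f x|) = `|z f|.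
Proof.
move=> cf.
have cn : continuous (fun t : R => `|t|) by exact: norm_continuous.
have cnf : continuous (fun x => `|f x|).
  by move=> x; apply: (continuous_comp (cf x)); exact: cn.
have z0 : 0 <= z (fun x => `|f x|) by exact: on_functions_ge0.
have : z (fun x => `|f x|) ^+ 2 = z f ^+ 2.
  rewrite !expr2 -(on_functionsM cf cn cn) -(@on_functionsM f id id)//; try by move=> x; exact: cvg_id.
  by congr z; apply/funext => x; rewrite -!expr2 real_normK// num_real.
by rewrite -[RHS]real_normK ?num_real// => /eqP; rewrite eqrXn2// => /eqP.
Qed.

Lemma on_functions_max0 f : continuous f ->
  z (fun x => Num.max 0 (f x)) = Num.max 0 (z f).
Proof.
move=> cf.
have cn : continuous (fun t : R => `|t|) by exact: norm_continuous.
have maxE (t : R) : Num.max 0 t = 2^-1 * `|t| + 2^-1 * t.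
  by rewrite maxr_absE add0r sub0r normrN; lra.
have c2 : continuous (fun t : R => 2^-1 * t).
  by move=> t; apply: cvgM; [exact: cvg_cst|exact: cvg_id].
have := on_functions_linear 2^-1 cf cn c2.
rewrite (_ : (fun x => _ + _) = (fun x => Num.max 0 (f x))); last first.
  by apply/funext => x; rewrite maxE.
move=> ->; rewrite maxE on_functions_norm//.
by have := on_functions_affine 2^-1 0 cf; rewrite addr0 => <-; congr (_ + z _);
  apply/funext => x /=; rewrite addr0.
Qed.

(* Both functions lie in C(f - g), being its positive and negative parts. *)
Lemma on_functions_disjoint f g : continuous f -> continuous g ->
  (forall x, 0 <= f x) -> (forall x, 0 <= g x) -> (forall x, f x * g x = 0) ->
  z f * z g = 0 /\ z (fun x => f x + g x) = z f + z g.
Proof.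
move=> cf cg f0 g0 fg0.
pose h x := f x - g x.
have ch : continuous h by move=> x; apply: cvgB; [exact: cf|exact: cg].
have cp : continuous (fun t : R => Num.max 0 t).
  by apply: (@continuous_max0 R R) => t; exact: cvg_id.
have cm : continuous (fun t : R => Num.max 0 (- t)).
  by apply: (@continuous_max0 R R) => t; apply: cvgN; exact: cvg_id.
have fE : f = (fun t => Num.max 0 t) \o h.
  apply/funext => x /=; rewrite /h; have := fg0 x => /eqP.
  rewrite mulf_eq0 => /orP[/eqP fx|/eqP gx]; last by rewrite gx subr0 max_r.
  by rewrite fx sub0r max_l// oppr_le0.
have gE : g = (fun t => Num.max 0 (- t)) \o h.
  apply/funext => x /=; rewrite /h opprB; have := fg0 x => /eqP.
  rewrite mulf_eq0 => /orP[/eqP fx|/eqP gx]; first by rewrite fx subr0 max_r.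
  by rewrite gx sub0r max_l// oppr_le0.
split.
  rewrite [in z f]fE [in z g]gE -(on_functionsM ch cp cm) -[RHS](on_functions_cst 0).
  by congr z; apply/funext => x; rewrite -[RHS](fg0 x) fE gE.
have := on_functions_linear 1 ch cp cm; rewrite -fE -gE mul1r => <-.
by congr z; apply/funext => x; rewrite mul1r fE gE.
Qed.

(** The working tool below: [zeta] kills whatever is disjoint from a function on which it is
    positive, as the evaluation at a point would do. *)
Lemma on_functions_disjoint0 f g : continuous f -> continuous g ->
  (forall x, 0 <= f x) -> (forall x, 0 <= g x) -> (forall x, f x * g x = 0) ->
  0 < z g -> z f = 0.
Proof.
move=> cf cg f0 g0 fg0 zg; have [/eqP + _] := on_functions_disjoint cf cg f0 g0 fg0.
by rewrite mulf_eq0 (gt_eqF zg) orbF => /eqP.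
Qed.

Lemma on_functions_below f (m : R) : continuous f ->
  z (fun x => Num.max 0 (- f x - m)) = Num.max 0 (- z f - m).
Proof.
move=> cf; have cfm : continuous (fun x => - f x - m).
  by move=> x; apply: cvgB; [apply: cvgN; exact: cf|exact: cvg_cst].
rewrite on_functions_max0//; congr Num.max.
rewrite -(mulN1r (z f)) -on_functions_affine//; congr z; apply/funext => x.
by rewrite mulN1r.
Qed.

(* Without a common zero, (u1, u2, u3) / sum |u_i| would map to a hexagon; a simple     *)
(* quasi-state on a circle is a point evaluation, and no point of the hexagon has all  *)
(* its coordinates negative.                                                           *)
Lemma simple_quasi_state_common_zero (u1 u2 u3 : X -> R) :
  compact [set: X] -> continuous u1 -> continuous u2 -> continuous u3 ->
  (forall x, u1 x + u2 x + u3 x = 0) ->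
  z u1 < 0 -> z u2 < 0 -> z u3 < 0 -> exists x, u1 x = 0 /\ u2 x = 0.
Proof.
move=> cX c1 c2 c3 sum0 z1 z2 z3; apply: contrapT => no0.
pose N (x : X) : R := `|u1 x| + `|u2 x| + `|u3 x|.
have cnorm (h : X -> R) : continuous h -> continuous (fun x => `|h x| : R).
  by move=> ch x; apply: (continuous_comp (ch x)); exact: norm_continuous.
have cN : continuous N.
  by move=> x; apply: cvgD; [apply: cvgD|]; apply: cnorm.
have N0 x : 0 < N x.
  rewrite lt_neqAle; apply/andP; split; last by rewrite !addr_ge0.
  apply/negP => /eqP N0; apply: no0; exists x.
  have := normr_ge0 (u1 x); have := normr_ge0 (u2 x); have := normr_ge0 (u3 x).
  rewrite /N in N0 => n3 n2 n1.
  by split; apply/eqP; rewrite -normr_eq0; apply/eqP; lra.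
have [[x0 _]|X0] := pselect ([set: X] !=set0); last first.
  suff : 0 <= z u1 by rewrite leNgt z1.
  by apply: on_functions_ge0 => // x; case: X0; exists x.
have [xB _ NB] : exists2 x, x \in [set: X] & forall y, y \in [set: X] -> N y <= N x.
  by apply: compact_EVT_max => //; [exists x0|exact: continuous_subspaceT].
pose B : R := N xB; have {}NB x : N x <= B by apply: NB; rewrite inE.
have B0 : 0 < B by exact: N0.
pose pN (h : X -> R) (x : X) : R := Num.max 0 (- h x) / N x.
have cpN (h : X -> R) : continuous h -> continuous (pN h).
  move=> ch x; have chN : continuous (fun x => - h x).
    by move=> y; apply: cvgN; exact: ch.
  apply: cvgM; first exact: (continuous_max0 chN).
  by apply: cvgV; [rewrite gt_eqF|exact: cN].
have pN0 h x : 0 <= pN h x by rewrite divr_ge0 ?le_max ?lexx // ltW // N0.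
pose k := pN u1.
have ck : continuous k by exact: cpN.
pose d (h : X -> R) (m : R) (x : X) : R := Num.max 0 (- h x - m).
have cd (h : X -> R) m : continuous h -> continuous (d h m).
  by move=> ch; apply: continuous_max0 => x; apply: cvgB; [apply: cvgN; exact: ch|exact: cvg_cst].
have d0 h m x : 0 <= d h m x by rewrite le_max lexx.
have zd (h : X -> R) m : continuous h -> z h < - m -> 0 < z (d h m).
  by move=> ch zh; rewrite on_functions_below// lt_max; apply/orP; right; lra.
have cMM (f g : X -> R) : continuous f -> continuous g -> continuous (fun x => f x * g x).
  by move=> cf cg x; apply: cvgM; [exact: cf|exact: cg].
(* Where [u1] and [u] are both negative, [v] is nonnegative. So [k * pN u] is disjoint from the
   negative part of [v], on which [zeta] is positive. *)
have zMM (u v : X -> R) : continuous u -> continuous v -> z v < 0 ->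
    (forall x, u1 x < 0 -> u x < 0 -> 0 <= v x) -> z (fun x => k x * pN u x) = 0.
  move=> cu cv zv uv; apply: (@on_functions_disjoint0 _ (d v 0)) => //.
  - by apply: cMM => //; exact: cpN.
  - exact: cd.
  - by move=> x; rewrite mulr_ge0 ?pN0.
  - move=> x; rewrite /k /pN /d subr0.
    have [u1x|u1x] := leP 0 (u1 x); first by rewrite max0N_ge0// !mul0r.
    have [ux|ux] := leP 0 (u x).
      by rewrite [X in _ * (X / _)]max0N_ge0// !(mul0r, mulr0).
    by rewrite [X in _ * X]max0N_ge0 ?mulr0// uv.
  - by apply: zd => //; rewrite oppr0.
have z3' : z (fun x => k x * pN u3 x) = 0.
  by apply: (zMM _ u2) => // x u1x u3x; have := sum0 x; lra.
have z2' : z (fun x => k x * pN u2 x) = 0.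
  by apply: (zMM _ u3) => // x u1x u2x; have := sum0 x; lra.
(* By [hexagon_split], [k * (2^-1 - k)] is a sum of two disjoint functions killed by [zeta].
   Multiplicativity on the algebra generated by [k] leaves only the values 0 and [2^-1] for
   [z k]. *)
have zk : z k * (2^-1 - z k) = 0.
  have ch : continuous (fun t : R => 2^-1 - t).
    by move=> t; apply: cvgB; [exact: cvg_cst|exact: cvg_id].
  have zh : z ((fun t : R => 2^-1 - t) \o k) = 2^-1 - z k.
    rewrite [RHS]addrC -(mulN1r (z k)) -on_functions_affine//; congr z.
    by apply/funext => x /=; rewrite mulN1r addrC.
  rewrite -zh -(@on_functionsM k id)//; last by move=> t; exact: cvg_id.
  transitivity (z (fun x => k x * pN u3 x) + z (fun x => k x * pN u2 x)); last first.
    by rewrite z3' z2' addr0.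
  have [||||x|_ <-] := @on_functions_disjoint (fun x => k x * pN u3 x) (fun x => k x * pN u2 x).
  - by apply: cMM => //; exact: cpN.
  - by apply: cMM => //; exact: cpN.
  - by move=> x; rewrite mulr_ge0 ?pN0.
  - by move=> x; rewrite mulr_ge0 ?pN0.
  - rewrite /k /pN; have [u1x|u1x] := leP 0 (u1 x); first by rewrite max0N_ge0// !mul0r.
    have [u3x|u3x] := leP 0 (u3 x).
      by rewrite [X in _ * (X / _) * _]max0N_ge0// !(mul0r, mulr0).
    have [u2x|u2x] := leP 0 (u2 x); last by have := sum0 x; lra.
    by rewrite [X in _ * (_ * (X / _))]max0N_ge0// !(mul0r, mulr0).
  - by congr z; apply/funext => x; exact: (hexagon_split (sum0 x) (N0 x)).
(* Half of the minimum keeps [z u1] and [z u2] strictly below [- m]; [e] is then chosen so that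
   [e * N] never exceeds [m]. *)
pose m := Num.min (- z u1) (- z u2) / 2.
have m0 : 0 < m by rewrite divr_gt0// lt_min !oppr_gt0 z1 z2.
have m1 : z u1 < - m.
  suff : Num.min (- z u1) (- z u2) <= - z u1 by rewrite /m; lra.
  by rewrite ge_min lexx.
have m2 : z u2 < - m.
  suff : Num.min (- z u1) (- z u2) <= - z u2 by rewrite /m; lra.
  by rewrite ge_min lexx orbT.
pose e := m / B; have e0 : 0 < e by rewrite divr_gt0.
have eN x : e * N x <= m by rewrite /e mulrAC ler_pdivrMr// ler_pM2l.
move: zk => /eqP; rewrite mulf_eq0 => /orP[/eqP zk0|].
  (* Where [k < e], the value of [- u1] is less than [m]. So the positive part of [e - k] is
     disjoint from that of [- u1 - m] and is killed by [zeta], although [zeta] sends it to [e] when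
     [z k = 0]. *)
  have : z (d k (- e)) = 0.
    apply: (@on_functions_disjoint0 _ (d u1 m)) => //; [exact: cd|exact: cd| |exact: zd].
    move=> x; rewrite /d opprK; have [ke|ke] := leP e (k x).
      by rewrite [X in X * _]max_l ?mul0r// addrC subr_le0.
    rewrite [X in _ * X]max_l ?mulr0//.
    move: ke; rewrite /k /pN ltr_pdivrMr// => ke.
    have : - u1 x <= Num.max 0 (- u1 x) by rewrite le_max lexx orbT.
    by have := eN x; lra.
  by rewrite on_functions_below// zk0 max_r; lra.
rewrite subr_eq0 eq_sym => /eqP zk1.
have cNk : continuous (fun x => - k x) by move=> x; apply: cvgN; exact: ck.
(* Where [k] exceeds [2^-1 - e], less than [e * N] is left for the negative part of [u2]; the
   contradiction is the same, with [u2] in place of [u1]. *)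
have : z (d (fun x => - k x) (2^-1 - e)) = 0.
  apply: (@on_functions_disjoint0 _ (d u2 m)) => //; [exact: cd|exact: cd| |exact: zd].
  move=> x; rewrite /d opprK; have [ke|ke] := leP (k x) (2^-1 - e).
    by rewrite [X in X * _]max_l ?mul0r// subr_le0.
  rewrite [X in _ * X]max_l ?mulr0// subr_le0.
  have Nx := N0 x; have := eN x; have := sum0 x.
  move: ke; rewrite /k /pN ltr_pdivlMr// mulrBl => ke s0 ex.
  have [u2x|u2x] := leP 0 (u2 x); first by lra.
  have [u1x|u1x] := leP 0 (u1 x).
    move: ke ex; rewrite max0N_ge0// /N (ltr0_norm u2x) (ger0_norm u1x).
    by have := ler_norm (u3 x); lra.
  move: ke; rewrite max0N_lt0//.
  have u3x : 0 <= u3 x by lra.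
  move: (e * N x) ex => q qm.
  by rewrite /N (ltr0_norm u1x) (ltr0_norm u2x) (ger0_norm u3x); lra.
rewrite on_functions_below//.
suff -> : z (fun x => - k x) = - z k by rewrite zk1 max_r; lra.
rewrite -(mulN1r (z k)) -[RHS]addr0 -on_functions_affine//; congr z.
by apply/funext => x; rewrite mulN1r addr0.
Qed.

(** The functions [F - a], [G - b] and [a + b - H] add up to 0, and the three inequalities say that
    [zeta] is negative on each of them. *)
Lemma simple_quasi_state_triangle (F G H : C) (a b : R) : compact [set: X] ->
  (forall x, H x = F x + G x) -> zeta F < a -> zeta G < b -> a + b < zeta H ->
  exists x, F x = a /\ G x = b.
Proof.
move=> cX HE Fa Gb FGab.
have csub (K : C) c : continuous (fun x => K x - c).
  by move=> x; apply: cvgB; [exact: cts_fun|exact: cvg_cst].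
have caff (K : C) c : continuous (fun x => -1 * K x + c).
  move=> x; apply: cvgD; last exact: cvg_cst.
  by apply: cvgM; [exact: cvg_cst|exact: cts_fun].
have zsub (K : C) c : z (fun x => K x - c) = zeta K - c.
  rewrite -on_functionsE -[X in X - _]mul1r -on_functions_affine; last exact: cts_fun.
  by congr z; apply/funext => x; rewrite mul1r.
have [|||x||||x [/eqP + /eqP]] := @simple_quasi_state_common_zero
    (fun x => F x - a) (fun x => G x - b) (fun x => -1 * H x + (a + b)) cX.
- exact: csub.
- exact: csub.
- exact: caff.
- by rewrite /= HE; lra.
- by rewrite zsub; lra.
- by rewrite zsub; lra.
- by rewrite on_functions_affine ?on_functionsE; [lra|exact: cts_fun].
by rewrite !subr_eq0 => /eqP Fx /eqP Gx; exists x.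
Qed.

End simple_quasi_states.

(** * The area inequality in the plane *)

Section lebesgue_shift.
Context {R : realType}.
Local Notation mu := (@lebesgue_measure R).
Local Notation RR := (measurableTypeR R).

(** By uniqueness of Lebesgue measure, since the translated measure agrees with it on half-open
    intervals. *)
Lemma lebesgue_measure_shift (c : R) (A : set RR) : measurable A ->
  mu [set x | A (x + c)] = mu A.
Proof.
move=> mA.
pose f (x : RR) : RR := x + c.
have mf : measurable_fun [set: RR] f.
  by apply: (@measurable_realfun.measurable_funD _ _ R); [exact: measurable_id|exact: measurable_cst].
pose fM := isMeasurableFun.Build _ _ _ _ _ mf.
pose fm : {mfun RR >-> RR} := HB.pack f fM.
change (pushforward mu fm A = mu A).
apply/esym/lebesgue_measure_unique => //= _ [[a b]] _ <-.
rewrite /pushforward (_ : _ @^-1` _ = `](a - c), (b - c)]%classic); last first.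
  by apply/seteqP; split => x /=; rewrite /fm /= /f !in_itv/= ltrBlDr lerBrDr.
rewrite /= !lebesgue_measure_itv/= !lte_fin ltrD2r.
by case: ifPn => // _; rewrite -!EFinD; congr EFin; lra.
Qed.

Local Notation mu2 := (@lebesgue_measure R \x @lebesgue_measure R)%E.

(** Both iterated products agree on rectangles, so sections may be taken along either axis. *)
Lemma lebesgue_measure2_xy (S : set (RR * RR)) : measurable S ->
  mu2 S = (mu \x^ mu)%E S.
Proof.
move=> mS; apply: (@product_measure_unique _ _ _ _ R mu mu) => // A B mA mB.
exact: product_measure2E.
Qed.

Lemma measurable_shear_snd (k : R) :
  measurable_fun [set: RR * RR] (fun p : RR * RR => (p.1, p.2 + k * p.1) : RR * RR).
Proof.
apply/measurable_fun_pair => //=.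
apply: (@measurable_realfun.measurable_funD _ _ R); first exact: measurable_snd.
apply: (@measurable_realfun.measurable_funM _ _ R); [exact: measurable_cst|exact: measurable_fst].
Qed.

Lemma measurable_shear_fst (k : R) :
  measurable_fun [set: RR * RR] (fun p : RR * RR => (p.1 + k * p.2, p.2) : RR * RR).
Proof.
apply/measurable_fun_pair => //=.
apply: (@measurable_realfun.measurable_funD _ _ R); first exact: measurable_fst.
apply: (@measurable_realfun.measurable_funM _ _ R); [exact: measurable_cst|exact: measurable_snd].
Qed.

Lemma lebesgue_measure2_shear_snd (k : R) (S : set (RR * RR)) : measurable S ->
  mu2 [set p | S (p.1, p.2 + k * p.1)] = mu2 S.
Proof.
move=> mS; apply: eq_integral => x _ /=.
rewrite -(lebesgue_measure_shift (k * x) (measurable_xsection x mS)); congr mu.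
Qed.

Lemma lebesgue_measure2_shear_fst (k : R) (S : set (RR * RR)) : measurable S ->
  mu2 [set p | S (p.1 + k * p.2, p.2)] = mu2 S.
Proof.
move=> mS; rewrite !lebesgue_measure2_xy//; last first.
  by rewrite -[X in measurable X]setTI; exact: (measurable_shear_fst k measurableT mS).
apply: eq_integral => x _ /=.
rewrite -(lebesgue_measure_shift (k * x) (measurable_ysection x mS)); congr mu.
Qed.

Lemma lebesgue_measure_segment (a b : R) : a <= b ->
  mu `[a, b]%classic = (b - a)%:E.
Proof.
rewrite le_eqVlt => /orP[/eqP <-|ab].
  by rewrite set_itv1 lebesgue_measure_set1 subrr.
by rewrite lebesgue_measure_itv/= lte_fin ab EFinB.
Qed.

Lemma measurable_parallelogram (k l a b c d : R) : measurable
  ([set p | p.1 + l * (p.2 + k * p.1) \in `[a, b] /\ p.2 + k * p.1 \in `[c, d]]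
    : set (RR * RR)).
Proof.
pose S : set (RR * RR) := `[a, b]%classic `*` `[c, d]%classic.
have mS : measurable S by exact: measurableX.
pose S1 : set (RR * RR) := [set p | S (p.1 + l * p.2, p.2)].
have mS1 : measurable S1.
  by rewrite -[X in measurable X]setTI; exact: (measurable_shear_fst l measurableT mS).
change (measurable [set p | S1 (p.1, p.2 + k * p.1)]).
by rewrite -[X in measurable X]setTI; exact: (measurable_shear_snd k measurableT mS1).
Qed.

(** Two shears turn the parallelogram into a rectangle, and a shear only translates the sections
    along one axis. *)
Lemma lebesgue_measure2_parallelogram (k l a b c d : R) : a <= b -> c <= d ->
  mu2 [set p | p.1 + l * (p.2 + k * p.1) \in `[a, b] /\ p.2 + k * p.1 \in `[c, d]]
    = ((b - a) * (d - c))%:E.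
Proof.
move=> ab cd; pose S : set (RR * RR) := `[a, b]%classic `*` `[c, d]%classic.
have mS : measurable S by exact: measurableX.
pose S1 : set (RR * RR) := [set p | S (p.1 + l * p.2, p.2)].
have mS1 : measurable S1.
  by rewrite -[X in measurable X]setTI; exact: (measurable_shear_fst l measurableT mS).
change (mu2 [set p | S1 (p.1, p.2 + k * p.1)] = ((b - a) * (d - c))%:E).
rewrite lebesgue_measure2_shear_snd// lebesgue_measure2_shear_fst//.
transitivity (mu `[a, b]%classic * mu `[c, d]%classic)%E; first exact: product_measure1E.
by rewrite !lebesgue_measure_segment // EFinM.
Qed.

End lebesgue_shift.

(** * Images of small squares under nearly linear maps *)

Section linear_estimate.
Context {R : realType}.
Local Notation mu := (@lebesgue_measure R).
Local Notation RR := (measurableTypeR R).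
Local Notation mu2 := (mu \x mu)%E.
Implicit Types S : set (R * R).

Lemma mu_ext_le_measurable (S T : set (RR * RR)) : measurable T -> S `<=` T ->
  (mu_ext mu2 S <= mu2 T)%E.
Proof. by move=> mT ST; rewrite -measurable_mu_extE//; exact: le_mu_ext. Qed.

Lemma mem_hull0 (q t delta : R) : 0 <= t <= delta ->
  Num.min 0 (q * delta) <= q * t <= Num.max 0 (q * delta).
Proof.
move=> /andP[t0 td]; rewrite ge_min le_max; have [q0|q0] := leP 0 q.
  by rewrite mulr_ge0//= ler_wpM2l// orbT.
have -> : q * t <= 0 by rewrite mulr_le0_ge0// ltW.
by rewrite /= andbT ler_nM2l// td orbT.
Qed.

Lemma hull0_length (q delta : R) : 0 <= delta ->
  Num.max 0 (q * delta) - Num.min 0 (q * delta) = `|q| * delta.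
Proof.
move=> d0; have [q0|q0] := leP 0 q.
  by have q0' := mulr_ge0 q0 d0; rewrite max_r// min_l// subr0 ger0_norm.
have q0' : q * delta <= 0 by rewrite mulr_le0_ge0// ltW.
by rewrite max_l// min_r// sub0r ltr0_norm// mulNr.
Qed.

(** The neighbourhood of radius [r], for the sup norm, of the image of a square of side [delta]
    under an affine map with matrix rows [(a, b)] and [(c, d)]. *)
Definition near_linear_image (a b c d x0 y0 delta r : R) : set (R * R) :=
  [set p | exists s t, [/\ 0 <= s <= delta, 0 <= t <= delta,
    `|p.1 - (x0 + a * s + b * t)| <= r & `|p.2 - (y0 + c * s + d * t)| <= r]].

(** Two shears straighten the parallelogram: the first, of slope [k], removes [s] from the second
    coordinate, leaving [(e / a) * t]; the second, of slope [l], removes [t] from the first. The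
    error widens each side by a multiple of [eta * delta]. If the determinant [e] is 0, then [t]
    stays in the first coordinate, but the second one ranges over the error alone. *)
Lemma near_linear_image_small0 (a b c d : R) : a != 0 ->
  exists2 K, 0 <= K & forall x0 y0 delta eta, 0 < delta -> 0 < eta <= 1 ->
    (mu_ext mu2 (near_linear_image a b c d x0 y0 delta (eta * delta)) <=
      ((`|a * d - b * c| + K * eta) * delta ^+ 2)%:E)%E.
Proof.
move=> a0; pose k := c / a; pose e := a * d - b * c.
pose l := if e == 0 then 0 else a * b / e.
pose A := if e == 0 then `|a| + `|b| else `|a|.
pose m1 := 1 + `|k|; pose m2 := 1 + `|l| * m1.
have m10 : 0 <= m1 by rewrite addr_ge0.
have m20 : 0 <= m2 by rewrite addr_ge0// mulr_ge0.
have A0 : 0 <= A by rewrite /A; case: ifP => _ //; rewrite addr_ge0.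
have eA : `|e / a| * A = `|e|.
  rewrite /A; case: eqP => [->|_]; first by rewrite mul0r normr0 mul0r.
  by rewrite normrM normfV mulfVK// normr_eq0.
pose K := `|e / a| * (2 * m2) + 2 * m1 * A + 4 * m1 * m2.
exists K; first by rewrite !addr_ge0// !mulr_ge0.
move=> x0 y0 delta eta d0 /andP[eta0 eta1].
set S := near_linear_image _ _ _ _ _ _ _ _.
pose v0 := y0 - k * x0.
pose w0 := x0 - l * v0.
pose lo q := Num.min 0 (q * delta); pose hi q := Num.max 0 (q * delta).
pose E1 := m1 * (eta * delta).
pose E2 := m2 * (eta * delta).
have ed0 : 0 <= eta * delta by rewrite mulr_ge0// ltW.
pose wlo := if e == 0 then lo a + lo b else lo a.
pose whi := if e == 0 then hi a + hi b else hi a.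
have hl q : hi q - lo q = `|q| * delta by rewrite hull0_length// ltW.
have lenw : whi - wlo = A * delta.
  rewrite /whi /wlo /A; case: ifP => _; last by rewrite hl.
  by rewrite opprD addrACA !hl mulrDl.
have key : S `<=` [set p | p.1 + - l * (p.2 + - k * p.1) \in `[w0 + wlo - E2, w0 + whi + E2] /\
     p.2 + - k * p.1 \in `[v0 + lo (e / a) - E1, v0 + hi (e / a) + E1]].
  move=> [x y] [s [t [s0 t0]]] /=; set r1 := x - _; set r2 := y - _ => hr1 hr2.
  have xE : x = x0 + a * s + b * t + r1 by rewrite /r1; lra.
  have yE : y = y0 + c * s + d * t + r2 by rewrite /r2; lra.
  clearbody r1 r2; subst x y.
  pose err := r2 - k * r1.
  have herr : `|err| <= E1.
    rewrite /E1 /m1 mulrDl mul1r (le_trans (ler_normB _ _))// lerD// normrM.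
    by rewrite ler_wpM2l.
  have vE : y0 + c * s + d * t + r2 + - k * (x0 + a * s + b * t + r1) =
      v0 + (e / a) * t + err.
    by rewrite /v0 /err /e /k; field.
  have hv := mem_hull0 (e / a) t0; rewrite -/(lo _) -/(hi _) in hv.
  rewrite vE !in_itv /=; split; last first.
    by move: herr hv; rewrite ler_norml => /andP[? ?] /andP[? ?]; apply/andP; split; lra.
  have ha := mem_hull0 a s0; rewrite -/(lo _) -/(hi _) in ha.
  have hb := mem_hull0 b t0; rewrite -/(lo _) -/(hi _) in hb.
  have hle : `|r1 - l * err| <= E2.
    rewrite /E2 /m2 mulrDl mul1r (le_trans (ler_normB _ _))// lerD// normrM.
    by rewrite -mulrA ler_wpM2l.
  have wE : x0 + a * s + b * t + r1 + - l * (v0 + e / a * t + err) =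
      w0 + a * s + (if e == 0 then b * t else 0) + (r1 - l * err).
    rewrite /w0 /l; case: eqP => [_|/eqP e0]; first by lra.
    by field; rewrite a0 e0.
  rewrite wE.
  rewrite /wlo /whi; case: ifP => _; move: hle ha hb; rewrite ler_norml =>
    /andP[? ?] /andP[? ?] /andP[? ?]; apply/andP; split; lra.
apply: (@le_trans _ _ (mu2 [set p | p.1 + - l * (p.2 + - k * p.1) \in `[w0 + wlo - E2, w0 + whi + E2] /\
     p.2 + - k * p.1 \in `[v0 + lo (e / a) - E1, v0 + hi (e / a) + E1]])).
  by apply: mu_ext_le_measurable => //; exact: measurable_parallelogram.
have E10 : 0 <= E1 by rewrite mulr_ge0.
have E20 : 0 <= E2 by rewrite mulr_ge0.
have hle q : lo q <= hi q by rewrite -subr_ge0 hl mulr_ge0// ltW.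
rewrite lebesgue_measure2_parallelogram; last 2 first.
- have : wlo <= whi by rewrite -subr_ge0 lenw mulr_ge0// ltW.
  by lra.
- by have := hle (e / a); lra.
rewrite lee_fin.
have -> : w0 + whi + E2 - (w0 + wlo - E2) = (A + 2 * m2 * eta) * delta.
  by rewrite mulrDl -lenw /E2; lra.
have -> : v0 + hi (e / a) + E1 - (v0 + lo (e / a) - E1) = (`|e / a| + 2 * m1 * eta) * delta.
  by have := hl (e / a); rewrite /E1; lra.
rewrite mulrACA -expr2 ler_pM2r ?exprn_gt0//.
rewrite -eA /K; set q := `|e / a|.
(* The product of the two widths has a term in [eta ^+ 2], absorbed into [K * eta] because
   [eta <= 1]. *)
have : 0 <= m1 * m2 * eta * (1 - eta).
  have e1 : 0 <= 1 - eta by rewrite subr_ge0.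
  by rewrite !mulr_ge0// ltW.
by clearbody q A m2 m1; lra.
Qed.

(** Exchanging [s] and [t] brings a nonzero [b] to the place of [a]; if both vanish, the set lies in
    a rectangle of width [2 * eta * delta]. *)
Lemma near_linear_image_small (a b c d : R) :
  exists2 K, 0 <= K & forall x0 y0 delta eta, 0 < delta -> 0 < eta <= 1 ->
    (mu_ext mu2 (near_linear_image a b c d x0 y0 delta (eta * delta)) <=
      ((`|a * d - b * c| + K * eta) * delta ^+ 2)%:E)%E.
Proof.
have [a0|a0] := eqVneq a 0; last exact: near_linear_image_small0.
have [b0|b0] := eqVneq b 0; last first.
  have [K K0 HK] := near_linear_image_small0 a d c b0.
  exists K => // x0 y0 delta eta d0 eta01.
  have -> : near_linear_image a b c d x0 y0 delta (eta * delta) =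
      near_linear_image b a d c x0 y0 delta (eta * delta).
    by apply/seteqP; split => p [s [t [s0 t0 p1 p2]]]; exists t, s; split => //;
      rewrite addrAC.
  by rewrite distrC; exact: HK.
subst a b; rewrite !mul0r subrr normr0.
pose m := `|c| + `|d| + 1; have m0 : 0 <= m by rewrite !addr_ge0.
exists (4 * m); first by rewrite mulr_ge0.
move=> x0 y0 delta eta d0 /andP[eta0 eta1].
have ed : eta * delta <= delta by rewrite -[leRHS]mul1r ler_wpM2r// ltW.
have ed0 : 0 < eta * delta by rewrite mulr_gt0.
apply: (@le_trans _ _ (mu2 [set p | p.1 + 0 * (p.2 + 0 * p.1) \in `[x0 - eta * delta, x0 + eta * delta] /\
     p.2 + 0 * p.1 \in `[y0 - m * delta, y0 + m * delta]])).
  apply: mu_ext_le_measurable; first exact: measurable_parallelogram.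
  move=> [x y] [s [t [/andP[s0 s1] /andP[t0 t1]]]] /=.
  rewrite !mul0r !addr0 !in_itv /= -ler_distl => -> h; split => //.
  rewrite -ler_distl (_ : y - y0 = (y - (y0 + c * s + d * t)) + (c * s + d * t)); last by lra.
  rewrite (le_trans (ler_normD _ _))// addrC /m mulrDl mul1r lerD//; last exact: le_trans ed.
  rewrite (le_trans (ler_normD _ _))// mulrDl !normrM lerD// ler_wpM2l//.
    by rewrite ger0_norm.
  by rewrite ger0_norm.
rewrite lebesgue_measure2_parallelogram; last 2 first.
- by lra.
- by have : 0 <= m * delta by [rewrite mulr_ge0// ltW]; lra.
by rewrite lee_fin add0r expr2; lra.
Qed.
End linear_estimate.

(** * Differentiability in the plane from continuous partial derivatives *)

Section plane_differential.
Context {R : realType}.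
Implicit Types (f g : R * R -> R) (p q : R * R).

Definition slice (b : bool) p (t : R) : R * R := if b then (p.1, t) else (t, p.2).
Lemma slice_derive b f p (t : R) : derivable f (slice b p t) (axis b) ->
  is_derive t 1 (f \o slice b p) (partial b f (slice b p t)).
Proof.
move=> df.
have E : (fun h : R => h^-1 *: ((f \o shift (slice b p t)) (h *: axis b) - f (slice b p t))) =
    (fun h : R => h^-1 *: (((f \o slice b p) \o shift t) (h *: (1 : R)) - (f \o slice b p) t)).
  apply/funext => h /=; congr (_ *: (f _ - _)).
  rewrite /slice /axis; case: (b); congr pair => /=.
  - by rewrite scaler0 add0r.
  - by rewrite scaler0 add0r.
by split; [rewrite /derivable -E|rewrite /derive -E].
Qed.

(** The mean value theorem, with [h] compared to a linear function of slope [c]; the endpoints may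
    come in either order. *)
Lemma derive_lipschitz (h : R -> R) (x y c e : R) :
  (forall t, Num.min x y <= t <= Num.max x y -> derivable h t 1) ->
  (forall t, Num.min x y <= t <= Num.max x y -> `|'D_1 h t - c| <= e) ->
  `|h y - h x - c * (y - x)| <= e * `|y - x|.
Proof.
wlog xy : x y / x <= y.
  move=> H dh he; have [xy|yx] := leP x y; first exact: H.
  have := H y x (ltW yx); rewrite minC maxC => /(_ dh he).
  rewrite (distrC x y) => H'; rewrite -normrN; apply: le_trans H'; rewrite le_eqVlt.
  by apply/orP; left; apply/eqP; congr `|_|; lra.
rewrite min_l// max_r// => dh he.
have dH t : x <= t <= y -> is_derive t 1 h ('D_1 h t).
  by move=> /dh; exact: derivableP.
have [||z zxy zE] := @MVT_segment R h ('D_1 h) x y xy.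
- by move=> t; rewrite in_itv /= => /andP[/ltW xz /ltW zy]; apply: dH; rewrite xz.
- apply: derivable_within_continuous => t; rewrite in_itv /=; exact: dh.
rewrite zE -mulrBl normrM ler_wpM2r// he//.
Qed.

End plane_differential.
Section first_order.
Context {R : realType} {V W : normedModType R}.
Implicit Types (f : V -> W) (x : V).

Lemma is_diff_first_order f (df : {linear V -> W}) x : continuous df ->
  (forall e, 0 < e -> \forall y \near x, `|f y - f x - df (y - x)| <= e * `|y - x|) ->
  is_diff x f df.
Proof.
move=> cdf H.
have E : f \o shift x = cst (f x) + df +o_ 0 id.
  apply/eqaddoP => _/posnumP[e]; have := H e%:num ltac:(by []).
  rewrite [X in X -> _](near_shift 0) subr0; apply: filterS => y /=.
  by rewrite addrK opprD addrA.
have dE : 'd f x = df :> (_ -> _) by apply: diff_unique.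
by split => //; apply/diff_locallyP; rewrite dE.
Qed.

Lemma differentiable_first_order f x (e : R) : differentiable f x -> 0 < e ->
  \forall y \near x, `|f y - f x - 'd f x (y - x)| <= e * `|y - x|.
Proof.
move=> df e0; have /diff_locally/eqaddoP/(_ _ e0) := df.
rewrite [X in X -> _](near_shift x) sub0r; apply: filterS => y /=.
by rewrite -[(_ - _ : _ -> _) _]/(_ - _) -[(_ + _ : _ -> _) _]/(_ + _) /= subrK opprD addrA.
Qed.

End first_order.

Section plane_gradient.
Context {R : realType}.
Implicit Types (f g : R * R -> R) (p q : R * R).

Definition lin2 (a b : R) (v : R * R) : R := a * v.1 + b * v.2.

Fact lin2_is_linear (a b : R) : linear (lin2 a b).
Proof. by move=> k u v; rewrite /lin2 /= -[k *: lin2 _ _ _]/(k * _) /GRing.scale /= /lin2; lra. Qed.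

HB.instance Definition _ (a b : R) := GRing.isLinear.Build R (R * R)%type R _ (lin2 a b)
  (lin2_is_linear a b).

Lemma lin2_continuous (a b : R) : continuous (lin2 a b).
Proof.
move=> x; apply: cvgD; apply: cvgM; try exact: cvg_cst; [exact: cvg_fst|exact: cvg_snd].
Qed.

Lemma normr_fst_le (v : R * R) : `|v.1| <= `|v|.
Proof. by rewrite [leRHS]/Num.norm /= le_max lexx. Qed.

Lemma normr_snd_le (v : R * R) : `|v.2| <= `|v|.
Proof. by rewrite [leRHS]/Num.norm /= le_max lexx orbT. Qed.

Lemma is_diff_approx f p (a b : R) :
  (forall e, 0 < e -> \forall q \near p, `|f q - f p - lin2 a b (q - p)| <= e * `|q - p|) ->
  is_diff p f (lin2 a b).
Proof. by move=> H; apply: is_diff_first_order => //; exact: lin2_continuous. Qed.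

Lemma is_diff_lin2 f p : differentiable f p ->
  is_diff p f (lin2 (partial false f p) (partial true f p)).
Proof.
move=> df; split => //; apply/funext => -[x y].
rewrite /partial !deriveE// /lin2 /=.
have -> : (x, y) = x *: axis false + y *: axis true :> R * R.
  by rewrite /axis; congr pair; rewrite /= /GRing.scale /=; lra.
by rewrite linearD !linearZ /= /GRing.scale /= mulrC (mulrC y).
Qed.

Lemma differentiable_approx f p (e : R) : differentiable f p -> 0 < e ->
  \forall q \near p,
    `|f q - f p - lin2 (partial false f p) (partial true f p) (q - p)| <= e * `|q - p|.
Proof.
move=> df e0; have [_ dE] := is_diff_lin2 df; rewrite -dE.
exact: differentiable_first_order.
Qed.

Lemma partial_is_diff f p (a b : R) : is_diff p f (lin2 a b) ->
  partial false f p = a /\ partial true f p = b.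
Proof.
move=> [df dE]; rewrite /partial !deriveE// dE /lin2 /axis /=; split; lra.
Qed.

(** From [p] to [q] one moves along two segments parallel to the axes, on each of which the mean
    value inequality applies; by continuity the slopes stay within [e / 2] of those at [p]. *)
Lemma continuous_partials_differentiable f p :
  (\forall q \near p, forall b, derivable f q (axis b)) ->
  (forall b, {for p, continuous (partial b f)}) -> differentiable f p.
Proof.
move=> df cf; pose a := partial false f p; pose b := partial true f p.
suff H : is_diff p f (lin2 a b) by exact: ex_diff.
apply: is_diff_approx => e e0.
have e20 : 0 < e / 2 by rewrite divr_gt0.
have near_b c : \forall q \near p, `|partial c f q - partial c f p| <= e / 2.
  have /cvgr_dist_le := cf c => /(_ _ e20); apply: filterS => q.
  by rewrite distrC.
have : \forall q \near p, (forall c, derivable f q (axis c)) /\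
     forall c, `|partial c f q - partial c f p| <= e / 2.
  by apply: filterS3 df (near_b false) (near_b true) => q dq ? ?; split; [exact: dq|by case].
move=> /nbhs_ballP[r /= r0 Hr].
near=> q.
have pq : ball p r q by near: q; exact: nbhsx_ballx.
have [pq1 pq2] : ball p.1 r q.1 /\ ball p.2 r q.2 by [].
have btw (x y t : R) : ball x r y -> Num.min x y <= t <= Num.max x y -> ball x r t.
  rewrite /ball /= !ltr_distlC ge_min le_max => /andP[y1 y2] /andP[].
  by move=> /orP[] ? /orP[] ?; apply/andP; split; lra.
have H1 : `|f (q.1, q.2) - f (p.1, q.2) - a * (q.1 - p.1)| <= e / 2 * `|q.1 - p.1|.
  have in1 t : Num.min p.1 q.1 <= t <= Num.max p.1 q.1 -> ball p r (t, q.2).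
    by move=> /(btw _ _ _ pq1) ?; split.
  apply: (@derive_lipschitz _ (f \o slice false q)) => t /in1/Hr[dt ct].
    by apply: ex_derive; apply: slice_derive; exact: dt.
  have dt' := slice_derive (dt false : derivable f (slice false q t) (axis false)).
  by rewrite derive_val; exact: ct.
have H2 : `|f (p.1, q.2) - f (p.1, p.2) - b * (q.2 - p.2)| <= e / 2 * `|q.2 - p.2|.
  have in2 t : Num.min p.2 q.2 <= t <= Num.max p.2 q.2 -> ball p r (p.1, t).
    by move=> /(btw _ _ _ pq2) ?; split => //; exact: ballxx.
  apply: (@derive_lipschitz _ (f \o slice true p)) => t /in2/Hr[dt ct].
    by apply: ex_derive; apply: slice_derive; exact: dt.
  have dt' := slice_derive (dt true : derivable f (slice true p t) (axis true)).
  by rewrite derive_val; exact: ct.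
have n1 := ler_wpM2l (ltW e20) (normr_fst_le (q - p)).
have n2 := ler_wpM2l (ltW e20) (normr_snd_le (q - p)).
rewrite /lin2 (_ : f q - f p - _ = (f (q.1, q.2) - f (p.1, q.2) - a * (q.1 - p.1)) +
  (f (p.1, q.2) - f (p.1, p.2) - b * (q.2 - p.2))); last first.
  by rewrite -!surjective_pairing /=; lra.
by rewrite (le_trans (ler_normD _ _))//; lra.
Unshelve. all: by end_near. Qed.

End plane_gradient.

(** * Dyadic cells *)

Section dyadic.
Context {R : realType}.
Local Notation mu := (@lebesgue_measure R).
Local Notation RR := (measurableTypeR R).
Local Notation mu2 := (mu \x mu)%E.

Definition dyadic_index (n : nat) (p : R * R) : int * int :=
  (Num.floor (2 ^+ n * p.1), Num.floor (2 ^+ n * p.2)).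

Definition cell (n : nat) (c : int * int) : set (R * R) := [set p | dyadic_index n p = c].

Lemma cellE n c : cell n c =
  `[c.1%:~R / 2 ^+ n, (c.1 + 1)%:~R / 2 ^+ n[%classic `*`
  `[c.2%:~R / 2 ^+ n, (c.2 + 1)%:~R / 2 ^+ n[%classic.
Proof.
have n0 : 0 < 2 ^+ n :> R by rewrite exprn_gt0.
have H (k : int) (x : R) : Num.floor (2 ^+ n * x) = k <->
    x \in `[k%:~R / 2 ^+ n, (k + 1)%:~R / 2 ^+ n[.
  rewrite in_itv /= ler_pdivrMr// ltr_pdivlMr// mulrC; split.
    by move=> <-; rewrite floor_le floorD1_gt.
  by move=> /andP[? ?]; apply: floor_def; apply/andP.
case: c => k l; apply/seteqP; split => -[x y] /=; rewrite /cell /dyadic_index /=.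
  by move=> [/H ? /H ?].
by move=> [/H -> /H ->].
Qed.

Lemma measurable_cell n c : measurable (cell n c : set (RR * RR)).
Proof. by rewrite cellE; exact: measurableX. Qed.

Lemma lebesgue_measure2_cell n c : mu2 (cell n c) = (((2 ^+ n)^-1 ^+ 2 : R))%:E.
Proof.
rewrite cellE; have n0 : 0 < 2 ^+ n :> R by rewrite exprn_gt0.
have H (k : int) : mu `[k%:~R / 2 ^+ n, (k + 1)%:~R / 2 ^+ n[%classic = ((2 ^+ n)^-1)%:E.
  rewrite lebesgue_measure_itv /= lte_fin ltr_pM2r ?invr_gt0// ltr_int ltzD1 lexx.
  by rewrite -EFinB -mulrBl intrD addrAC subrr add0r mul1r.
rewrite expr2 EFinM -{1}(H c.1) -(H c.2); exact: product_measure1E.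
Qed.

Lemma dyadic_index_dist n (p q : R * R) : dyadic_index n p = dyadic_index n q ->
  `|p - q| <= (2 ^+ n)^-1.
Proof.
have n0 : 0 < 2 ^+ n :> R by rewrite exprn_gt0.
have H (x y : R) : Num.floor (2 ^+ n * x) = Num.floor (2 ^+ n * y) -> `|x - y| <= (2 ^+ n)^-1.
  move=> xy; have := floor_le (2 ^+ n * x); have := floorD1_gt (2 ^+ n * x).
  have := floor_le (2 ^+ n * y); have := floorD1_gt (2 ^+ n * y).
  rewrite xy intrD => h1 h2 h3 h4.
  rewrite -(ler_pM2l n0) divff ?gt_eqF// -[X in X * _]gtr0_norm// -normrM mulrBr ler_norml.
  by apply/andP; split; lra.
by move=> [/H h1 /H h2]; rewrite /Num.norm /= ge_max h1.
Qed.

(** Cells are nested: the floor at level [j] is the integer half of the floor at level [j.+1]. *)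
Lemma dyadic_index_le n m (p q : R * R) : (n <= m)%N ->
  dyadic_index m p = dyadic_index m q -> dyadic_index n p = dyadic_index n q.
Proof.
move=> /subnKC <-; elim: (m - n)%N => [|k IH]; rewrite ?addn0// addnS.
move=> H; apply: IH; move: H; set j := (n + k)%N.
have F (x : R) : Num.floor (2 ^+ j * x) = (Num.floor (2 ^+ j.+1 * x) %/ 2)%Z.
  apply: floor_def; set z := 2 ^+ j.+1 * x.
  have -> : 2 ^+ j * x = z / 2 by rewrite /z exprS; field.
  have zE := divz_eq (Num.floor z) 2.
  have z0 : 0 <= (Num.floor z %% 2)%Z by exact: modz_ge0.
  have z1 : (Num.floor z %% 2)%Z < 2 by exact: ltz_pmod.
  have zl := floor_le z; have zu := floorD1_gt z.
  move: zE z0 z1; set q0 := (_ %/ _)%Z; set r := (_ %% _)%Z => zE z0 z1; clearbody q0 r.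
  rewrite zE !intrD intrM in zl zu.
  rewrite -[2%:~R]/(2 : R) in zl zu; rewrite -[1%:~R]/(1 : R) in zu.
  have r0 : (0 : R) <= r%:~R by rewrite ler0z.
  have r1 : (r%:~R : R) <= 1 by rewrite -[1]/(1%:~R) ler_int -ltzD1.
  by rewrite intrD -[1%:~R]/(1 : R); apply/andP; split; lra.
by rewrite /dyadic_index !F => -[-> ->].
Qed.

Lemma small_dyadic (e : R) : 0 < e -> exists N, forall n, (N <= n)%N -> (2 ^+ n)^-1 < e.
Proof.
move=> e0; exists (Num.bound e^-1) => n Nn.
rewrite invf_plt ?posrE ?exprn_gt0//.
apply: lt_le_trans (archi_boundP _) _; first by rewrite invr_ge0 ltW.
rewrite (le_trans (_ : _ <= n%:R))// ?ler_nat//.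
by rewrite -natrX ler_nat ltnW// ltn_expl.
Qed.

Lemma near_cell (p : R * R) (P : set (R * R)) : (\forall q \near p, P q) ->
  exists N, forall n, (N <= n)%N -> cell n (dyadic_index n p) `<=` P.
Proof.
move=> /nbhs_ballP[r /= r0 rP]; have [N HN] := small_dyadic r0.
exists N => n Nn q /dyadic_index_dist pq; apply: rP.
rewrite -ball_normE /ball_ /= distrC; apply: le_lt_trans pq _; exact: HN.
Qed.

End dyadic.

(** * Images of open sets *)

Section images.
Context {R : realType}.
Local Notation mu := (@lebesgue_measure R).
Local Notation RR := (measurableTypeR R).
Local Notation mu2 := (mu \x mu)%E.

(** Each point is assigned its cell at the first level where that cell is good. By nesting, all
    points of a cell share the cells of lower levels, so each piece is empty or a full cell. The
    pieces are numbered by [pickle] on pairs of a level and a cell. *)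
Lemma dyadic_tiling (O : set (R * R)) (good : nat -> int * int -> Prop) :
  (forall n c, good n c -> cell n c `<=` O) ->
  (forall p, O p -> exists n, good n (dyadic_index n p)) ->
  exists F : (set (R * R))^nat, [/\ trivIset setT F, \bigcup_k F k = O &
    forall k, F k = set0 \/ exists2 nc, good nc.1 nc.2 & F k = cell nc.1 nc.2].
Proof.
move=> goodO exgood.
pose first (n : nat) (p : R * R) := good n (dyadic_index n p) /\
  forall m, (m < n)%N -> ~ good m (dyadic_index m p).
have first_uniq n m p : first n p -> first m p -> n = m.
  by move=> [gn ln] [gm lm]; case: (ltngtP n m) => // [/lm|/ln].
have exfirst p : O p -> exists n, first n p.
  move=> /exgood Hp; pose P n := `[< good n (dyadic_index n p) >].
  have exP : exists n, P n by case: Hp => n gn; exists n; exact/asboolP.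
  exists (ex_minn exP); case: ex_minnP => n /asboolP gn ln; split => // m mn gm.
  by have /ln := introT (asboolP _) gm; rewrite leqNgt mn.
pose F k : set (R * R) := if (pickle_inv k : option (nat * (int * int))) is Some (n, c) then
  [set p | dyadic_index n p = c /\ first n p] else set0.
exists F; split.
- apply/trivIsetP => i j _ _ ij; apply/seteqP; split => // p [].
  rewrite /F; case ui : (pickle_inv i) => [[n c]|//]; case uj : (pickle_inv j) => [[m d]|//].
  move=> [ci fi] [cj fj]; have nm := first_uniq _ _ _ fi fj; subst m.
  have cd : c = d by rewrite -ci -cj.
  subst d; case/eqP: ij.
  have := pickle_invK i : oapp pickle i (pickle_inv i : option (nat * (int * int))) = i.
  have := pickle_invK j : oapp pickle j (pickle_inv j : option (nat * (int * int))) = j.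
  by rewrite ui uj /= ci => <- <-.
- apply/seteqP; split => [p [k _]|p Op].
    rewrite /F; case: (pickle_inv k) => [[n c]|//] [pc [gn _]]; rewrite pc in gn; exact: (goodO _ _ gn).
  have [n fn] := exfirst _ Op; exists (pickle (n, dyadic_index n p)) => //.
  by rewrite /F pickleK_inv.
- move=> k; rewrite /F; case: (pickle_inv k) => [[n c]|]; last by left.
  have [[p [pc fp]]|no] := pselect (exists p, dyadic_index n p = c /\ first n p).
    right; exists (n, c) => /=; first by rewrite -pc; exact: fp.1.
    apply/seteqP; split => [q [qc _]//|q qc]; split => //.
    have qp : dyadic_index n q = dyadic_index n p by rewrite pc.
    split; first by rewrite qp; exact: fp.1.
    by move=> m mn; rewrite (dyadic_index_le (ltnW mn) qp); exact: fp.2.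
  by left; apply/seteqP; split => // q qc; apply: no; exists q.
Qed.

(** Measurability refers to the product of the Borel sigma-algebras; a tiling by cells, which are
    rectangles, provides it. *)
Lemma open_measurable2 (O : set (R * R)) : open O -> measurable (O : set (RR * RR)).
Proof.
move=> oO.
have [|p Op|F [_ <- HF]] := @dyadic_tiling O (fun n c => cell n c `<=` O); first by [].
  by have [N HN] := near_cell (open_nbhs_nbhs (conj oO Op)); exists N; exact: HN.
apply: bigcupT_measurable => k; have [->|[nc _ ->]] := HF k; first exact: measurable0.
exact: measurable_cell.
Qed.

Lemma open_continuous_measurable_fun2 (O : set (R * R)) (f : R * R -> R) : open O ->
  (forall p, O p -> {for p, continuous f}) ->
  measurable_fun (O : set (RR * RR)) (f : RR * RR -> RR).
Proof.
move=> oO cf; apply: (measurability _ (measurable_realfun.RGenOInfty.measurableE R)).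
move=> /= _ [_ [a ->]] <-; apply: open_measurable2.
rewrite openE => p [Op /=]; rewrite in_itv/= andbT => afp.
have h1 : \forall q \near p, O q by exact: open_nbhs_nbhs.
have h2 : \forall q \near p, a < f q.
  exact: (cvgr_gt (f p) (cf p Op) _ afp).
apply: filterS2 h1 h2 => q Oq aq; split => //=.
by rewrite in_itv /= aq.
Qed.

(** On a small cell [Psi] is within [eta * delta] of its affine approximation at [p], so the image
    of the cell is contained in a near linear image of a square. *)
Lemma differentiable_cell_image (Psi : R * R -> R * R) (p : R * R) (e : R) : 0 < e ->
  differentiable (fun q => (Psi q).1) p -> differentiable (fun q => (Psi q).2) p ->
  exists N, forall n, (N <= n)%N -> let c := dyadic_index n p in
    (mu_ext mu2 (Psi @` cell n c) <= (`|jacobian_map Psi p| + e)%:E * mu2 (cell n c))%E.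
Proof.
move=> e0 d1 d2; set f1 := (fun q => _) in d1; set f2 := (fun q => _) in d2.
have [K K0 HK] := near_linear_image_small (partial false f1 p) (partial true f1 p)
  (partial false f2 p) (partial true f2 p).
(* Chosen so that [K * eta <= e]; dividing by [K + 1] allows [K = 0]. *)
pose eta := Num.min 1 (e / (K + 1)).
have K1 : 0 < K + 1 by rewrite ltr_wpDl.
have eta0 : 0 < eta by rewrite lt_min ltr01 divr_gt0.
have eta1 : eta <= 1 by rewrite ge_min lexx.
have Keta : K * eta <= e.
  have : eta <= e / (K + 1) by rewrite ge_min lexx orbT.
  by rewrite ler_pdivlMr// mulrDr mulr1 mulrC; have := ltW eta0; lra.
have [N1 H1] := near_cell (differentiable_approx d1 eta0).
have [N2 H2] := near_cell (differentiable_approx d2 eta0).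
exists (maxn N1 N2) => n Nn; set c := dyadic_index n p => /=.
have {}H1 := H1 n (leq_trans (leq_maxl _ _) Nn).
have {}H2 := H2 n (leq_trans (leq_maxr _ _) Nn).
pose delta : R := (2 ^+ n)^-1.
have delta0 : 0 < delta by rewrite invr_gt0 exprn_gt0.
(* [z] is the lower left corner of the cell, and [(x0, y0)] is the value there of the affine
   approximation at [p]. *)
pose z : R * R := (c.1%:~R * delta, c.2%:~R * delta).
pose x0 := f1 p - lin2 (partial false f1 p) (partial true f1 p) (p - z).
pose y0 := f2 p - lin2 (partial false f2 p) (partial true f2 p) (p - z).
apply: (@le_trans _ _ (mu_ext mu2 (near_linear_image (partial false f1 p) (partial true f1 p)
  (partial false f2 p) (partial true f2 p) x0 y0 delta (eta * delta)))).
  apply: le_mu_ext => _ [q qc <-].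
  have := qc; rewrite cellE => -[/=]; rewrite !in_itv /= => /andP[q1 q1'] /andP[q2 q2'].
  have qp : eta * `|q - p| <= eta * delta.
    by rewrite ler_pM2l//; apply: dyadic_index_dist.
  exists (q.1 - z.1), (q.2 - z.2); split.
  - by rewrite subr_ge0 q1 lerBlDl /= -[X in _ + X]mul1r -mulrDl -[1]/(1%:~R) -intrD ltW.
  - by rewrite subr_ge0 q2 lerBlDl /= -[X in _ + X]mul1r -mulrDl -[1]/(1%:~R) -intrD ltW.
  - apply: le_trans qp; apply: le_trans (H1 q qc); rewrite le_eqVlt; apply/orP; left; apply/eqP.
    by congr `|_|; rewrite /x0 /lin2 /= /f1; lra.
  - apply: le_trans qp; apply: le_trans (H2 q qc); rewrite le_eqVlt; apply/orP; left; apply/eqP.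
    by congr `|_|; rewrite /y0 /lin2 /= /f2; lra.
rewrite lebesgue_measure2_cell -/delta.
apply: (le_trans (HK x0 y0 delta eta delta0 _)); first by rewrite eta0.
rewrite -EFinM lee_fin ler_pM2r ?exprn_gt0//.
by rewrite /jacobian_map /jacobian lerD2l.
Qed.

(** A cell is good if it obeys the inequality. Small cells around a point are good: one half of [e]
    pays for the linear approximation, the other for the oscillation of the jacobian. A tiling by
    good cells and countable subadditivity conclude. *)
Lemma open_image_le (U O : set (R * R)) (Psi : R * R -> R * R) (e : R) :
  open O -> O `<=` U -> 0 < e ->
  (forall p, U p -> [/\ differentiable (fun q => (Psi q).1) p,
     differentiable (fun q => (Psi q).2) p & {for p, continuous (jacobian_map Psi)}]) ->
  (mu_ext mu2 (Psi @` O) <= \int[mu2]_(p in O) (`|jacobian_map Psi p| + e)%:E)%E.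
Proof.
move=> oO OU e0 HU.
pose h (p : RR * RR) : \bar R := (`|jacobian_map Psi p| + e)%:E.
have mO := open_measurable2 oO.
have mh : @measurable_fun _ _ (RR * RR)%type (\bar R) O h.
  apply/measurable_EFinP; apply: open_continuous_measurable_fun2 => // p /OU/HU[_ _ cJ].
  by apply: cvgD; [apply: cvg_norm; exact: cJ|exact: cvg_cst].
have h0 p : (0 <= h p)%E by rewrite lee_fin addr_ge0// ltW.
pose good n c := cell n c `<=` O /\
  (mu_ext mu2 (Psi @` cell n c) <= \int[mu2]_(p in cell n c) h p)%E.
have [n c [//]|p Op|F [tF FO HF]] := @dyadic_tiling O good.
  have [d1 d2 cJ] := HU p (OU _ Op).
  have e20 : 0 < e / 2 by rewrite divr_gt0.
  have [N1 H1] := differentiable_cell_image e20 d1 d2.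
  have nO : \forall q \near p, O q by exact: open_nbhs_nbhs.
  have nJ : \forall q \near p, `|jacobian_map Psi p| - e / 2 <= `|jacobian_map Psi q|.
    have /cvgr_dist_le/(_ _ e20) : (fun q => `|jacobian_map Psi q|) @ p --> `|jacobian_map Psi p|.
      by apply: cvg_norm; exact: cJ.
    apply: filterS => q; rewrite ler_distl => /andP[? ?]; lra.
  have [N2 H2] := near_cell nO; have [N3 H3] := near_cell nJ.
  pose n := maxn N1 (maxn N2 N3); exists n.
  have := leqnn n; rewrite {1}/n !geq_max => /and3P[/H1 /= {}H1 /H2 {}H2 /H3 {}H3].
  split => //; apply: (le_trans H1).
  rewrite -integral_cst; last exact: measurable_cell.
  have mc := @measurable_cell R n (dyadic_index n p).
  apply: ge0_le_integral => //.
  - by move=> q _; rewrite lee_fin addr_ge0// ltW.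
  - exact: measurable_funS mh.
  - by move=> q /H3; rewrite lee_fin; lra.
rewrite -[in leRHS]FO (@ge0_integral_bigcup _ _ _ mu2 F h)//; last 2 first.
- move=> k; have [->|[nc _ ->]] := HF k; first exact: measurable0.
  exact: measurable_cell.
- by rewrite FO.
rewrite -[in leLHS]FO image_bigcup; apply: le_trans (mu_ext_sigma_subadditive _ _) _ => //.
apply: lee_nneseries => k _; first by move=> _; apply: mu_ext_ge0 => ?; exact: measure_ge0.
have [->|[nc [_ gnc] ->]] := HF k; last exact: gnc.
rewrite image_set0 mu_ext0 ?measure0 //; first by apply: integral_ge0 => p _; exact: h0.
Qed.

End images.

(** * Regularity of finite Borel measures *)

Section regularity.
Context {R : realType}.
Local Notation RR := (measurableTypeR R).
Variable nu : {measure set (RR * RR) -> \bar R}.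
Hypothesis nu_fin : (nu setT < +oo)%E.
Implicit Types A O C : set (R * R).

Definition regular (A : set (R * R)) := forall e : R, 0 < e -> exists O C,
  [/\ open O, closed C, C `<=` A, A `<=` O & (nu (O `\` C) <= e%:E)%E].

Lemma closed_measurable2 (C : set (R * R)) : closed C -> measurable (C : set (RR * RR)).
Proof.
by move=> cC; rewrite -[C]setCK; apply: measurableC; apply: open_measurable2; exact: closed_openC.
Qed.

Lemma finite_measure_fin (A : set (RR * RR)) : measurable A -> (nu A < +oo)%E.
Proof. by move=> mA; apply: le_lt_trans nu_fin; apply: le_measure; rewrite ?inE. Qed.

Lemma regularC (A : set (R * R)) : regular A -> regular (~` A).
Proof.
move=> rA e e0; have [W [C [oO cC CA AO OC]]] := rA e e0.
exists (~` C), (~` W); split.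
- exact: closed_openC.
- exact: open_closedC.
- exact: subsetC.
- exact: subsetC.
- by rewrite setDE setCK setIC -setDE.
Qed.

(** The union [D] of the inner closed sets need not be closed, but its finite parts [Cn n] are, and
    one of them suffices by continuity from above of the finite measure [nu]. *)
Lemma regular_bigcup (A : (set (R * R))^nat) : (forall n, regular (A n)) ->
  regular (\bigcup_n A n).
Proof.
move=> rA e e0.
have e20 : 0 < e / 2 by rewrite divr_gt0.
have H n : exists OC : set (R * R) * set (R * R), [/\ open OC.1, closed OC.2, OC.2 `<=` A n,
    A n `<=` OC.1 & (nu (OC.1 `\` OC.2) <= ((e / 2) / (2 ^ n.+1)%:R)%:E)%E].
  have en0 : 0 < (e / 2) / (2 ^ n.+1)%:R by rewrite divr_gt0.
  have [W [C [oO cC CA AO OC]]] := rA n _ en0.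
  by exists (W, C).
have [OC HOC] := choice H.
pose O := \bigcup_n (OC n).1; pose D := \bigcup_n (OC n).2.
have oO : open O by apply: bigcup_open => n _; case: (HOC n).
have mC n : measurable ((OC n).2 : set (RR * RR)) by apply: closed_measurable2; case: (HOC n).
have mO n : measurable ((OC n).1 : set (RR * RR)) by apply: open_measurable2; case: (HOC n).
have mOO : measurable (O : set (RR * RR)) by exact: open_measurable2.
have mD : measurable (D : set (RR * RR)) by exact: bigcupT_measurable.
have OD : (nu (O `\` D) <= (e / 2)%:E)%E.
  apply: (@le_trans _ _ (\sum_(n <oo) nu ((OC n).1 `\` (OC n).2))%E).
    apply: measure_sigma_subadditive => //.
    - by move=> n; exact: measurableD.
    - exact: measurableD.
    - by move=> x [[n _ On] nD]; exists n => //; split => // Cn; apply: nD; exists n.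
  apply: le_trans (epsilon_trick0 xpredT (ltW e20)).
  by apply: lee_nneseries => n _ //; case: (HOC n).
pose Cn n := \big[setU/set0]_(i < n) (OC i).2.
have cCn n : closed (Cn n).
  by rewrite /Cn; elim/big_ind : _ => [|X Y cX cY|i _]; [exact: closed0|exact: closedU|case: (HOC i)].
have mCn n : measurable (Cn n : set (RR * RR)) by exact: closed_measurable2.
have CnD n : Cn n `<=` D by apply: bigsetU_bigcup.
have capE : \bigcap_n (O `\` Cn n) = O `\` D.
  apply/seteqP; split => [x Hx|x [Ox nD] n _]; last by split => // /CnD.
  split; first by case: (Hx 0%N I).
  move=> [n _ Cx]; case: (Hx n.+1 I) => _; apply.
  by rewrite /Cn big_ord_recr; right.
have cv : nu \o (fun n => O `\` Cn n) @ \oo --> nu (O `\` D).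
  rewrite -capE; apply: nonincreasing_cvg_mu.
  - exact/finite_measure_fin/measurableD.
  - by move=> n; exact: measurableD.
  - by rewrite capE; exact: measurableD.
  - apply/nonincreasing_seqP => n; apply/subsetPset => x [Ox nC]; split => // Cx; apply: nC.
    by rewrite /Cn big_ord_recr; left.
have lte : (nu (O `\` D) < e%:E)%E.
  by apply: le_lt_trans OD _; rewrite lte_fin ltr_pdivrMr// ltr_pMr// ltr1n.
have [N _ HN] : \forall n \near \oo, (nu (O `\` Cn n) < e%:E)%E.
  exact: (cv _ (open_ereal_lt' lte)).
exists O, (Cn N); split => //.
- apply: (subset_trans (CnD N)) => x [n _ Cx]; exists n => //.
  by case: (HOC n) => _ _ CA _ _; exact: CA.
- by move=> x [n _ Ax]; exists n => //; case: (HOC n) => _ _ _ AO _; exact: AO.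
- by apply/ltW/HN => /=.
Qed.

(* The sublevel sets {g < b + 1/n} are open and decrease to {g <= b}. *)
Lemma regular_sublevel (g : R * R -> R) (b : R) : continuous g -> regular [set p | g p <= b].
Proof.
move=> cg e e0.
pose O n : set (R * R) := [set p | g p < b + n.+1%:R^-1].
pose C : set (R * R) := [set p | g p <= b].
have oO n : open (O n).
  by apply: (@open_comp _ _ g [set y | y < b + n.+1%:R^-1]) => [p _|]; [exact: cg|exact: open_lt].
have cC : closed C.
  by apply: (@closed_comp _ _ g [set y | y <= b]) => [p _|]; [exact: cg|exact: closed_le].
have mC := closed_measurable2 cC.
have mO n := open_measurable2 (oO n).
have capE : \bigcap_n (O n `\` C) = set0.
  apply/seteqP; split => // p Hp.
  have gb : b < g p by have [_ /negP] := Hp 0%N I; rewrite -ltNge.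
  have [N HN] := ltr_add_invr gb.
  by have [+ _] := Hp N I; rewrite /O/= ltNge => /negP; apply; exact: ltW.
have cv : nu \o (fun n => O n `\` C) @ \oo --> (0 : \bar R).
  rewrite -(measure0 nu) -capE; apply: nonincreasing_cvg_mu.
  - exact/finite_measure_fin/measurableD.
  - by move=> n; exact: measurableD.
  - by rewrite capE.
  - apply/nonincreasing_seqP => n; apply/subsetPset => x [Ox nC]; split => //.
    apply: lt_le_trans Ox _; rewrite lerD2l lef_pV2 ?posrE// ler_nat//.
have [N _ HN] : \forall n \near \oo, (nu (O n `\` C) < e%:E)%E.
  by apply: (cv _ (@open_ereal_lt' _ _ e%:E _)); rewrite lte_fin.
exists (O N), C; split => //; last by apply/ltW/HN => /=.
by move=> p Cp; apply: le_lt_trans Cp _; rewrite ltrDl invr_gt0.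
Qed.

Lemma regular0 : regular set0.
Proof.
move=> e e0; exists set0, set0; split => //; first exact: closed0.
by rewrite setD0 measure0 lee_fin ltW.
Qed.

Lemma regularI (A B : set (R * R)) : regular A -> regular B -> regular (A `&` B).
Proof.
move=> rA rB; rewrite -[A]setCK -[B]setCK -setCU; apply: regularC.
rewrite -bigcup2E; apply: regular_bigcup => -[|[|n]]; rewrite /bigcup2 /=.
- exact: regularC.
- exact: regularC.
- exact: regular0.
Qed.

(** The sets with regular preimage form a sigma-algebra, which contains the half-open intervals
    because those are differences of two sublevel sets. *)
Lemma regular_preimage (g : R * R -> R) (A : set RR) : continuous g -> measurable A ->
  regular (g @^-1` A).
Proof.
move=> cg; suff : measurable `<=` [set A : set RR | regular (g @^-1` A)] by apply.
apply: smallest_sub.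
  split => //=.
  - by rewrite preimage_set0; exact: regular0.
  - by move=> B rB; rewrite setTD preimage_setC; exact: regularC.
  - by move=> B rB; rewrite preimage_bigcup; exact: regular_bigcup.
move=> _ [[a b] /= _ <-].
rewrite (_ : _ @^-1` _ = ~` [set p | g p <= a] `&` [set p | g p <= b]); last first.
  apply/seteqP; split => p /=; rewrite in_itv /= ltNge; first by move=> /andP[/negP].
  by move=> [/negP -> ->].
by apply: regularI; [apply: regularC|]; exact: regular_sublevel.
Qed.

Lemma measurable_regular (A : set (RR * RR)) : measurable A -> regular A.
Proof.
rewrite measurable_prod_measurableType; apply: smallest_sub.
  split.
  - exact: regular0.
  - by move=> B rB; rewrite setTD; exact: regularC.
  - by move=> B rB; exact: regular_bigcup.
move=> _ [B mB [C mC <-]].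
have -> : B `*` C = fst @^-1` B `&` snd @^-1` C by [].
apply: regularI; apply: regular_preimage => // p; [exact: cvg_fst|exact: cvg_snd].
Qed.

End regularity.

(** * The area inequality for Borel sets *)

Section area_inequality.
Context {R : realType}.
Local Notation mu := (@lebesgue_measure R).
Local Notation RR := (measurableTypeR R).
Local Notation mu2 := (mu \x mu)%E.
Variables (U : set (R * R)) (Psi : R * R -> R * R).
Hypothesis oU : open U.
Hypothesis HU : forall p, U p -> [/\ differentiable (fun q => (Psi q).1) p,
  differentiable (fun q => (Psi q).2) p & {for p, continuous (jacobian_map Psi)}].
Local Notation J := (jacobian_map Psi).

Lemma measurable_normr_jacobian (A : set (RR * RR)) : measurable A -> A `<=` U ->
  measurable_fun A (fun p : RR * RR => `|J p|%:E).
Proof.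
move=> mA AU; apply/measurable_EFinP.
apply: (measurable_funS (E := U)) => //; first exact: open_measurable2.
apply: open_continuous_measurable_fun2 => // p /HU[_ _ cJ].
by apply: cvg_norm; exact: cJ.
Qed.

(** Enclose [A] in an open [O] inside [V] such that the difference has measure at most [d], and use
    the inequality for open sets. The excess is at most [B * d] from the jacobian and [d * v] from
    the slack, together at most [e]. *)
Lemma image_le_integral_bounded (V A : set (RR * RR)) (B : R) : open (V : set (R * R)) ->
  V `<=` U -> (mu2 V < +oo)%E -> (forall p, V p -> `|J p| <= B) ->
  measurable A -> A `<=` V ->
  (mu_ext mu2 (Psi @` A) <= \int[mu2]_(p in A) `|J p|%:E)%E.
Proof.
move=> oV VU Vfin JB mA AV.
have mV : measurable V by exact: open_measurable2.
pose v := fine (mu2 V).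
have vE : mu2 V = v%:E by rewrite fineK// ge0_fin_numE.
have v0 : 0 <= v by rewrite fine_ge0.
have [B0|B0] := leP 0 B; last first.
  suff -> : A = set0.
    by rewrite image_set0 mu_ext0 ?measure0//; apply: integral_ge0 => p _; rewrite lee_fin.
  apply/seteqP; split => // p /AV/JB; move/(le_trans (normr_ge0 _)).
  by rewrite leNgt B0.
apply/lee_addgt0Pr => e e0.
pose d := Num.min 1 (e / (v + B + 1)).
have vB : 0 < v + B + 1 by rewrite ltr_wpDl// addr_ge0.
have d0 : 0 < d by rewrite lt_min ltr01 divr_gt0.
have d1 : d <= 1 by rewrite ge_min lexx.
have dv : d * (v + B + 1) <= e.
  by rewrite -ler_pdivlMr// ge_min lexx orbT.
(* Restricting to [V] makes the measure finite, as regularity requires. *)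
pose nu : {measure set (RR * RR) -> \bar R} := mrestr mu2 mV.
have nufin : (nu setT < +oo)%E by rewrite /nu/= /mrestr setTI.
have [W [C [oW cC CA AW WC]]] := measurable_regular nufin mA d0.
pose O := W `&` V.
have oO : open O by exact: openI.
have mO : measurable (O : set (RR * RR)) by exact: open_measurable2.
have AO : A `<=` O by move=> p Ap; split; [exact: AW|exact: AV].
have OU : O `<=` U by move=> p [_ /VU].
have OAd : (mu2 (O `\` A) <= d%:E)%E.
  apply: le_trans WC; rewrite /nu /= /mrestr; apply: le_measure; rewrite ?inE.
  - exact: measurableD.
  - apply: measurableI => //; apply: measurableD; first exact: open_measurable2.
    exact: closed_measurable2.
  - by move=> p [[Wp Vp] nAp]; split => //; split => // /CA.
apply: (@le_trans _ _ (mu_ext mu2 (Psi @` O))); first by apply: le_mu_ext; exact: image_subset.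
apply: le_trans (open_image_le oO OU d0 HU) _.
have mOJ : measurable_fun (O : set (RR * RR)) (fun p : RR * RR => `|J p|%:E).
  exact: measurable_normr_jacobian.
change (\int[mu2]_(p in O) (`|J p|%:E + cst d%:E p) <= \int[mu2]_(p in A) `|J p|%:E + e%:E)%E.
rewrite ge0_integralD//; last by move=> p _; rewrite lee_fin ltW.
rewrite integral_cst//.
have OE : (O : set (RR * RR)) = A `|` (O `\` A) by rewrite setDUK.
have mOA : measurable (O `\` A : set (RR * RR)) by exact: measurableD.
rewrite {1}OE ge0_integral_setU -?OE//; last by rewrite disj_set2E setDIK.
rewrite -addeA leeD2l//.
have h1 : (\int[mu2]_(p in O `\` A) `|J p|%:E <= B%:E * d%:E)%E.
  apply: (@le_trans _ _ (\int[mu2]_(p in O `\` A) (cst B%:E p))%E).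
    apply: ge0_le_integral => //; first exact: measurable_funS mOJ.
    by move=> p [[_ Vp] _]; rewrite lee_fin JB.
  by rewrite integral_cst// lee_wpmul2l ?lee_fin.
have h2 : (d%:E * mu2 O <= d%:E * v%:E)%E.
  apply: lee_wpmul2l; first by rewrite lee_fin ltW.
  by rewrite -vE; apply: le_measure; rewrite ?inE// => p [].
apply: (le_trans (leeD h1 h2)); rewrite -!EFinM -EFinD lee_fin.
by have := ltW d0; lra.
Qed.

(** The open sets [V k], bounded and with bounded jacobian, exhaust the domain; [A] is cut into
    disjoint pieces accordingly. *)
Lemma image_le_integral (A : set (RR * RR)) : measurable A -> A `<=` U ->
  (mu_ext mu2 (Psi @` A) <= \int[mu2]_(p in A) `|J p|%:E)%E.
Proof.
move=> mA AU.
pose V (k : nat) : set (R * R) := U `&` [set p | `|p| < k%:R /\ `|J p| < k%:R].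
have oV k : open (V k).
  rewrite openE => p [Up [pk Jk]].
  have h1 : \forall q \near p, U q by exact: open_nbhs_nbhs.
  have h2 : \forall q \near p, `|q| < k%:R.
    have cn : (fun q : R * R => `|q|) @ p --> `|p| by apply: cvg_norm; exact: cvg_id.
    exact: (cvgr_lt `|p| cn _ pk).
  have h3 : \forall q \near p, `|J q| < k%:R.
    have cn : (fun q : R * R => `|J q|) @ p --> `|J p|.
      by apply: cvg_norm; case: (HU Up) => _ _; exact.
    exact: (cvgr_lt `|J p| cn _ Jk).
  by apply: filterS3 h1 h2 h3 => q; split.
have Vfin k : (mu2 (V k) < +oo)%E.
  pose r : R := k%:R.
  pose S : set (RR * RR) := `[- r, r]%classic `*` `[- r, r]%classic.
  have mS : measurable S by exact: measurableX.
  apply: (@le_lt_trans _ _ (mu2 S)).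
    apply: le_measure; rewrite ?inE//; first exact: open_measurable2.
    move=> p [_ [pk _]]; split; rewrite /= in_itv /= -ler_norml; apply: le_trans (ltW pk).
      exact: normr_fst_le.
    exact: normr_snd_le.
  have -> : mu2 S = (mu `[(- r)%R, r]%classic * mu `[(- r)%R, r]%classic)%E.
    exact: product_measure1E.
  have k0 : - r <= r by have : 0 <= r := ler0n _ k; lra.
  by rewrite lebesgue_measure_segment// -EFinM ltry.
pose E := seqDU (fun k => A `&` V k).
have AE : \bigcup_k E k = A.
  rewrite /E -seqDU_bigcup_eq; apply/seteqP; split => [p [k _ []]//|p Ap].
  pose m := Num.bound (Num.max `|p| `|J p|).
  have hk : Num.max `|p| `|J p| < m%:R by apply: archi_boundP; rewrite le_max normr_ge0.
  move: hk; rewrite gt_max => /andP[? ?].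
  exists m => //; split; first exact: Ap.
  by split; first exact: AU.
have mE k : measurable (E k).
  apply: seqDU_measurable => i; apply: measurableI => //; exact: open_measurable2.
rewrite -[in leRHS]AE (@ge0_integral_bigcup _ _ _ mu2 E)//; last 2 first.
- rewrite AE; exact: measurable_normr_jacobian.
- exact: trivIset_seqDU.
rewrite -[in leLHS]AE image_bigcup; apply: le_trans (mu_ext_sigma_subadditive _ _) _ => //.
apply: lee_nneseries => k _; first by move=> _; apply: mu_ext_ge0 => ?; exact: measure_ge0.
apply: (@image_le_integral_bounded (V k) _ k%:R) => //.
- by move=> p [].
- by move=> p [_ [_ /ltW]].
- by move=> p [[]].
Qed.

End area_inequality.

(** * One half of the change of variables formula *)

Section change_of_variables.
Context {R : realType}.
Local Notation mu := (@lebesgue_measure R).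
Local Notation RR := (measurableTypeR R).
Local Notation mu2 := (mu \x mu)%E.
Variables (U V : set (R * R)) (Psi : R * R -> R * R).
Hypothesis oU : open U.
Hypothesis HU : forall p, U p -> [/\ differentiable (fun q => (Psi q).1) p,
  differentiable (fun q => (Psi q).2) p & {for p, continuous (jacobian_map Psi)}].
Hypothesis VPsi : V `<=` Psi @` U.
Local Notation J := (jacobian_map Psi).

(* [Psi] is only controlled on [U]: extended by 0, it is globally measurable. *)
Lemma measurable_extension : exists2 Psi0 : RR * RR -> RR * RR,
  measurable_fun setT Psi0 & forall p, U p -> Psi0 p = Psi p.
Proof.
have mU : measurable (U : set (RR * RR)) by exact: open_measurable2.
have H (g : R * R -> R) : (forall p, U p -> differentiable g p) ->
    measurable_fun setT ((g : RR * RR -> RR) \_ U).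
  move=> dg; apply/(measurable_restrictT _ mU).
  by apply: open_continuous_measurable_fun2 => // p /dg/differentiable_continuous.
pose g1 (p : R * R) := (Psi p).1; pose g2 (p : R * R) := (Psi p).2.
exists (fun p => ((g1 \_ U) p, (g2 \_ U) p)); last first.
  by move=> p Up; rewrite !patchE mem_set// /g1 /g2 -surjective_pairing.
by apply: measurable_fun_pair; apply: H => p /HU[].
Qed.

(** Let [h] be a simple function below [f] on [V]. Each level set of [h] with nonzero value is
    covered by the image of its preimage in [U], so that the area inequality bounds its measure;
    summing over the levels bounds the integral of [h]. *)
Lemma change_of_variables_le (f : RR * RR -> \bar R) :
  (forall q, V q -> 0 <= f q)%E ->
  measurable_fun (U : set (RR * RR)) (fun p => f (Psi p) * `|J p|%:E)%E ->
  (forall p, U p -> 0 <= f (Psi p))%E ->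
  (\int[mu2]_(q in V) f q <= \int[mu2]_(p in U) (f (Psi p) * `|J p|%:E))%E.
Proof.
move=> f0 mfJ fPsi0.
have mU : measurable (U : set (RR * RR)) by exact: open_measurable2.
rewrite ge0_integralE//; apply: ge_ereal_sup => _ [h /= hf <-].
rewrite sintegralE.
have [Psi0 mPsi0 Psi0E] := measurable_extension.
pose B (r : R) : set (RR * RR) := Psi0 @^-1` (h @^-1` [set r]).
have mh r : measurable (h @^-1` [set r]) by [].
have mB r : measurable (B r) by rewrite -[B r]setTI; exact: mPsi0.
have mUB r : measurable (U `&` B r : set (RR * RR)) by exact: measurableI.
have Bneg r : r < 0 -> B r = set0.
  by move=> r0; apply/seteqP; split => // p hp; move: r0; rewrite -hp ltNge fun_ge0.
have mJ : measurable_fun (U : set (RR * RR)) (fun p : RR * RR => `|J p|%:E).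
  exact: (measurable_normr_jacobian oU HU mU (@subset_refl _ _)).
have mJB r : measurable_fun (U : set (RR * RR)) ((fun p : RR * RR => `|J p|%:E) \_ (B r)).
  by apply/(measurable_restrict _ (mB r) mU); apply: measurable_funS mJ => // p [].
have pos r p : (0 <= r%:E * ((fun p : RR * RR => `|J p|%:E) \_ (B r)) p)%E.
  have [r0|r0] := leP 0 r; last by rewrite Bneg// patch_set0 mule0.
  by apply: mule_ge0; [rewrite lee_fin|apply: erestrict_ge0 => q; rewrite lee_fin].
have step r : range h r ->
  (r%:E * mu2 (h @^-1` [set r]) <=
   \int[mu2]_(p in U) (r%:E * ((fun p => `|J p|%:E) \_ (B r)) p))%E.
  move=> [x _ hx].
  have r0 : 0 <= r by rewrite -hx.
  rewrite ge0_integralZl//; last by move=> p _; apply: erestrict_ge0 => q; rewrite lee_fin.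
  have [->|rN0] := eqVneq r 0; first by rewrite !mul0e.
  apply: lee_wpmul2l; first by rewrite lee_fin.
  rewrite -integral_mkcondr -measurable_mu_extE//.
  apply: le_trans (image_le_integral oU HU (mUB r) _); last by move=> p [].
  apply: le_mu_ext => q hq.
  (* [h] lies below [f] extended by 0 outside [V], so a nonzero value of [h] is only taken in
     [V]. *)
  have Vq : V q.
    apply: contrapT => nVq; have := hf q; rewrite patchE memNset// hq lee_fin => r0'.
    by case/eqP: rN0; apply/eqP; rewrite eq_le r0 r0'.
  by have [p Up pq] := VPsi Vq; exists p => //; split => //; rewrite /B /= Psi0E// pq.
have finr : finite_set (range h) by exact: fimfunP.
apply: le_trans (lee_fsum finr step) _.
rewrite -ge0_integral_fsum//; last by move=> r; apply: measurable_funeM.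
apply: ge0_le_integral => //.
- by move=> p Up; apply: fsume_ge0 => r _; exact: pos.
- by apply: emeasurable_fsum => // r; apply: measurable_funeM.
- move=> p Up.
  rewrite (fsbigD1 (h (Psi p)))//=; last by exists (Psi p).
  rewrite patchE mem_set//; last by rewrite /B /= Psi0E.
  rewrite fsbig1 ?adde0; last first.
    move=> r [_ /= rh]; rewrite patchE memNset ?mule0//.
    by rewrite /B /= Psi0E// => hr; apply: rh; rewrite -hr.
  apply: lee_wpmul2r; first by rewrite lee_fin.
  by have := hf (Psi p); rewrite patchE; case: ifP => // _ h0; exact: le_trans h0 (fPsi0 _ Up).
Qed.

End change_of_variables.

(** * Functions of class C^1 in the plane *)

Section gradients.
Context {R : realType}.
Implicit Types (U : set (R * R)) (f g : R * R -> R) (p q : R * R).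

Lemma is_diff_near f g p (a b : R) : (\forall q \near p, f q = g q) ->
  is_diff p f (lin2 a b) -> is_diff p g (lin2 a b).
Proof.
move=> fg [df dE]; apply: is_diff_approx => e e0.
have fgp : f p = g p := nbhs_singleton fg.
have := differentiable_first_order df e0; rewrite dE => H.
by apply: filterS2 fg H => q <-; rewrite fgp.
Qed.

Lemma continuous_near (T : topologicalType) (f g : T -> R) (p : T) : (\forall q \near p, f q = g q) ->
  {for p, continuous f} -> {for p, continuous g}.
Proof.
move=> fg cf; have fgp : f p = g p := nbhs_singleton fg.
suff : g @ p --> f p by rewrite fgp; exact.
by apply: cvg_trans cf; apply: near_eq_cvg; apply: filterS fg => q ->.
Qed.

(** Class C^1 with a named gradient: the rules below then compute the gradient of a compound
    function along with its continuity. *)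
Definition grad_on U f (fx fy : R * R -> R) := forall p, U p ->
  [/\ is_diff p f (lin2 (fx p) (fy p)), {for p, continuous fx} & {for p, continuous fy}].

Lemma grad_on_partial U f fx fy p : grad_on U f fx fy -> U p ->
  partial false f p = fx p /\ partial true f p = fy p.
Proof. by move=> H /H[df _ _]; exact: partial_is_diff. Qed.

Lemma grad_on_differentiable U f fx fy p : grad_on U f fx fy -> U p -> differentiable f p.
Proof. by move=> H /H[[]]. Qed.

Lemma grad_on_continuous U f fx fy p : grad_on U f fx fy -> U p -> {for p, continuous f}.
Proof. by move=> H Up; apply: differentiable_continuous; exact: grad_on_differentiable H Up. Qed.

Lemma open_near U p : open U -> U p -> \forall q \near p, U q.
Proof. by move=> oU Up; exact: open_nbhs_nbhs. Qed.

Lemma smooth_on_grad U f : open U -> smooth_on U f ->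
  grad_on U f (partial false f) (partial true f).
Proof.
move=> oU sf p Up; split.
- apply: is_diff_lin2; apply: continuous_partials_differentiable.
    by apply: filterS (open_near oU Up) => q Uq b; exact: (sf [::] q Uq).2.
  by move=> b; exact: (sf [:: b] p Up).1.
- exact: (sf [:: false] p Up).1.
- exact: (sf [:: true] p Up).1.
Qed.

Lemma smooth_on_partial U f b : smooth_on U f -> smooth_on U (partial b f).
Proof. by move=> sf s p Up; have := sf (rcons s b) p Up; rewrite /partials foldr_rcons. Qed.

Lemma grad_on_near U f g fx fy gx gy : open U -> (forall p, U p -> f p = g p) ->
  (forall p, U p -> fx p = gx p) -> (forall p, U p -> fy p = gy p) ->
  grad_on U f fx fy -> grad_on U g gx gy.
Proof.
move=> oU fg fgx fgy H p Up; have [df cx cy] := H p Up.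
have nU := open_near oU Up.
rewrite -fgx// -fgy//; split.
- by apply: is_diff_near df; apply: filterS nU => q; exact: fg.
- by apply: continuous_near cx; apply: filterS nU => q; exact: fgx.
- by apply: continuous_near cy; apply: filterS nU => q; exact: fgy.
Qed.

Lemma grad_on_sub U V f fx fy : V `<=` U -> grad_on U f fx fy -> grad_on V f fx fy.
Proof. by move=> VU H p /VU; exact: H. Qed.

Lemma grad_on_cst U (c : R) : grad_on U (fun=> c) (fun=> 0) (fun=> 0).
Proof.
move=> p _; split; try exact: cvg_cst.
apply: is_diff_eq; apply/funext => v; rewrite /lin2 !mul0r addr0 //.
Qed.

Lemma grad_onD U f g fx fy gx gy : grad_on U f fx fy -> grad_on U g gx gy ->
  grad_on U (fun p => f p + g p) (fun p => fx p + gx p) (fun p => fy p + gy p).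
Proof.
move=> Hf Hg p Up; have [df cfx cfy] := Hf p Up; have [dg cgx cgy] := Hg p Up.
split; [|exact: cvgD|exact: cvgD].
apply: (is_diff_eq (is_diffD _ _)); apply/funext => v; rewrite /lin2 /= -[(_ + _ : _ -> _) _]/(_ + _) /=; lra.
Qed.

Lemma grad_onM U f g fx fy gx gy : grad_on U f fx fy -> grad_on U g gx gy ->
  grad_on U (fun p => f p * g p)
    (fun p => fx p * g p + f p * gx p) (fun p => fy p * g p + f p * gy p).
Proof.
move=> Hf Hg p Up; have [df cfx cfy] := Hf p Up; have [dg cgx cgy] := Hg p Up.
have cf := grad_on_continuous Hf Up; have cg := grad_on_continuous Hg Up.
split; try by apply: cvgD; apply: cvgM.
apply: (is_diff_eq (is_diffM _ _)); apply/funext => v.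
rewrite /lin2 /= -[(_ + _ : _ -> _) _]/(_ + _) /= -[(_ *: _ : _ -> _) _]/(_ *: _).
by rewrite -[(g p *: _ : _ -> _) _]/(_ *: _) /GRing.scale /=; lra.
Qed.

Lemma grad_on_comp1 U f fx fy (phi dphi : R -> R) : grad_on U f fx fy ->
  (forall p, U p -> is_derive (f p) 1 phi (dphi (f p))) ->
  (forall p, U p -> {for f p, continuous dphi}) ->
  grad_on U (fun p => phi (f p)) (fun p => dphi (f p) * fx p) (fun p => dphi (f p) * fy p).
Proof.
move=> Hf Hphi cdphi p Up; have [df cfx cfy] := Hf p Up.
have cf := grad_on_continuous Hf Up.
have cd : {for p, continuous (dphi \o f)} by apply: continuous_comp => //; exact: cdphi.
split; try by apply: cvgM.
have [dph phE] := Hphi p Up.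
have dphi1 : is_diff (f p) phi (fun h => h *: dphi (f p)).
  split; first exact/derivable1_diffP.
  by rewrite diff1E; [rewrite derive1E phE|exact/derivable1_diffP].
apply: (is_diff_eq (is_diff_comp df dphi1)); apply/funext => v.
by rewrite /= /lin2 /GRing.scale /=; lra.
Qed.

Lemma grad_on_comp2 U V f fx fy (t1 t2 t1x t1y t2x t2y : R * R -> R) :
  grad_on V f fx fy -> grad_on U t1 t1x t1y -> grad_on U t2 t2x t2y ->
  (forall p, U p -> V (t1 p, t2 p)) ->
  grad_on U (fun p => f (t1 p, t2 p))
    (fun p => fx (t1 p, t2 p) * t1x p + fy (t1 p, t2 p) * t2x p)
    (fun p => fx (t1 p, t2 p) * t1y p + fy (t1 p, t2 p) * t2y p).
Proof.
move=> Hf H1 H2 UV p Up; have [df cfx cfy] := Hf _ (UV _ Up).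
have [d1 c1x c1y] := H1 p Up; have [d2 c2x c2y] := H2 p Up.
have c1 := grad_on_continuous H1 Up; have c2 := grad_on_continuous H2 Up.
have cT : {for p, continuous (fun q => (t1 q, t2 q))} by exact: (cvg_pair c1 c2).
have cx : {for p, continuous (fun q => fx (t1 q, t2 q))} by exact: (continuous_comp cT cfx).
have cy : {for p, continuous (fun q => fy (t1 q, t2 q))} by exact: (continuous_comp cT cfy).
split; try by apply: cvgD; apply: cvgM.
apply: (is_diff_eq (is_diff_comp (is_diff_pair d1 d2) df)); apply/funext => v.
by rewrite /= /lin2 /=; lra.
Qed.

(** The mean value inequality for [t |-> k t (y + h) - k t y], whose derivative is [b * h] up to
    [2 * e * h] because [kx] is differentiable at [(x, y)]. *)
Lemma second_difference (k kx : R -> R -> R) (x y a b e : R) : 0 < e ->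
  nbhs ((x, y) : R * R) (fun q : R * R => is_derive q.1 1 (k^~ q.2) (kx q.1 q.2)) ->
  nbhs ((x, y) : R * R) (fun q : R * R =>
    `|kx q.1 q.2 - kx x y - (a * (q.1 - x) + b * (q.2 - y))| <= e * `|q - (x, y)|) ->
  exists2 r, 0 < r & forall h, 0 < h < r ->
   `|k (x + h) (y + h) - k (x + h) y - k x (y + h) + k x y - b * h ^+ 2| <= 2 * e * h ^+ 2.
Proof.
move=> e0 H1 H2;
have H12 : \forall q \near ((x, y) : R * R), is_derive (q.1 : R) 1 (k^~ q.2) (kx q.1 q.2) /\
    `|kx q.1 q.2 - kx x y - (a * (q.1 - x) + b * (q.2 - y))| <= e * `|q - (x, y)|.
  exact: filterI H1 H2.
move: H12 => /nbhs_ballP[r /= r0 Hr].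
exists r => // h /andP[h0 hr].
have inb t s : 0 <= t <= h -> 0 <= s <= h -> ball ((x, y) : R * R) r (x + t, y + s).
  move=> /andP[? ?] /andP[? ?]; split; rewrite /ball /= opprD addNKr normrN ger0_norm//; lra.
have nb t s : 0 <= t <= h -> 0 <= s <= h -> `|(x + t, y + s) - (x, y) : R * R| <= h.
  move=> /andP[? ?] /andP[? ?]; rewrite /Num.norm /= ge_max /=.
  by rewrite (addrC x) (addrC y) !addrK !ger0_norm//; apply/andP.
have h0' : 0 <= (0 : R) <= h by apply/andP; split => //; exact: ltW.
have hh : 0 <= h <= h by apply/andP; split => //; exact: ltW.
pose phi t := k t (y + h) - k t y.
have btw t : Num.min x (x + h) <= t <= Num.max x (x + h) -> 0 <= t - x <= h.
  rewrite min_l ?max_r ?lerDl; try exact: ltW.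
  by move=> /andP[? ?]; apply/andP; split; lra.
have dphi t : 0 <= t - x <= h -> is_derive t 1 phi (kx t (y + h) - kx t y).
  move=> ht; have [d1 _] := Hr _ (inb _ _ ht hh); have [d2 _] := Hr _ (inb _ _ ht h0').
  by rewrite /= addrC subrK addr0 in d1 d2; apply: is_deriveB.
have := @derive_lipschitz R phi x (x + h) (b * h) (2 * e * h).
rewrite /phi [x + h - x]addrC addKr (ger0_norm (ltW h0)) => H.
rewrite (_ : _ - b * h ^+ 2 = k (x + h) (y + h) - k (x + h) y - (k x (y + h) - k x y) - b * h * h); last by lra.
rewrite expr2 mulrA; apply: H => t /btw ht; first by case: (dphi _ ht).
have -> : 'D_1 phi t = kx t (y + h) - kx t y by case: (dphi _ ht).
have [_ /= A1] := Hr _ (inb _ _ ht hh); have [_ /= A2] := Hr _ (inb _ _ ht h0').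
have {}A1 := le_trans A1 (ler_wpM2l (ltW e0) (nb _ _ ht hh)).
have {}A2 := le_trans A2 (ler_wpM2l (ltW e0) (nb _ _ ht h0')).
move: A1 A2; rewrite [x + _]addrC subrK addr0 !ler_norml => /andP[? ?] /andP[? ?].
by apply/andP; split; lra.
Qed.

(** The second difference over a square of side [h] is symmetric in the axes; it equals both
    [gxy p * h ^+ 2] and [gyx p * h ^+ 2], each up to [2 * e * h ^+ 2]. *)
Lemma schwarz U g gx gy gxx gxy gyx gyy p : open U -> grad_on U g gx gy ->
  grad_on U gx gxx gxy -> grad_on U gy gyx gyy -> U p -> gxy p = gyx p.
Proof.
move=> oU Hg Hgx Hgy Up; apply/eqP; rewrite eq_le; apply/andP.
suff H (e : R) : 0 < e -> `|gxy p - gyx p| <= 4 * e.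
  suff : `|gxy p - gyx p| <= 0 by rewrite normr_le0 subr_eq0 => /eqP ->; rewrite lexx.
  apply/ler_addgt0Pr => e e0; rewrite add0r; apply: le_trans (H (e / 4) _) _.
    by rewrite divr_gt0.
  by rewrite mulrC divfK.
move=> e0; case: p Up => x y Up.
have nU := open_near oU Up.
have D1 : nbhs ((x, y) : R * R) (fun q : R * R =>
    is_derive q.1 1 ((fun t s : R => g (t, s)) ^~ q.2) ((fun t s => gx (t, s)) q.1 q.2)).
  apply: filterS nU => -[t s] Uq /=.
  have [dg <-] := (grad_on_differentiable Hg Uq, (grad_on_partial Hg Uq).1).
  have dd : derivable g (slice false (x, s) t) (axis false) by exact: diff_derivable.
  exact: slice_derive dd.
have [[dgx dgxE] _ _] := Hgx _ Up; have [[dgy dgyE] _ _] := Hgy _ Up.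
have A1 : nbhs ((x, y) : R * R) (fun q : R * R => `|(fun t s => gx (t, s)) q.1 q.2 -
   (fun t s => gx (t, s)) x y - (gxx (x, y) * (q.1 - x) + gxy (x, y) * (q.2 - y))| <= e * `|q - (x, y)|).
  have := differentiable_first_order dgx e0.
  by rewrite dgxE; apply: filterS => -[t s].
have [r1 r10 H1] := @second_difference (fun t s => g (t, s)) (fun t s => gx (t, s)) x y _ _ e e0 D1 A1.
have swp (P : R * R -> Prop) : (\forall q \near ((x, y) : R * R), P q) ->
    \forall q \near ((y, x) : R * R), P (q.2, q.1).
  move=> /nbhs_ballP[r /= r0 Hr]; apply/nbhs_ballP; exists r => //= q [q1 q2].
  by apply: Hr; split.
have D2 : nbhs ((y, x) : R * R) (fun q : R * R =>
    is_derive q.1 1 ((fun t s : R => g (s, t)) ^~ q.2) ((fun t s => gy (s, t)) q.1 q.2)).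
  apply: filterS (swp _ nU) => -[t s] Uq /=.
  have [dg <-] := (grad_on_differentiable Hg Uq, (grad_on_partial Hg Uq).2).
  have dd : derivable g (slice true (s, y) t) (axis true) by exact: diff_derivable.
  exact: slice_derive dd.
have A2 : nbhs ((y, x) : R * R) (fun q : R * R => `|(fun t s => gy (s, t)) q.1 q.2 -
   (fun t s => gy (s, t)) y x - (gyy (x, y) * (q.1 - y) + gyx (x, y) * (q.2 - x))| <= e * `|q - (y, x)|).
  have := differentiable_first_order dgy e0.
  rewrite dgyE => /swp; apply: filterS => -[t s] /=.
  have -> : `|(t, s) - (y, x) : R * R| = `|(s, t) - (x, y) : R * R|.
    exact: maxC.
  by rewrite [gyy _ * _ + _]addrC.
have [r2 r20 H2] := @second_difference (fun t s => g (s, t)) (fun t s => gy (s, t)) y x _ _ e e0 D2 A2.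
pose h := Num.min r1 r2 / 2.
have m0 : 0 < Num.min r1 r2 by rewrite lt_min r10.
have h0 : 0 < h by rewrite divr_gt0.
have hm : h < Num.min r1 r2 by rewrite /h; lra.
move: hm; rewrite lt_min => /andP[hr1 hr2].
have := H1 h; rewrite h0 hr1 => /(_ isT) {}H1.
have := H2 h; rewrite h0 hr2 => /(_ isT) {}H2.
have hh : 0 < h ^+ 2 by rewrite exprn_gt0.
rewrite -(ler_pM2r hh) -[X in `|_| * X]gtr0_norm// -normrM.
by move: H1 H2; rewrite !ler_norml => /andP[? ?] /andP[? ?]; apply/andP; split; lra.
Qed.

End gradients.

(** * Integrals of compactly supported derivatives *)

Section compact_support.
Context {R : realType}.
Local Notation mu := (@lebesgue_measure R).
Local Notation RR := (measurableTypeR R).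
Local Notation mu2 := (mu \x mu)%E.

Lemma plane_compact_closed (K : set (R * R)) : compact K -> closed K.
Proof. by apply: compact_closed; exact: norm_hausdorff. Qed.

Lemma compact_in_ball (K : set (R * R)) : compact K ->
  exists2 b : R, 0 < b & forall p, K p -> `|p| < b.
Proof.
move=> /compact_bounded/ex_strict_bound_gt0[b b0 Kb]; by exists b.
Qed.

Lemma square_finite (b : R) :
  (mu2 ([set p : RR * RR | (`|(p : R * R)| < b)%R]) < +oo)%E.
Proof.
have [b0|b0] := ltP 0 b; last first.
  rewrite (_ : [set p | _] = set0) ?measure0//; apply/seteqP; split => // p /= pb.
  by have := le_lt_trans (normr_ge0 _) (lt_le_trans pb b0); rewrite ltxx.
pose S : set (RR * RR) := `[- b, b]%classic `*` `[- b, b]%classic.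
have mS : measurable S by exact: measurableX.
apply: (@le_lt_trans _ _ (mu2 S)).
  apply: le_measure; rewrite ?inE//.
    apply: open_measurable2; have := @open_comp (R * R)%type R (fun p => `|p|) [set y | y < b].
    by apply; [move=> p _; exact: norm_continuous|exact: open_lt].
  move=> p /ltW pb; split; rewrite /= in_itv /= -ler_norml; apply: le_trans pb.
    exact: normr_fst_le.
  exact: normr_snd_le.
have -> : mu2 S = (mu `[(- b)%R, b]%classic * mu `[(- b)%R, b]%classic)%E.
  exact: product_measure1E.
by rewrite lebesgue_measure_segment -?EFinM ?ltry//; lra.
Qed.

Lemma compact_finite (K : set (R * R)) : compact K -> (mu2 (K : set (RR * RR)) < +oo)%E.
Proof.
move=> cK; have [b _ Kb] := compact_in_ball cK.
apply: le_lt_trans (square_finite b); apply: le_measure; rewrite ?inE //.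
  by apply: closed_measurable2; exact: plane_compact_closed.
apply: open_measurable2; have := @open_comp (R * R)%type R (fun p => `|p|) [set y | y < b].
by apply; [move=> p _; exact: norm_continuous|exact: open_lt].
Qed.

Lemma compact_support_integrable (W K : set (R * R)) (h : R * R -> R) :
  open W -> compact K -> K `<=` W -> (forall p, W p -> {for p, continuous h}) ->
  (forall p, W p -> ~ K p -> h p = 0) ->
  mu2.-integrable (W : set (RR * RR)) (fun p : RR * RR => (h p)%:E).
Proof.
move=> oW cK KW ch h0.
have mW : measurable (W : set (RR * RR)) by exact: open_measurable2.
have mK : measurable (K : set (RR * RR)).
  by apply: closed_measurable2; exact: plane_compact_closed.
have mh : measurable_fun (W : set (RR * RR)) (h : RR * RR -> RR).
  exact: open_continuous_measurable_fun2.
have [B B0 hB] : exists2 B, 0 <= B & forall p, K p -> `|h p| <= B.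
  have [K0|/set0P[p0 Kp0]] := eqVneq K set0.
    by exists 0 => // p; rewrite K0.
  have [||p /set_mem Kp hp] := @compact_EVT_max _ _ (fun p => `|h p|) K _ cK.
  - by exists p0.
  - apply: continuous_in_subspaceT => p /set_mem /KW Wp.
    by apply: cvg_norm; exact: ch.
  exists `|h p| => // q Kq; apply: hp; exact: mem_set.
apply/integrableP; split; first exact/measurable_EFinP.
apply: (@le_lt_trans _ _ (\int[mu2]_(p in W) ((cst B%:E) \_ K) p)%E).
  apply: ge0_le_integral => //.
  - by apply/measurable_EFinP; exact: (measurableT_comp (@normr_measurable R setT)).
  - apply: measurable_funS (measurableT) _ _ => //.
    by apply/(measurable_restrictT _ mK); exact: measurable_cst.
  - move=> p Wp; rewrite patchE; case: ifPn => [/set_mem Kp|/negP nK].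
      by rewrite lee_fin hB.
    have -> : h p = 0 by apply: h0 => // Kp; apply: nK; exact: mem_set.
    by rewrite abse0.
rewrite -integral_mkcondr setIidr// integral_cst//.
by rewrite lte_mul_pinfty// ?lee_fin//; exact: compact_finite.
Qed.

(** Near a point of [W] the extension by 0 is [v]; near any other point it is 0, the complement of
    [K] being open. *)
Lemma grad_on_ext (W K : set (R * R)) (v vx vy : R * R -> R) : open W -> closed K -> K `<=` W ->
  grad_on W v vx vy -> (forall p, W p -> ~ K p -> [/\ v p = 0, vx p = 0 & vy p = 0]) ->
  grad_on setT (v \_ W) (vx \_ W) (vy \_ W).
Proof.
move=> oW cK KW Hv v0 p _.
have [Wp|nWp] := pselect (W p).
  have H : grad_on W (v \_ W) (vx \_ W) (vy \_ W).
    by apply: (grad_on_near oW _ _ _ Hv) => q Wq; rewrite patchE mem_set.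
  exact: H.
have oC : open (~` K) by exact: closed_openC.
have nK : (~` K) p by move=> /KW.
have H : grad_on (~` K) (v \_ W) (vx \_ W) (vy \_ W).
  have e0 (f : R * R -> R) : (forall q, W q -> ~ K q -> f q = 0) ->
      forall q, (~` K) q -> 0 = (f \_ W) q.
    move=> f0 q nKq; rewrite patchE; case: ifPn => [/set_mem Wq|//].
    by rewrite f0.
  apply: (grad_on_near oC _ _ _ (@grad_on_cst R (~` K) 0)).
  - by apply: e0 => q Wq nKq; case: (v0 q Wq nKq).
  - by apply: e0 => q Wq nKq; case: (v0 q Wq nKq).
  - by apply: e0 => q Wq nKq; case: (v0 q Wq nKq).
exact: H.
Qed.

Lemma integral_derivative0 (F f : R -> R) (b : R) : 0 < b ->
  (forall t : R, is_derive t 1 F (f t)) -> continuous f ->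
  (forall t, b <= `|t| -> F t = 0) -> (forall t, b <= `|t| -> f t = 0) ->
  (\int[mu]_t (f t)%:E = 0)%E.
Proof.
move=> b0 dF cf F0 f0.
have bb : - b < b by lra.
have -> : (\int[mu]_t (f t)%:E = \int[mu]_(t in `[(- b)%R, b]) (f t)%:E)%E.
  rewrite [RHS]integral_mkcond; apply: eq_integral => t _.
  rewrite patchE; case: ifPn => // /negP tb; rewrite f0//.
  rewrite leNgt; apply/negP => /ltW; rewrite ler_norml => /andP[? ?].
  by apply: tb; rewrite inE /= in_itv /=; apply/andP.
have cF : continuous F.
  by move=> t; apply: differentiable_continuous; apply/derivable1_diffP; case: (dF t).
rewrite (continuous_FTC2 bb (F := F)).
- have Fb : F b = 0 by apply: F0; rewrite ger0_norm// ltW.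
  have FNb : F (- b) = 0 by apply: F0; rewrite normrN ger0_norm// ltW.
  by rewrite Fb FNb sube0.
- exact: continuous_subspaceT.
- split.
  + by move=> t _; case: (dF t).
  + by apply: cvg_at_right_filter; exact: cF.
  + by apply: cvg_at_left_filter; exact: cF.
- by move=> t _; rewrite derive1E; case: (dF t).
Qed.

(** Fubini, integrating first along the axis selected by [c]: each line contributes 0 by the
    fundamental theorem of calculus. *)
Lemma integral_partial0 (c : bool) (K : set (R * R)) (v vx vy : R * R -> R) : compact K ->
  grad_on setT v vx vy -> (forall p, ~ K p -> [/\ v p = 0, vx p = 0 & vy p = 0]) ->
  (\int[mu2]_p (if c then vy p else vx p)%:E = 0)%E.
Proof.
move=> cK Hv v0.
have [b b0 Kb] := compact_in_ball cK.
have nK p : b <= `|p| -> ~ K p by move=> bp /Kb; rewrite ltNge bp.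
pose w := if c then vy else vx.
have cw : continuous w by move=> p; rewrite /w; case: (c); case: (Hv p I).
have w0 p : ~ K p -> w p = 0 by rewrite /w => /v0[]; case: (c).
have iw : mu2.-integrable setT (fun p : RR * RR => (w p)%:E).
  apply: (@compact_support_integrable setT K) => //; first exact: openT.
    by move=> p _; exact: cw.
  by move=> p _; exact: w0.
have -> : (\int[mu2]_p (if c then vy p else vx p)%:E = \int[mu2]_p (w p)%:E)%E.
  by rewrite /w; case: (c).
have dv (p : R * R) : is_derive (if c then p.2 else p.1 : R) (1 : R) (v \o slice c p) (w p).
  have [dvp _ _] := Hv p I.
  have [] := partial_is_diff dvp => px py.
  have -> : w p = partial c v p by rewrite /w; case: (c).
  have sp : slice c p (if c then p.2 else p.1) = p.
    by rewrite /slice; case: (c); rewrite -surjective_pairing.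
  rewrite -[X in partial c v X]sp; apply: slice_derive; rewrite sp.
  by apply: diff_derivable; case: dvp.
case: c @w cw w0 iw dv => w cw w0 iw dv.
- rewrite -integral12_prod_meas1//; apply: integral0_eq => x _.
  apply: (@integral_derivative0 (fun y => v (x, y)) (fun y => w (x, y)) b) => //.
  + by move=> y; exact: (dv (x, y)).
  + move=> y; apply: (@continuous_comp _ _ _ (fun y => (x, y)) w); last exact: cw.
    exact: (cvg_pair (cvg_cst x) (@cvg_id _ (nbhs y))).
  + move=> y yb; have [] // := v0 (x, y); apply: nK; apply: le_trans yb _.
    exact: (normr_snd_le (x, y)).
  + by move=> y yb; apply: w0; apply: nK; apply: le_trans yb _; exact: (normr_snd_le (x, y)).
- rewrite -integral21_prod_meas1//; apply: integral0_eq => y _.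
  apply: (@integral_derivative0 (fun x => v (x, y)) (fun x => w (x, y)) b) => //.
  + by move=> x; exact: (dv (x, y)).
  + move=> x; apply: (@continuous_comp _ _ _ (fun x => (x, y)) w); last exact: cw.
    exact: (cvg_pair (@cvg_id _ (nbhs x)) (cvg_cst y)).
  + move=> x xb; have [] // := v0 (x, y); apply: nK; apply: le_trans xb _.
    exact: (normr_fst_le (x, y)).
  + by move=> x xb; apply: w0; apply: nK; apply: le_trans xb _; exact: (normr_fst_le (x, y)).
Qed.

End compact_support.

(** * Stokes' formula in a plane domain *)

Section plane_stokes.
Context {R : realType}.
Local Notation mu := (@lebesgue_measure R).
Local Notation RR := (measurableTypeR R).
Local Notation mu2 := (mu \x mu)%E.

(* sigma (dw /\ dg) = d (sigma w dg) has compact support. *)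
Lemma jacobian_integral0 (W K : set (R * R)) (sg w wx wy g : R * R -> R) :
  open W -> compact K -> K `<=` W -> grad_on W sg (fun=> 0) (fun=> 0) ->
  grad_on W w wx wy -> (forall p, W p -> ~ K p -> w p = 0) -> smooth_on W g ->
  (\int[mu2]_(p in W) (sg p * Defs.jacobian w g p)%:E = 0)%E.
Proof.
move=> oW cK KW Hsg Hw w0 sg_g.
have clK := plane_compact_closed cK.
(* Outside [K], [w] is 0 on an open set, so its gradient vanishes there too. *)
have wg0 p : W p -> ~ K p -> wx p = 0 /\ wy p = 0.
  move=> Wp nKp.
  pose WK := W `&` ~` K.
  have oWK : open WK by apply: openI => //; exact: closed_openC.
  have H1 : grad_on WK w (fun=> 0) (fun=> 0).
    apply: (grad_on_near oWK _ _ _ (@grad_on_cst R WK 0)) => // q [Wq nKq].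
    by rewrite w0.
  have [<- <-] := grad_on_partial Hw Wp.
  exact: (grad_on_partial H1 (conj Wp nKp)).
have Hg := smooth_on_grad oW sg_g.
have Hgx := smooth_on_grad oW (smooth_on_partial false sg_g).
have Hgy := smooth_on_grad oW (smooth_on_partial true sg_g).
(* [v1x] is the x-derivative of [sg * w * g_y] and [v2y] the y-derivative of [sg * w * g_x]; the
   factor 0 is the gradient of [sg]. By the symmetry of second derivatives, their difference is the
   integrand. *)
pose d (wz gz gzz : R * R -> R) p := (0 * w p + sg p * wz p) * gz p + sg p * w p * gzz p.
pose v1x := d wx (partial true g) (partial false (partial true g)).
pose v2y := d wy (partial false g) (partial true (partial false g)).
have H1 : grad_on W (fun p => sg p * w p * partial true g p) v1x
    (d wy (partial true g) (partial true (partial true g))).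
  exact: grad_onM (grad_onM Hsg Hw) Hgy.
have H2 : grad_on W (fun p => sg p * w p * partial false g p)
    (d wx (partial false g) (partial false (partial false g))) v2y.
  exact: grad_onM (grad_onM Hsg Hw) Hgx.
have d0 (wz gz gzz : R * R -> R) p : wz p = 0 -> w p = 0 -> d wz gz gzz p = 0.
  by move=> wz0 wp0; rewrite /d wz0 wp0; lra.
have E1 := grad_on_ext oW clK KW H1 _; have E2 := grad_on_ext oW clK KW H2 _.
have pE (f : R * R -> R) q : (f \_ W) q = if q \in W then f q else 0.
  by rewrite patchE.
have p0 (f : R * R -> R) q : (W q -> f q = 0) -> (f \_ W) q = 0.
  by move=> fq; rewrite pE; case: ifPn => // /set_mem.
have I1 : (\int[mu2]_p ((v1x \_ W) p)%:E = 0)%E.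
  apply: (integral_partial0 false cK (E1 _)).
    move=> p Wp nKp; have [wx0 wy0] := wg0 p Wp nKp; have wp0 := w0 p Wp nKp.
    by rewrite /v1x !d0// wp0 mulr0 mul0r.
  move=> p nKp; split; apply: p0 => Wp; have [wx0 wy0] := wg0 p Wp nKp.
  - by rewrite w0// mulr0 mul0r.
  - by rewrite ?/v1x ?/v2y d0// w0.
  - by rewrite ?/v1x ?/v2y d0// w0.
have I2 : (\int[mu2]_p ((v2y \_ W) p)%:E = 0)%E.
  apply: (integral_partial0 true cK (E2 _)).
    move=> p Wp nKp; have [wx0 wy0] := wg0 p Wp nKp; have wp0 := w0 p Wp nKp.
    by rewrite /v2y !d0// wp0 mulr0 mul0r.
  move=> p nKp; split; apply: p0 => Wp; have [wx0 wy0] := wg0 p Wp nKp.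
  - by rewrite w0// mulr0 mul0r.
  - by rewrite ?/v1x ?/v2y d0// w0.
  - by rewrite ?/v1x ?/v2y d0// w0.
have patchI (f : R * R -> R) :
    (\int[mu2]_p ((f \_ W) p)%:E = \int[mu2]_(p in W) (f p)%:E)%E.
  rewrite [RHS]integral_mkcond; apply: eq_integral => p _.
  by rewrite (pE f p) patchE; case: ifP.
rewrite patchI in I1; rewrite patchI in I2.
have in1 : mu2.-integrable (W : set (RR * RR)) (fun p : RR * RR => (v1x p)%:E).
  apply: (compact_support_integrable oW cK KW) => [p Wp|p Wp nKp].
    by have [_ c _] := H1 p Wp.
  by have [wx0 wy0] := wg0 p Wp nKp; rewrite /v1x d0// w0.
have in2 : mu2.-integrable (W : set (RR * RR)) (fun p : RR * RR => (v2y p)%:E).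
  apply: (compact_support_integrable oW cK KW) => [p Wp|p Wp nKp].
    by have [_ _ c] := H2 p Wp.
  by have [wx0 wy0] := wg0 p Wp nKp; rewrite /v2y d0// w0.
transitivity (\int[mu2]_(p in W) ((v1x p)%:E - (v2y p)%:E))%E.
  apply: eq_integral => p /set_mem Wp; rewrite -EFinB; congr EFin.
  rewrite /Defs.jacobian (grad_on_partial Hw Wp).1 (grad_on_partial Hw Wp).2 /v1x /v2y /d.
  by rewrite (schwarz oW Hg Hgx Hgy Wp); lra.
apply: (eq_trans (integralB_EFin (open_measurable2 oW) in1 in2)).
exact: (eq_trans (f_equal2 (fun a b : \bar R => (a - b)%E) I1 I2) (sube0 _)).
Qed.

(** Around a point where [h] is positive, [h] exceeds [h p / 2] on a whole dyadic cell, which has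
    positive measure. *)
Lemma integral0_continuous_eq0 (W : set (R * R)) (h : R * R -> R) : open W ->
  (forall p, W p -> {for p, continuous h}) -> (forall p, W p -> 0 <= h p) ->
  (\int[mu2]_(p in W) (h p)%:E = 0)%E -> forall p, W p -> h p = 0.
Proof.
move=> oW ch h0 Ih p Wp; apply/eqP; rewrite eq_le h0// andbT leNgt; apply/negP => hp.
have hp2 : 0 < h p / 2 by rewrite divr_gt0.
have n1 : \forall q \near p, h p / 2 < h q.
  by apply: (cvgr_gt (h p) (ch p Wp)); lra.
have [N1 H1] := near_cell n1; have [N2 H2] := near_cell (open_near oW Wp).
pose n := maxn N1 N2; pose c := dyadic_index n p.
have C1 : cell n c `<=` [set q | h p / 2 < h q] by exact: (H1 n (leq_maxl _ _)).
have C2 : cell n c `<=` W by exact: (H2 n (leq_maxr _ _)).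
have mc := @measurable_cell R n c.
have mW : measurable (W : set (RR * RR)) by exact: open_measurable2.
have mh : measurable_fun (W : set (RR * RR)) (fun p : RR * RR => (h p)%:E).
  by apply/measurable_EFinP; exact: open_continuous_measurable_fun2.
have : (0 < \int[mu2]_(p in W) (h p)%:E)%E.
  apply: (@lt_le_trans _ _ (\int[mu2]_(q in cell n c) (cst (h p / 2)%:E q))%E).
    rewrite integral_cst//.
    rewrite [X in (_ * X)%E](_ : _ = ((2 ^+ n)^-1 ^+ 2 : R)%:E); last exact: lebesgue_measure2_cell.
    by rewrite -EFinM lte_fin mulr_gt0// exprn_gt0// invr_gt0 exprn_gt0.
  apply: (@le_trans _ _ (\int[mu2]_(q in cell n c) (h q)%:E)%E).
    apply: ge0_le_integral => //.
    - by move=> q _; rewrite lee_fin ltW.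
    - exact: measurable_funS mh.
    - by move=> q /C1 /ltW; rewrite lee_fin.
  by apply: ge0_subset_integral => // q Wq; rewrite lee_fin h0.
by rewrite Ih ltxx.
Qed.

End plane_stokes.

(** * Calculus on the surface *)

Section manifold_calculus.
Context {R : realType} (M : closed_surface R).
Implicit Types (c : chart R M) (u g : M -> R).

Lemma of_plane_near c p (W : set M) : img c p -> open W -> W (of_plane c p) ->
  \forall q \near p, W (of_plane c q).
Proof.
move=> cp oW Wp; have := @of_plane_continuous _ _ c p; rewrite inE => /(_ cp).
by apply; exact: open_nbhs_nbhs.
Qed.

Lemma open_preimage_of_plane c (W : set M) : open W -> open [set p | img c p /\ W (of_plane c p)].
Proof.
move=> oW; rewrite openE => p [cp Wp].
apply: filterS2 (open_near (@open_img _ _ c) cp) (of_plane_near cp oW Wp) => q *.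
by split.
Qed.

Lemma open_overlap c c' : open (overlap c c').
Proof. by apply: open_preimage_of_plane; exact: open_dom. Qed.

Lemma transition_overlap c c' p : overlap c c' p -> overlap c' c (transition c c' p).
Proof.
move=> [cp c'p]; split; first exact: to_planeP.
by rewrite /transition /= to_planeK//; exact: of_planeP.
Qed.

Lemma of_plane_transition c c' p : overlap c c' p ->
  of_plane c' (transition c c' p) = of_plane c p.
Proof. by move=> [cp c'p]; rewrite /transition /= to_planeK. Qed.

Lemma transitionK c c' p : overlap c c' p -> transition c' c (transition c c' p) = p.
Proof.
by move=> cp; rewrite {1}/transition /= of_plane_transition// of_planeK//; case: cp.
Qed.

Lemma grad_on_jacobian (W : set (R * R)) (f g fx fy gx gy : R * R -> R) p : open W ->
  grad_on W f fx fy -> grad_on W g gx gy -> W p ->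
  Defs.jacobian f g p = fx p * gy p - fy p * gx p /\ {for p, continuous (Defs.jacobian f g)}.
Proof.
move=> oW Hf Hg Wp.
have E q : W q -> fx q * gy q - fy q * gx q = Defs.jacobian f g q.
  move=> Wq; rewrite /Defs.jacobian.
  by have [-> ->] := grad_on_partial Hf Wq; have [-> ->] := grad_on_partial Hg Wq.
split; first by rewrite E.
apply: (@continuous_near _ _ (fun q => fx q * gy q - fy q * gx q)).
  exact: filterS (open_near oW Wp).
have [_ ? ?] := Hf p Wp; have [_ ? ?] := Hg p Wp.
by apply: cvgB; apply: cvgM.
Qed.

Lemma smooth_map_on_jacobian (W : set (R * R)) (T : R * R -> R * R) p : open W ->
  smooth_map_on W T -> W p -> [/\ differentiable (fun q => (T q).1) p,
    differentiable (fun q => (T q).2) p & {for p, continuous (jacobian_map T)}].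
Proof.
move=> oW [/(smooth_on_grad oW) H1 /(smooth_on_grad oW) H2] Wp.
split; [exact: grad_on_differentiable H1 Wp|exact: grad_on_differentiable H2 Wp|].
exact: (grad_on_jacobian oW H1 H2 Wp).2.
Qed.

Definition C1 u := forall c, atlas c -> exists ux uy, grad_on (img c) (u \o of_plane c) ux uy.

Lemma smooth_C1 u : smooth u -> C1 u.
Proof.
move=> su c ac; do 2 eexists; apply: smooth_on_grad; [exact: open_img|exact: su].
Qed.

Lemma C1_continuous u : C1 u -> continuous u.
Proof.
move=> Hu x; have [ux [uy H]] := Hu _ (atlas_chart_at x).
set c := chart_at x in H; have cx : dom c x := dom_chart_at x.
apply: (@continuous_near _ _ ((u \o of_plane c) \o to_plane c)).
  apply: filterS (open_nbhs_nbhs (conj (@open_dom _ _ c) cx)) => y cy /=.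
  by rewrite to_planeK.
apply: continuous_comp.
  by apply: (@to_plane_continuous _ _ c); rewrite inE.
by apply: (grad_on_continuous H); exact: to_planeP.
Qed.

(** The chain rule and the multiplicativity of 2 by 2 determinants. *)
Lemma d_wedge_d_transition u g c c' p : C1 u -> C1 g -> atlas c -> atlas c' ->
  overlap c c' p ->
  d_wedge_d u g c p = d_wedge_d u g c' (transition c c' p) * jacobian_map (transition c c') p.
Proof.
move=> Hu Hg ac ac' op; pose U := overlap c c'.
have oU : open U by exact: open_overlap.
have [/(smooth_on_grad oU) H1 /(smooth_on_grad oU) H2] := atlas_smooth ac ac'.
have UV q : U q -> img c' ((transition c c' q).1, (transition c c' q).2).
  by move=> Uq; rewrite -surjective_pairing; case: (transition_overlap Uq).
have [ux [uy Gu]] := Hu _ ac'; have [gx [gy Gg]] := Hg _ ac'.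
have E (v : M -> R) q : U q ->
    (v \o of_plane c') ((transition c c' q).1, (transition c c' q).2) = (v \o of_plane c) q.
  by move=> Uq; rewrite -surjective_pairing /= of_plane_transition.
have Cu : grad_on U (u \o of_plane c) _ _ :=
  grad_on_near oU (E u) (fun _ _ => erefl) (fun _ _ => erefl) (grad_on_comp2 Gu H1 H2 UV).
have Cg : grad_on U (g \o of_plane c) _ _ :=
  grad_on_near oU (E g) (fun _ _ => erefl) (fun _ _ => erefl) (grad_on_comp2 Gg H1 H2 UV).
have c'p : img c' (transition c c' p) by case: (transition_overlap op).
rewrite /d_wedge_d (grad_on_jacobian oU Cu Cg op).1.
rewrite (grad_on_jacobian (@open_img _ _ c') Gu Gg c'p).1.
rewrite /jacobian_map (grad_on_jacobian oU H1 H2 op).1 -!surjective_pairing.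
lra.
Qed.

Variable omega : area_form M.

(** The jacobian of the transition map is a factor of [omega c], hence nonzero, and it cancels in
    the quotient. *)
Lemma poissonE u g c x : C1 u -> C1 g -> atlas c -> dom c x ->
  poisson omega u g x = - d_wedge_d u g c (to_plane c x) / omega c (to_plane c x).
Proof.
move=> Hu Hg ac cx; rewrite /poisson; set c' := chart_at x.
have ac' : atlas c' := atlas_chart_at x; have c'x : dom c' x := dom_chart_at x.
have op : overlap c c' (to_plane c x) by split; [exact: to_planeP|rewrite to_planeK].
have tE : transition c c' (to_plane c x) = to_plane c' x by rewrite /transition /= to_planeK.
have H1 := d_wedge_d_transition Hu Hg ac ac' op; have H2 := form_transition omega ac ac' op.
have H3 := form_neq0 omega ac (to_planeP cx).
rewrite tE in H1 H2; rewrite H1.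
have J0 : jacobian_map (transition c c') (to_plane c x) != 0.
  by move: H3; rewrite H2 mulf_eq0 negb_or => /andP[].
have w0 : omega c' (to_plane c' x) != 0 by exact: (form_neq0 omega ac' (to_planeP c'x)).
by rewrite H2; field; rewrite w0 J0.
Qed.

Lemma poisson_chart u g c p : C1 u -> C1 g -> atlas c -> img c p ->
  poisson omega u g (of_plane c p) = - d_wedge_d u g c p / omega c p.
Proof.
by move=> Hu Hg ac cp; rewrite (poissonE Hu Hg ac (of_planeP cp)) of_planeK.
Qed.

Lemma form_continuous c p : atlas c -> img c p -> {for p, continuous (omega c)}.
Proof. by move=> ac cp; exact: (form_smooth omega ac [::] cp).1. Qed.

Lemma d_wedge_d_continuous u g c p : C1 u -> C1 g -> atlas c -> img c p ->
  {for p, continuous (d_wedge_d u g c)}.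
Proof.
move=> Hu Hg ac cp; have [ux [uy Gu]] := Hu _ ac; have [gx [gy Gg]] := Hg _ ac.
exact: (grad_on_jacobian (@open_img _ _ c) Gu Gg cp).2.
Qed.

Lemma poisson_continuous u g : C1 u -> C1 g -> continuous (poisson omega u g).
Proof.
move=> Hu Hg x; set c := chart_at x; have cx : dom c x := dom_chart_at x.
have ac : atlas c := atlas_chart_at x.
apply: (@continuous_near _ _ ((fun p => - d_wedge_d u g c p / omega c p) \o to_plane c)).
  apply: filterS (open_nbhs_nbhs (conj (@open_dom _ _ c) cx)) => y cy /=.
  by rewrite (poissonE Hu Hg ac cy).
have ct : {for x, continuous (to_plane c)} := to_plane_continuous (mem_set cx).
have cp : img c (to_plane c x) by exact: to_planeP.
apply: (continuous_comp ct).
apply: cvgM; first by apply: cvgN; exact: d_wedge_d_continuous.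
by apply: cvgV; [exact: form_neq0|exact: form_continuous].
Qed.

(** Area integrals involve the absolute value of the coefficient of [omega], whereas exactness
    concerns the 2-form itself. The sign relating them is locally constant, hence passes through
    derivatives. *)
Definition orientation c (p : R * R) : R := Num.sg (omega c p).

Lemma orientation_grad c : atlas c -> grad_on (img c) (orientation c) (fun=> 0) (fun=> 0).
Proof.
move=> ac p cp.
have n : \forall q \near p, orientation c p = orientation c q.
  have cw := form_continuous ac cp.
  have [w0|w0|w0] := ltgtP (omega c p) 0.
  - have nw : \forall q \near p, omega c q < 0 by exact: (cvgr_lt (omega c p) cw _ w0).
    by move: nw; apply: filterS => q wq; rewrite /orientation !ltr0_sg.
  - have nw : \forall q \near p, 0 < omega c q by exact: (cvgr_gt (omega c p) cw _ w0).
    by move: nw; apply: filterS => q wq; rewrite /orientation !gtr0_sg.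
  - by have := form_neq0 omega ac cp; rewrite w0 eqxx.
split; try exact: cvg_cst.
by apply: (is_diff_near n); have [] := @grad_on_cst R setT (orientation c p) p I.
Qed.

Lemma poisson_density u g c p : C1 u -> C1 g -> atlas c -> img c p ->
  poisson omega u g (of_plane c p) * `|omega c p| = - (orientation c p * d_wedge_d u g c p).
Proof.
move=> Hu Hg ac cp; rewrite (poisson_chart Hu Hg ac cp) normrEsg.
by rewrite /orientation; field; exact: form_neq0.
Qed.

Lemma normr_d_wedge_d u g c p : C1 u -> C1 g -> atlas c -> img c p ->
  `|d_wedge_d u g c p| = `|poisson omega u g (of_plane c p)| * `|omega c p|.
Proof.
move=> Hu Hg ac cp; rewrite -normrM (poisson_chart Hu Hg ac cp) divfK ?normrN//.
exact: form_neq0.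
Qed.

End manifold_calculus.

(** * Integrals over a chart and their independence of the chart *)

Section chart_integrals.
Context {R : realType} (M : closed_surface R) (omega : area_form M).
Local Notation mu := (@lebesgue_measure R).
Local Notation RR := (measurableTypeR R).
Local Notation mu2 := (mu \x mu)%E.
Implicit Types (c : chart R M) (h u g : M -> R).

Definition chart_density c h (p : R * R) : R := h (of_plane c p) * `|omega c p|.

Definition chart_integral c h : \bar R := (\int[mu2]_(p in img c) (chart_density c h p)%:E)%E.

Lemma chart_density_continuous c h p : atlas c -> continuous h -> img c p ->
  {for p, continuous (chart_density c h)}.
Proof.
move=> ac ch cp.
have c1 : {for p, continuous (h \o of_plane c)}.
  have cof : {for p, continuous (of_plane c)} := of_plane_continuous (mem_set cp).
  exact: (continuous_comp cof (ch _)).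
have c2 : {for p, continuous (fun q => `|omega c q|)}.
  by apply: cvg_norm; exact: form_continuous.
exact: (cvgM c1 c2).
Qed.

Lemma measurable_img c : measurable (img c : set (RR * RR)).
Proof. by apply: open_measurable2; exact: open_img. Qed.

Lemma measurable_chart_density c h : atlas c -> continuous h ->
  measurable_fun (img c : set (RR * RR)) (fun p : RR * RR => (chart_density c h p)%:E).
Proof.
move=> ac ch; apply/measurable_EFinP; apply: open_continuous_measurable_fun2.
  exact: open_img.
by move=> p cp; exact: chart_density_continuous.
Qed.

Lemma chart_integral_overlap c c' h : atlas c -> continuous h ->
  (forall x, ~ (dom c x /\ dom c' x) -> h x = 0) ->
  chart_integral c h = (\int[mu2]_(p in overlap c c') (chart_density c h p)%:E)%E.
Proof.
move=> ac ch h0.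
have -> : overlap c c' = img c `&` overlap c c' by apply/seteqP; split => p [].
rewrite integral_mkcondr; apply: eq_integral => p /set_mem cp.
rewrite patchE; case: ifPn => // /negP nop; rewrite /chart_density h0 ?mul0r//.
by move=> [_ c'p]; apply: nop; rewrite inE; split.
Qed.

(** The transition from [c'] to [c] maps one overlap onto the other, and the transformation law of
    [omega] turns the integrand of the change of variables into the density in [c']. *)
Lemma chart_integral_le c c' h : atlas c -> atlas c' -> continuous h ->
  (forall x, 0 <= h x) -> (forall x, ~ (dom c x /\ dom c' x) -> h x = 0) ->
  (chart_integral c h <= chart_integral c' h)%E.
Proof.
move=> ac ac' ch hge0 h0.
have h0' x : ~ (dom c' x /\ dom c x) -> h x = 0 by move=> nx; apply: h0 => -[*]; apply: nx.
rewrite (chart_integral_overlap ac ch h0) (chart_integral_overlap ac' ch h0').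
pose f (q : RR * RR) : \bar R := (chart_density c h q)%:E.
pose T := transition c' c.
have oU := @open_overlap _ _ c' c.
have HU p : overlap c' c p -> [/\ differentiable (fun q => (T q).1) p,
    differentiable (fun q => (T q).2) p & {for p, continuous (jacobian_map T)}].
  exact: (smooth_map_on_jacobian oU (atlas_smooth ac' ac)).
have VT : overlap c c' `<=` T @` overlap c' c.
  move=> q oq; exists (transition c c' q); first exact: transition_overlap.
  exact: transitionK.
have fT p : overlap c' c p -> (f (T p) * `|jacobian_map T p|%:E)%E = (chart_density c' h p)%:E.
  move=> op; rewrite /f -EFinM; congr EFin; rewrite /chart_density /T of_plane_transition//.
  by rewrite -mulrA -normrM -(form_transition omega ac' ac op).
have cd0 (c0 : chart R M) p : 0 <= chart_density c0 h p by rewrite mulr_ge0.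
apply: le_trans (change_of_variables_le oU HU VT (f := f) _ _ _) _.
- by move=> q _; rewrite lee_fin.
- apply: (@eq_measurable_fun _ _ _ _ _ (fun p : RR * RR => (chart_density c' h p)%:E)).
    by move=> p /set_mem op; rewrite -(fT p op).
  apply: (measurable_funS (measurable_img c')); first by move=> p [].
  exact: measurable_chart_density.
- by move=> p _; rewrite lee_fin.
- rewrite (_ : (\int[mu2]_(p in overlap c' c) (f (T p) * `|jacobian_map T p|%:E))%E =
    (\int[mu2]_(p in overlap c' c) (chart_density c' h p)%:E)%E)//.
  by apply: eq_integral => p /set_mem op; exact: fT.
Qed.

Lemma chart_integral_ge0_eq c c' h : atlas c -> atlas c' -> continuous h ->
  (forall x, 0 <= h x) -> (forall x, ~ (dom c x /\ dom c' x) -> h x = 0) ->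
  chart_integral c h = chart_integral c' h.
Proof.
move=> ac ac' ch hge0 h0; apply/eqP; rewrite eq_le; apply/andP; split.
  exact: chart_integral_le.
by apply: chart_integral_le => // x nx; apply: h0 => -[*]; apply: nx.
Qed.

Lemma chart_integral_pos_neg c h : chart_integral c h =
  (chart_integral c (fun x => Num.max (h x) 0)%R - chart_integral c (fun x => Num.max (- h x) 0)%R)%E.
Proof.
rewrite /chart_integral integralE; congr (_ - _)%E; apply: eq_integral => p _.
  rewrite funeposE /chart_density /= -EFin_max; congr EFin.
  by rewrite maxr_pMl// mul0r.
rewrite funenegE /chart_density /= -EFin_max; congr EFin.
by rewrite maxr_pMl// mul0r mulNr.
Qed.

Lemma chart_integral_change c c' h : atlas c -> atlas c' -> continuous h ->
  (forall x, ~ (dom c x /\ dom c' x) -> h x = 0) ->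
  chart_integral c h = chart_integral c' h.
Proof.
move=> ac ac' ch h0; rewrite (chart_integral_pos_neg c) (chart_integral_pos_neg c').
have ch0 : continuous (fun x => Num.max (h x) 0).
  by move=> x; apply: (@continuous_max _ _ h (fun=> 0)); [exact: ch|exact: cvg_cst].
have chN : continuous (fun x => - h x) by move=> x; apply: cvgN; exact: ch.
have chN0 : continuous (fun x => Num.max (- h x) 0).
  by move=> x; apply: (@continuous_max _ _ (fun x => - h x) (fun=> 0)); [exact: chN|exact: cvg_cst].
congr (_ - _)%E; apply: chart_integral_ge0_eq => //.
- by move=> x; rewrite le_max lexx orbT.
- by move=> x /h0 ->; rewrite maxxx.
- by move=> x; rewrite le_max lexx orbT.
- by move=> x /h0 ->; rewrite oppr0 maxxx.
Qed.

(** As the surface is compact, so is [K], and its image in the plane is a compact subset of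
    [img c]. *)
Definition supported c h := exists K : set M,
  [/\ closed K, K `<=` dom c & forall x, ~ K x -> h x = 0].

Lemma supported_plane c h : supported c h -> exists K : set (R * R),
  [/\ compact K, K `<=` img c & forall p, img c p -> ~ K p -> h (of_plane c p) = 0].
Proof.
move=> [K [cK Kc h0]]; exists (to_plane c @` K); split.
- apply: continuous_compact.
    apply: continuous_in_subspaceT => x /set_mem/Kc cx.
    exact: (to_plane_continuous (mem_set cx)).
  exact: (subclosed_compact cK (@surface_compact _ M)).
- by move=> _ [x /Kc cx <-]; exact: to_planeP.
- move=> p cp nKp; apply: h0 => Kp; apply: nKp; exists (of_plane c p) => //.
  exact: of_planeK.
Qed.

Lemma supported_integrable c h : atlas c -> continuous h -> supported c h ->
  mu2.-integrable (img c : set (RR * RR)) (fun p : RR * RR => (chart_density c h p)%:E).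
Proof.
move=> ac ch /supported_plane[K [cK Kc h0]].
apply: (compact_support_integrable (@open_img _ _ c) cK Kc).
  by move=> p cp; exact: chart_density_continuous.
by move=> p cp nKp; rewrite /chart_density h0// mul0r.
Qed.

(** Read in the chart, the density is [d_wedge_d u g c] times a locally constant sign, and [u] has
    compact support there. *)
Lemma chart_stokes c u g : atlas c -> C1 u -> smooth g -> supported c u ->
  chart_integral c (poisson omega u g) = 0%E.
Proof.
move=> ac Hu sg /supported_plane[K [cK Kc u0]].
have Hg := smooth_C1 sg; have [ux [uy Gu]] := Hu _ ac.
have HN : grad_on (img c) (fun p => - orientation omega c p) (fun=> 0) (fun=> 0).
  apply: (grad_on_near (@open_img _ _ c) _ _ _
    (grad_onM (@grad_on_cst R (img c) (-1)) (orientation_grad omega ac))) => p _.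
  - by rewrite mulN1r.
  - by rewrite mul0r mulr0 addr0.
  - by rewrite mul0r mulr0 addr0.
rewrite -[RHS](jacobian_integral0 (@open_img _ _ c) cK Kc HN Gu u0 (sg _ ac)).
apply: eq_integral => p /set_mem cp; congr EFin.
by rewrite /chart_density (poisson_density omega Hu Hg ac cp) mulNr.
Qed.

End chart_integrals.

(** * Functions of class C^1 and the squared positive part *)

Section C1_plane.
Context {R : realType}.
Implicit Types (U : set (R * R)) (f g : R * R -> R).

Definition C1_on U f := exists fx fy, grad_on U f fx fy.

(** The gradient is unique, hence given by the partial derivatives. This makes the property local,
    so that it can be glued in [C1_onU]. *)
Lemma C1_onP U f : open U -> C1_on U f -> grad_on U f (partial false f) (partial true f).
Proof.
move=> oU [fx [fy H]]; apply: (grad_on_near oU _ _ _ H) => // p Up.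
  by rewrite (grad_on_partial H Up).1.
by rewrite (grad_on_partial H Up).2.
Qed.

Lemma C1_onU U V f : open U -> open V -> C1_on U f -> C1_on V f -> C1_on (U `|` V) f.
Proof.
move=> oU oV /(C1_onP oU) HU /(C1_onP oV) HV.
by exists (partial false f), (partial true f) => p [/HU|/HV].
Qed.

Lemma C1_on_sub U V f : V `<=` U -> C1_on U f -> C1_on V f.
Proof. by move=> VU [fx [fy H]]; exists fx, fy; exact: grad_on_sub H. Qed.

Lemma C1_on_eq U f g : open U -> (forall p, U p -> f p = g p) -> C1_on U f -> C1_on U g.
Proof.
by move=> oU fg [fx [fy H]]; exists fx, fy; apply: (grad_on_near oU fg _ _ H).
Qed.

Lemma C1_on_cst U (k : R) : C1_on U (fun=> k).
Proof. by do 2 eexists; exact: grad_on_cst. Qed.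

Lemma C1_onD U f g : C1_on U f -> C1_on U g -> C1_on U (fun p => f p + g p).
Proof. by move=> [? [? Hf]] [? [? Hg]]; do 2 eexists; exact: (grad_onD Hf Hg). Qed.

Lemma C1_onM U f g : C1_on U f -> C1_on U g -> C1_on U (fun p => f p * g p).
Proof. by move=> [? [? Hf]] [? [? Hg]]; do 2 eexists; exact: (grad_onM Hf Hg). Qed.

Lemma C1_on_fst U : C1_on U (fun p => p.1).
Proof.
exists (fun=> 1), (fun=> 0) => p _; split; [|exact: cst_continuous|exact: cst_continuous].
apply: is_diff_approx => e e0; apply/nbhs_ballP; exists 1 => //= q _.
have -> : q.1 - p.1 - lin2 1 0 (q - p) = 0 by rewrite /lin2 /=; lra.
by rewrite normr0 mulr_ge0// ltW.
Qed.

Lemma C1_on_snd U : C1_on U (fun p => p.2).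
Proof.
exists (fun=> 0), (fun=> 1) => p _; split; [|exact: cst_continuous|exact: cst_continuous].
apply: is_diff_approx => e e0; apply/nbhs_ballP; exists 1 => //= q _.
have -> : q.2 - p.2 - lin2 0 1 (q - p) = 0 by rewrite /lin2 /=; lra.
by rewrite normr0 mulr_ge0// ltW.
Qed.

Lemma C1_on_comp1 U f (phi dphi : R -> R) : C1_on U f ->
  (forall p, U p -> is_derive (f p) 1 phi (dphi (f p))) ->
  (forall p, U p -> {for f p, continuous dphi}) -> C1_on U (fun p => phi (f p)).
Proof. by move=> [? [? H]] H1 H2; do 2 eexists; exact: (grad_on_comp1 H H1 H2). Qed.

Lemma C1_on_comp2 U V f t1 t2 : C1_on V f -> C1_on U t1 -> C1_on U t2 ->
  (forall p, U p -> V (t1 p, t2 p)) -> C1_on U (fun p => f (t1 p, t2 p)).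
Proof.
by move=> [? [? H]] [? [? H1]] [? [? H2]] UV; do 2 eexists; exact: (grad_on_comp2 H H1 H2 UV).
Qed.

Lemma is_derive_quadratic (f : R -> R) (t d : R) :
  (forall s, `|f s - f t - d * (s - t)| <= (s - t) ^+ 2) -> is_derive t 1 f d.
Proof.
move=> H.
have cv : (fun h : R => h^-1 *: ((f \o shift t) (h *: (1 : R)) - f t)) @ 0^' --> d.
  apply/cvgrPdist_le => e e0; near=> h.
  have h0 : h != 0 by near: h; exact: nbhs_dnbhs_neq.
  have he : `|h| <= e by near: h; exact: dnbhs0_le.
  have {}H := H (h + t); rewrite addrK in H.
  rewrite /= /GRing.scale /= mulr1 distrC.
  have h0' : 0 < `|h| by rewrite normr_gt0.
  apply: le_trans he; rewrite -(ler_pM2l h0') -normrM mulrBr mulrA divff// mul1r.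
  by rewrite -expr2 real_normK ?num_real// [h * d]mulrC.
by split; [apply: cvgP cv|exact: cvg_lim cv].
Unshelve. all: by end_near. Qed.

(* The square makes the positive part of class C^1. *)
Definition pos2 (t : R) : R := Num.max 0 t ^+ 2.

Lemma is_derive_pos2 (t : R) : is_derive t 1 pos2 (2 * Num.max 0 t).
Proof.
apply: is_derive_quadratic => s; rewrite /pos2.
have [s0|s0] := leP 0 s; have [t0|t0] := leP 0 t.
- by rewrite ger0_norm; [|rewrite (_ : _ - _ = (s - t) ^+ 2) ?sqr_ge0//]; lra.
- rewrite mulr0 mul0r expr0n /= !subr0 ger0_norm ?sqr_ge0//.
  by rewrite ler_pXn2r ?nnegrE//; lra.
- rewrite expr0n /= ler_norml; apply/andP; split; nra.
- by rewrite expr0n /= mulr0 mul0r !subr0 normr0 sqr_ge0.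
Qed.

Lemma pos2_ge0 (t : R) : 0 <= pos2 t.
Proof. exact: sqr_ge0. Qed.

Lemma pos2_le0 (t : R) : t <= 0 -> pos2 t = 0.
Proof. by move=> t0; rewrite /pos2 max_l// expr0n. Qed.

Lemma pos2_gt0 (t : R) : 0 < t -> 0 < pos2 t.
Proof. by move=> t0; rewrite /pos2 max_r ?exprn_gt0// ltW. Qed.

Lemma continuous_dpos2 : continuous (fun t : R => 2 * Num.max 0 t).
Proof.
move=> t; apply: cvgM; first exact: cvg_cst.
by apply: (@continuous_max _ _ (fun=> 0) id); [exact: cvg_cst|exact: cvg_id].
Qed.

Lemma C1_on_pos2 U f : C1_on U f -> C1_on U (fun p => pos2 (f p)).
Proof.
move=> H; apply: (C1_on_comp1 (dphi := fun t => 2 * Num.max 0 t) H) => p _.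
  exact: is_derive_pos2.
exact: continuous_dpos2.
Qed.

Lemma C1_on_inv U f : C1_on U f -> (forall p, U p -> f p != 0) -> C1_on U (fun p => (f p)^-1).
Proof.
move=> H f0; apply: (C1_on_comp1 (phi := fun t => t^-1) (dphi := fun t => - (t * t)^-1) H) => p /f0 fp.
  split; first by apply: (@derivableV R R id) => //; exact: derivable_id.
  have -> : 'D_1 (fun t : R => t^-1) (f p) = _ :=
    @deriveV R R id (f p) 1 fp (@derivable_id _ _ (f p) 1).
  by rewrite derive_id /GRing.scale /= mulr1 expr2.
by apply: cvgN; apply: cvgV; [rewrite mulf_neq0|apply: cvgM; exact: cvg_id].
Qed.

End C1_plane.

(** * Partitions of unity on the surface *)

Section surface_C1.
Context {R : realType} (M : closed_surface R).
Implicit Types (c : chart R M) (u v g : M -> R).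

Lemma C1_cst (k : R) : C1 (fun _ : M => k).
Proof. by move=> c ac; exact: C1_on_cst. Qed.

Lemma C1D u v : C1 u -> C1 v -> C1 (fun x => u x + v x).
Proof. by move=> Hu Hv c ac; exact: (C1_onD (Hu c ac) (Hv c ac)). Qed.

Lemma C1M u v : C1 u -> C1 v -> C1 (fun x => u x * v x).
Proof. by move=> Hu Hv c ac; exact: (C1_onM (Hu c ac) (Hv c ac)). Qed.

Lemma C1_sum (I : Type) (s : seq I) (F : I -> M -> R) : (forall i, C1 (F i)) ->
  C1 (fun x => \sum_(i <- s) F i x).
Proof.
move=> HF; elim: s => [|i s IH].
  rewrite (_ : (fun _ => _) = fun=> 0); first exact: C1_cst.
  by apply/funext => x; rewrite big_nil.
rewrite (_ : (fun _ => _) = fun x => F i x + \sum_(i <- s) F i x); first exact: C1D.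
by apply/funext => x; rewrite big_cons.
Qed.

Lemma C1_inv u : C1 u -> (forall x, u x != 0) -> C1 (fun x => (u x)^-1).
Proof. by move=> Hu u0 c ac; apply: (C1_on_inv (Hu c ac)) => p _; exact: u0. Qed.

Definition bump_plane (p0 : R * R) (r : R) (q : R * R) : R :=
  pos2 (r ^+ 2 - (q.1 - p0.1) ^+ 2) * pos2 (r ^+ 2 - (q.2 - p0.2) ^+ 2).

Lemma C1_on_bump_plane U p0 r : C1_on U (bump_plane p0 r).
Proof.
have H (f : R * R -> R) k : C1_on U f -> C1_on U (fun q => pos2 (r ^+ 2 - (f q - k) ^+ 2)).
  move=> Hf; apply: C1_on_pos2.
  have Hfk := C1_onD Hf (C1_on_cst U (- k)).
  have := C1_onD (C1_on_cst U (r ^+ 2)) (C1_onM (C1_on_cst U (-1)) (C1_onM Hfk Hfk)).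
  rewrite (_ : (fun p => r ^+ 2 + _) = fun q => r ^+ 2 - (f q - k) ^+ 2)//.
  by apply/funext => q; rewrite mulN1r expr2.
by apply: C1_onM; apply: H; [exact: C1_on_fst|exact: C1_on_snd].
Qed.

Lemma bump_plane_ge0 p0 r q : 0 <= bump_plane p0 r q.
Proof. by rewrite mulr_ge0// pos2_ge0. Qed.

Lemma bump_plane_gt0 p0 r : 0 < r -> 0 < bump_plane p0 r p0.
Proof.
by move=> r0; rewrite /bump_plane !subrr expr0n /= subr0 mulr_gt0// pos2_gt0// exprn_gt0.
Qed.

Lemma bump_plane_eq0 p0 r q : 0 < r -> ~ (q.1 \in `[p0.1 - r, p0.1 + r] /\
  q.2 \in `[p0.2 - r, p0.2 + r]) -> bump_plane p0 r q = 0.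
Proof.
move=> r0 nq.
have H (x y : R) : x \notin `[y - r, y + r] -> pos2 (r ^+ 2 - (x - y) ^+ 2) = 0.
  rewrite in_itv /= -ler_distl -ltNge => xy; apply: pos2_le0; rewrite subr_le0.
  by rewrite -[leRHS]real_normK ?num_real// ler_pXn2r ?nnegrE// ltW.
rewrite /bump_plane.
have [q1|/H ->] := boolP (q.1 \in `[p0.1 - r, p0.1 + r]); last by rewrite mul0r.
have [q2|/H ->] := boolP (q.2 \in `[p0.2 - r, p0.2 + r]); last by rewrite mulr0.
by case: nq.
Qed.

(** A plane bump read through the chart and extended by 0. In any other chart it is C^1 on the
    overlap, by composition, and off [K], where it is 0; [K] is compact, hence closed in the
    Hausdorff surface, and these two open sets cover the chart. *)
Lemma bump_exists (x : M) : exists psi : M -> R, [/\ C1 psi, forall y, 0 <= psi y,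
  0 < psi x & supported (chart_at x) psi].
Proof.
set c := chart_at x; have ac : atlas c := atlas_chart_at x.
have cx : dom c x := dom_chart_at x; pose p0 := to_plane c x.
have cp0 : img c p0 by exact: to_planeP.
have /nbhs_ballP[e /= e0 He] := open_near (@open_img _ _ c) cp0.
pose r := e / 2; have r0 : 0 < r by rewrite divr_gt0.
pose K0 : set (R * R) := `[p0.1 - r, p0.1 + r]%classic `*` `[p0.2 - r, p0.2 + r]%classic.
have K0c : K0 `<=` img c.
  move=> q [/= q1 q2]; apply: He; move: q1 q2; rewrite !in_itv /= -!ler_distl => q1 q2.
  by split; rewrite /ball /= distrC; [apply: le_lt_trans q1 _|apply: le_lt_trans q2 _]; rewrite /r; lra.
have cK0 : compact K0 by apply: compact_setX; exact: segment_compact.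
pose psi (y : M) : R := if pselect (dom c y) then bump_plane p0 r (to_plane c y) else 0.
pose K : set M := of_plane c @` K0.
have cK : compact K.
  apply: continuous_compact => //; apply: continuous_in_subspaceT => q /set_mem/K0c cq.
  exact: (of_plane_continuous (mem_set cq)).
have clK : closed K by apply: (compact_closed _ cK); exact: surface_hausdorff.
have Kc : K `<=` dom c by move=> _ [q /K0c cq <-]; exact: of_planeP.
have psi0 y : ~ K y -> psi y = 0.
  move=> nKy; rewrite /psi; case: pselect => // cy; apply: bump_plane_eq0 => // -[q1 q2].
  by apply: nKy; exists (to_plane c y); [split|exact: to_planeK].
exists psi; split.
- move=> c' ac'; pose A := overlap c' c; pose B := [set p | img c' p /\ (~` K) (of_plane c' p)].
  have oA : open A by exact: open_overlap.
  have oB : open B by apply: open_preimage_of_plane; exact: closed_openC.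
  have AB : img c' `<=` A `|` B.
    move=> p cp; have [Kp|nKp] := pselect (K (of_plane c' p)); last by right.
    by left; split => //; exact: Kc.
  apply: (C1_on_sub AB); apply: C1_onU => //.
    have [/(smooth_on_grad oA) H1 /(smooth_on_grad oA) H2] := atlas_smooth ac' ac.
    apply: (@C1_on_eq _ A (fun p => bump_plane p0 r ((transition c' c p).1, (transition c' c p).2))) => //.
      move=> p [cp c'p]; rewrite -surjective_pairing /psi /=.
      by case: pselect.
    apply: (@C1_on_comp2 _ A setT (bump_plane p0 r)) => //; first exact: C1_on_bump_plane.
      by do 2 eexists; exact: H1.
    by do 2 eexists; exact: H2.
  apply: (@C1_on_eq _ B (fun=> 0)) => //; last exact: C1_on_cst.
  by move=> p [cp nKp]; rewrite /= psi0.
- by move=> y; rewrite /psi; case: pselect => // ?; exact: bump_plane_ge0.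
- by rewrite /psi; case: pselect => // ?; exact: bump_plane_gt0.
- by exists K.
Qed.

(** By compactness finitely many bumps are nowhere all zero; they are divided by their sum. *)
Lemma partition_of_unity : exists (s : seq M) (rho : M -> M -> R),
  [/\ forall x, C1 (rho x), forall x y, 0 <= rho x y,
    forall x, supported (chart_at x) (rho x) & forall y, \sum_(x <- s) rho x y = 1].
Proof.
have [psi Hpsi] := choice bump_exists.
have [s Hs] : exists s : seq M, forall y, exists2 x, x \in s & 0 < psi x y.
  have [[x0 _]|M0] := pselect ([set: M] !=set0); last first.
    by exists [::] => y; case: M0; exists y.
  pose pM := isPointed.Build (carrier M) x0.
  pose M' : ptopologicalType := HB.pack (carrier M) pM.
  have cM : @cover_compact M' [set: M'].
    by rewrite -compact_cover; exact: surface_compact.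
  have [|x _|D' _ D'M] := cM M' [set: M'] (fun x => [set y | 0 < psi x y]).
  - move=> x _; have [H1 _ _ _] := Hpsi x.
    by apply: (@open_comp _ _ (psi x) [set t | 0 < t]) => [y _|]; [exact: C1_continuous|exact: open_gt].
  - by exists x => //; case: (Hpsi x).
  exists (finmap.enum_fset D') => y; have [x xD xy] := D'M y I; by exists x.
pose S (y : M) : R := \sum_(x <- s) psi x y.
have S0 y : 0 < S y.
  have [x xs xy] := Hs y; rewrite /S (big_rem x)//= ltr_pwDl// sumr_ge0// => z _.
  by case: (Hpsi z).
have SC : C1 S by apply: C1_sum => x; case: (Hpsi x).
exists s, (fun x y => psi x y * (S y)^-1); split.
- move=> x; apply: C1M; first by case: (Hpsi x).
  by apply: C1_inv => // y; rewrite gt_eqF.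
- by move=> x y; rewrite mulr_ge0 ?invr_ge0 ?(ltW (S0 y))//; case: (Hpsi x).
- move=> x; have [_ _ _ [K [cK Kc K0]]] := Hpsi x.
  by exists K; split => // y /K0 ->; rewrite mul0r.
- by move=> y; rewrite -mulr_suml -/(S y) divff// gt_eqF.
Qed.

End surface_C1.

(** * Stokes' formula on the surface *)

Section stokes.
Context {R : realType} (M : closed_surface R) (omega : area_form M).
Local Notation mu := (@lebesgue_measure R).
Local Notation RR := (measurableTypeR R).
Local Notation mu2 := (mu \x mu)%E.
Implicit Types (c : chart R M) (u v g h : M -> R).
Local Notation bracket := (poisson omega).

Lemma poissonD u v g : C1 u -> C1 v -> C1 g ->
  bracket (fun x => u x + v x) g = (fun x => bracket u g x + bracket v g x).
Proof.
move=> Hu Hv Hg; apply/funext => x; set c := chart_at x.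
have ac : atlas c := atlas_chart_at x; have cx : dom c x := dom_chart_at x.
have cp := to_planeP cx; have oc := @open_img _ _ c.
rewrite !(poissonE omega _ Hg ac cx)//; last exact: C1D.
have [ux [uy Gu]] := Hu _ ac; have [vx [vy Gv]] := Hv _ ac; have [gx [gy Gg]] := Hg _ ac.
rewrite /d_wedge_d (grad_on_jacobian oc Gu Gg cp).1 (grad_on_jacobian oc Gv Gg cp).1.
have := (grad_on_jacobian oc (grad_onD Gu Gv) Gg cp).1.
rewrite -[(fun p => (u \o of_plane c) p + _)]/((fun x => u x + v x) \o of_plane c) => ->.
by rewrite -mulrDl; congr (_ / _); lra.
Qed.

Lemma poisson0l g : C1 g -> bracket (fun=> 0) g = (fun=> 0).
Proof.
move=> Hg; have C0 : C1 (fun _ : M => 0 : R) by exact: C1_cst.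
have := poissonD C0 C0 Hg; rewrite (_ : (fun x : M => 0 + 0) = fun=> 0); last first.
  by apply/funext => x; rewrite addr0.
move=> E; apply/funext => x; have := congr1 (fun f => f x) E => /= /eqP.
by rewrite -[X in X == _]addr0 -subr_eq0 opprD addrACA subrr add0r add0r oppr_eq0 => /eqP.
Qed.

Lemma poisson_sum (I : Type) (s : seq I) (F : I -> M -> R) g : (forall i, C1 (F i)) -> C1 g ->
  bracket (fun x => \sum_(i <- s) F i x) g = (fun x => \sum_(i <- s) bracket (F i) g x).
Proof.
move=> HF Hg; elim: s => [|i s IH].
  rewrite (_ : (fun x => _) = fun=> 0); last by apply/funext => x; rewrite big_nil.
  by rewrite poisson0l//; apply/funext => x; rewrite big_nil.
rewrite (_ : (fun x => _) = fun x => F i x + \sum_(i <- s) F i x); last first.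
  by apply/funext => x; rewrite big_cons.
rewrite poissonD//; last exact: C1_sum.
by rewrite IH; apply/funext => x; rewrite big_cons.
Qed.

Lemma poisson_supported c u g : C1 u -> C1 g -> supported c u -> supported c (bracket u g).
Proof.
move=> Hu Hg [K [cK Kc u0]]; exists K; split => // x nKx.
set c' := chart_at x; have ac : atlas c' := atlas_chart_at x; have cx : dom c' x := dom_chart_at x.
have cp := to_planeP cx.
pose B := [set p | img c' p /\ (~` K) (of_plane c' p)].
have oB : open B by apply: open_preimage_of_plane; exact: closed_openC.
have Bp : B (to_plane c' x) by split => //; rewrite to_planeK.
have [gx [gy Gg]] := Hg _ ac.
have Gg' : grad_on B (g \o of_plane c') gx gy by apply: grad_on_sub Gg => p [].
have Gu : grad_on B (u \o of_plane c') (fun=> 0) (fun=> 0).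
  apply: (grad_on_near oB _ _ _ (@grad_on_cst R B 0)) => // p [_ nKp].
  by rewrite /= u0.
rewrite (poissonE omega Hu Hg ac cx) /d_wedge_d (grad_on_jacobian oB Gu Gg' Bp).1.
by rewrite !mul0r subrr oppr0 mul0r.
Qed.

Lemma supportedMl c u v : supported c u -> supported c (fun x => u x * v x).
Proof. by move=> [K [cK Kc u0]]; exists K; split => // x /u0 ->; rewrite mul0r. Qed.

Lemma supportedMr c u v : supported c v -> supported c (fun x => u x * v x).
Proof. by move=> [K [cK Kc u0]]; exists K; split => // x /u0 ->; rewrite mulr0. Qed.

Lemma chart_integral_sum c (I : Type) (s : seq I) (h : I -> M -> R) : atlas c ->
  (forall i, continuous (h i)) -> (forall i, supported c (h i)) ->
  chart_integral omega c (fun x => \sum_(i <- s) h i x) =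
    (\sum_(i <- s) chart_integral omega c (h i))%E.
Proof.
move=> ac ch sh; have mc := measurable_img c.
(* Integrability is carried along in the induction, to split the integral of each sum. *)
suff [_ ->] : mu2.-integrable (img c : set (RR * RR))
    (fun p : RR * RR => (chart_density omega c (fun x => \sum_(i <- s) h i x) p)%:E) /\
    chart_integral omega c (fun x => \sum_(i <- s) h i x) =
    (\sum_(i <- s) chart_integral omega c (h i))%E by [].
elim: s => [|i s [IH1 IH2]].
  rewrite big_nil (_ : (fun x => \sum_(i <- [::]) h i x) = fun=> 0); last by apply/funext => x; rewrite big_nil.
  rewrite /chart_integral /chart_density; split.
    by under eq_fun do rewrite mul0r; exact: integrable0.
  by apply: integral0_eq => p _; rewrite mul0r.
rewrite (_ : (fun x => \sum_(j <- i :: s) h j x) = fun x => h i x + \sum_(i <- s) h i x); last first.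
  by apply/funext => x; rewrite big_cons.
have i1 := supported_integrable omega ac (ch i) (sh i).
have E p : (chart_density omega c (fun x => h i x + \sum_(i <- s) h i x) p)%:E =
   ((chart_density omega c (h i) p)%:E + (chart_density omega c (fun x => \sum_(i <- s) h i x)%R p)%:E)%E.
  by rewrite -EFinD /chart_density mulrDl.
split.
  by under eq_fun do rewrite E; exact: integrableD.
rewrite big_cons -IH2 /chart_integral -integralD//.
by apply: eq_integral => p _; rewrite E.
Qed.

(* The integral of {f, g} omega over the surface, computed with a partition of  *)
(* unity, vanishes because {rho f, g} omega is exact for each cut-off rho.     *)
Lemma poisson_ge0_eq0 f g : C1 f -> smooth g -> (forall x, 0 <= bracket f g x) ->
  forall x, bracket f g x = 0.
Proof.
move=> Hf sg h0; have Hg := smooth_C1 sg.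
have [s [rho [Crho rho0 srho sum1]]] := @partition_of_unity _ M.
pose h := bracket f g.
pose fj j x := rho j x * f x.
have Cfj j : C1 (fj j) by exact: C1M.
have crho i : continuous (rho i) by exact: C1_continuous.
have hE x : h x = \sum_(j <- s) bracket (fj j) g x.
  rewrite /h -[RHS]/((fun x => \sum_(j <- s) bracket (fj j) g x) x) -poisson_sum//.
  congr (bracket _ g x); apply/funext => y.
  by rewrite /fj -mulr_suml sum1 mul1r.
have cM u v : continuous u -> continuous v -> continuous (fun x => u x * v x).
  by move=> cu cv x; apply: cvgM; [exact: cu|exact: cv].
have cb j : continuous (bracket (fj j) g) by exact: poisson_continuous.
have sb j : supported (chart_at j) (bracket (fj j) g).
  by apply: poisson_supported => //; exact: supportedMl.
pose I c u := chart_integral omega c u.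
(* The product of [rho i] and the bracket of [fj j] with [g] is supported in both charts, so its
   integral may be taken in the chart of [j]. Summing over [i] first then removes [rho i], and
   Stokes' formula in the chart of [j] gives 0. *)
have tot : (\sum_(i <- s) I (chart_at i) (fun x => rho i x * h x)%R = 0)%E.
  transitivity (\sum_(i <- s) \sum_(j <- s) I (chart_at j) (fun x => rho i x * bracket (fj j) g x)%R)%E.
    apply: eq_bigr => i _.
    transitivity (\sum_(j <- s) I (chart_at i) (fun x => rho i x * bracket (fj j) g x)%R)%E.
      rewrite -chart_integral_sum.
      - by congr chart_integral; apply/funext => x; rewrite hE mulr_sumr.
      - exact: atlas_chart_at.
      - by move=> j; exact: cM.
      - by move=> j; exact: supportedMl.
    apply: eq_bigr => j _; apply: chart_integral_change.
    - exact: atlas_chart_at.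
    - exact: atlas_chart_at.
    - exact: cM.
    - move=> x; have [K1 [_ K1c r0]] := srho i; have [K2 [_ K2c b0]] := sb j.
      have [/K1c ci|nK1] := pselect (K1 x); last by rewrite r0// mul0r.
      have [/K2c cj|nK2] := pselect (K2 x); last by rewrite b0// mulr0.
      by case.
  rewrite exchange_big; apply: big1 => j _ /=.
  rewrite -chart_integral_sum.
  - rewrite -[RHS](chart_stokes omega (atlas_chart_at j) (Cfj j) sg); last exact: supportedMl.
    by congr chart_integral; apply/funext => x; rewrite -mulr_suml sum1 mul1r.
  - exact: atlas_chart_at.
  - by move=> i; exact: cM.
  - by move=> i; exact: supportedMr.
have ch : continuous h by exact: poisson_continuous.
have I0 i : (0 <= I (chart_at i) (fun x => rho i x * h x)%R)%E.
  apply: integral_ge0 => p _; rewrite lee_fin /chart_density mulr_ge0// mulr_ge0//; exact: h0.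
move=> x.
(* The terms of the total are nonnegative, so each of them is 0; one whose cut-off is positive at
   [x] forces [h x = 0]. *)
have [i si rix] : exists2 i, i \in s & 0 < rho i x.
  apply: contrapT => H; have := sum1 x; rewrite big_seq big1 => [/eqP|].
    by rewrite eq_sym oner_eq0.
  move=> i si; apply/eqP; rewrite eq_le rho0 andbT leNgt; apply/negP => ri; apply: H.
  by exists i.
set c := chart_at i; have ac : atlas c := atlas_chart_at i.
have cx : dom c x.
  have [K [_ Kc r0]] := srho i; apply: Kc; apply: contrapT => /r0 r.
  by rewrite r ltxx in rix.
have Ii : I c (fun x => rho i x * h x) = 0%E.
  apply/eqP; rewrite eq_le I0 andbT -tot (big_rem i)//= leeDl// sume_ge0//.
have cp := to_planeP cx.
have := integral0_continuous_eq0 (@open_img _ _ c) _ _ Ii cp.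
move=> H; have : chart_density omega c (fun x => rho i x * h x) (to_plane c x) = 0.
  apply: H => p cp'.
    by apply: chart_density_continuous => //; exact: cM.
  by rewrite /chart_density mulr_ge0// mulr_ge0//; exact: h0.
rewrite /chart_density to_planeK// => /eqP; rewrite mulf_eq0 normr_eq0.
rewrite (negbTE (form_neq0 omega ac cp)) orbF mulf_eq0 (gt_eqF rix) => /eqP; exact.
Qed.

End stokes.

(** * Fibres of (F, G) *)

Section cut_off.
Context {R : realType}.

Lemma is_derive_pos2_affine (e k t : R) :
  is_derive t 1 (fun s => pos2 (e * s + k)) (e * (2 * Num.max 0 (e * t + k))).
Proof.
have da : is_derive t 1 (fun s : R => e * s + k) e.
  apply: is_derive_quadratic => s.
  by rewrite (_ : _ - _ - _ = 0) ?normr0 ?sqr_ge0//; ring.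
have := @is_derive1_comp _ pos2 (fun s => e * s + k) t _ _ (is_derive_pos2 _) da.
by rewrite mulrC.
Qed.

Lemma continuous_max0_affine (e k : R) : continuous (fun t : R => e * (2 * Num.max 0 (e * t + k))).
Proof.
move=> t; apply: cvgM; first exact: cvg_cst.
have ca : {for t, continuous (fun s : R => e * s + k)}.
  by apply: cvgD; [apply: cvgM; [exact: cvg_cst|exact: cvg_id]|exact: cvg_cst].
exact: (continuous_comp ca (@continuous_dpos2 R _)).
Qed.

(* Its derivative is a hat function supported in [a - d, a + d]. *)
Definition step (a d t : R) : R :=
  pos2 (1 * t + (d - a)) + (-2) * pos2 (1 * t - a) + pos2 (1 * t + (- d - a)).

Definition dstep (a d t : R) : R :=
  1 * (2 * Num.max 0 (1 * t + (d - a))) + (-2) * (1 * (2 * Num.max 0 (1 * t - a)))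
  + 1 * (2 * Num.max 0 (1 * t + (- d - a))).

Lemma is_derive_step (a d t : R) : is_derive t 1 (step a d) (dstep a d t).
Proof.
have H k := is_derive_pos2_affine 1 k t.
rewrite /step /dstep; apply: is_deriveD; exact: is_deriveD.
Qed.

Lemma continuous_dstep (a d : R) : continuous (dstep a d).
Proof.
move=> t; rewrite /dstep; apply: cvgD; first apply: cvgD.
- exact: continuous_max0_affine.
- by apply: cvgM; [exact: cvg_cst|exact: continuous_max0_affine].
- exact: continuous_max0_affine.
Qed.

Lemma dstep_ge0 (a d t : R) : 0 < d -> 0 <= dstep a d t.
Proof.
move=> d0; rewrite /dstep.
have [h1|h1] := leP 0 (1 * t + (d - a)); have [h2|h2] := leP 0 (1 * t - a);
have [h3|h3] := leP 0 (1 * t + (- d - a)); lra.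
Qed.

Lemma dstep_gt0 (a d : R) : 0 < d -> 0 < dstep a d a.
Proof.
move=> d0; rewrite /dstep.
have [h1|h1] := leP 0 (1 * a + (d - a)); have [h2|h2] := leP 0 (1 * a - a);
have [h3|h3] := leP 0 (1 * a + (- d - a)); lra.
Qed.

Lemma dstep_eq0 (a d t : R) : 0 < d -> d < `|t - a| -> dstep a d t = 0.
Proof.
move=> d0; rewrite /dstep => dt.
have [ta|ta] := leP 0 (t - a); [rewrite ger0_norm// in dt|rewrite ltr0_norm// in dt];
have [h1|h1] := leP 0 (1 * t + (d - a)); have [h2|h2] := leP 0 (1 * t - a);
have [h3|h3] := leP 0 (1 * t + (- d - a)); lra.
Qed.

End cut_off.

Section fibers.
Context {R : realType} (M : closed_surface R) (omega : area_form M).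
Implicit Types (F G : M -> R).
Local Notation bracket := (poisson omega).

(** Since [dG /\ dG = 0], the derivative of [eta] contributes nothing to the wedge with [dG]. *)
Lemma poisson_comp F G (alpha dalpha eta deta : R -> R) : C1 F -> C1 G ->
  (forall t : R, is_derive t 1 alpha (dalpha t)) -> continuous dalpha ->
  (forall t : R, is_derive t 1 eta (deta t)) -> continuous deta ->
  C1 (fun x => alpha (F x) * eta (G x)) /\
  forall x, bracket (fun y => alpha (F y) * eta (G y)) G x =
    dalpha (F x) * eta (G x) * bracket F G x.
Proof.
move=> HF HG da cda de cde.
have grad c : atlas c -> exists fx fy gx gy, [/\ grad_on (img c) (F \o of_plane c) fx fy,
    grad_on (img c) (G \o of_plane c) gx gy &
    let u := alpha \o F \o of_plane c in let v := eta \o G \o of_plane c in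
    let du := dalpha \o F \o of_plane c in let dv := deta \o G \o of_plane c in
    grad_on (img c) (fun p => u p * v p)
      (fun p => (du p * fx p) * v p + u p * (dv p * gx p))
      (fun p => (du p * fy p) * v p + u p * (dv p * gy p))].
  move=> ac; have [fx [fy Gf]] := HF _ ac; have [gx [gy Gg]] := HG _ ac.
  exists fx, fy, gx, gy; split => //=.
  by apply: grad_onM; apply: grad_on_comp1 => // p cp; [exact: cda|exact: cde].
have CM : C1 (fun x => alpha (F x) * eta (G x)).
  by move=> c /grad[fx [fy [gx [gy [_ _ H]]]]]; do 2 eexists; exact: H.
split => // x; set c := chart_at x.
have ac : atlas c := atlas_chart_at x; have cx : dom c x := dom_chart_at x.
have cp := to_planeP cx; have oc := @open_img _ _ c.
rewrite (poissonE omega CM HG ac cx) (poissonE omega HF HG ac cx) /d_wedge_d.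
have [fx [fy [gx [gy [Gf Gg Gh]]]]] := grad c ac.
rewrite (grad_on_jacobian oc Gf Gg cp).1.
have := (grad_on_jacobian oc Gh Gg cp).1; rewrite /= => ->.
by rewrite to_planeK// [RHS]mulrA; congr (_ / _); ring.
Qed.

(** On the compact set where [h <= 0] the continuous function [N] has no zero, so it stays away from
    0, at distance [e] say; two deviations of at most [e / 3] add up to less. *)
Lemma near_fiber (F G h : M -> R) (a b : R) : continuous F -> continuous G -> continuous h ->
  (forall x, F x = a -> G x = b -> 0 < h x) ->
  exists2 d : R, 0 < d & forall x, `|F x - a| <= d -> `|G x - b| <= d -> 0 < h x.
Proof.
move=> cF cG ch H.
pose N x : R := `|F x - a| + `|G x - b|; pose K := [set x | h x <= 0].
have cN : continuous N.
  move=> x; apply: cvgD; apply: cvg_norm; apply: cvgB; [exact: cF|exact: cvg_cst|exact: cG|exact: cvg_cst].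
have cK : compact K.
  apply: (subclosed_compact _ (@surface_compact _ M)) => //.
  by apply: (@closed_comp _ _ h [set t | t <= 0]) => [x _|]; [exact: ch|exact: closed_le].
have NK : closed (N @` K).
  by apply: compact_closed; [exact: Rhausdorff|apply: continuous_compact => //; exact: continuous_subspaceT].
have N0 : (~` (N @` K)) 0.
  move=> [x Kx N0]; have : 0 < h x.
    by apply: H; apply/eqP; rewrite -subr_eq0 -normr_eq0 eq_le normr_ge0 andbT;
      move: N0 (normr_ge0 (F x - a)) (normr_ge0 (G x - b)); rewrite /N => *; lra.
  by rewrite ltNge Kx.
have /nbhs_ballP[e /= e0 He] := open_nbhs_nbhs (conj (closed_openC NK) N0).
exists (e / 3); first by rewrite divr_gt0.
move=> x Fx Gx; rewrite ltNge; apply/negP => Kx.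
apply: (He (N x)); last by exists x.
rewrite /ball /= sub0r normrN ger0_norm ?addr_ge0// /N; lra.
Qed.

Lemma poissonN F G : C1 F -> C1 G ->
  C1 (fun y => - F y) /\ forall x, bracket (fun y => - F y) G x = - bracket F G x.
Proof.
move=> HF HG.
have HN : C1 (fun y => - F y).
  rewrite (_ : (fun y => _) = fun y => -1 * F y); first by apply: C1M => //; exact: C1_cst.
  by apply/funext => y; rewrite mulN1r.
split => // x; have := congr1 (fun h => h x) (poissonD omega HF HN HG).
rewrite (_ : (fun y => F y + - F y) = fun=> 0); last by apply/funext => y; rewrite subrr.
by rewrite poisson0l//= => /eqP; rewrite eq_sym addrC addr_eq0 => /eqP.
Qed.

(* {f, G} for the cut-off f = step(F) eta(G) would be nonnegative and not identically zero. *)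
Lemma fiber_not_positive F G (a b : R) : C1 F -> smooth G ->
  (exists x, F x = a /\ G x = b) ->
  exists x, [/\ F x = a, G x = b & bracket F G x <= 0].
Proof.
move=> HF sG [x0 [Fx0 Gx0]]; apply: contrapT => H.
have HG := smooth_C1 sG.
have pos x : F x = a -> G x = b -> 0 < bracket F G x.
  by move=> Fx Gx; rewrite ltNge; apply/negP => b0; apply: H; exists x.
have [d d0 Hd] := near_fiber (C1_continuous HF) (C1_continuous HG)
  (@poisson_continuous _ _ omega _ _ HF HG) pos.
(* The product is positive at [b] and vanishes at distance more than [d] from [b], where the sign of
   the bracket is unknown. *)
pose eta1 := fun t : R => pos2 (1 * t + (d - b)); pose eta2 := fun t : R => pos2 (-1 * t + (d + b)).
pose deta (t : R) := eta1 t * (-1 * (2 * Num.max 0 (-1 * t + (d + b)))) +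
  eta2 t * (1 * (2 * Num.max 0 (1 * t + (d - b)))).
have de (t : R) : is_derive t 1 (eta1 * eta2) (deta t).
  exact: (is_deriveM (is_derive_pos2_affine _ _ t) (is_derive_pos2_affine _ _ t)).
have cder (f : R -> R) (df : R -> R) : (forall t : R, is_derive t 1 f (df t)) -> continuous f.
  by move=> H1 t; apply: differentiable_continuous; apply/derivable1_diffP; case: (H1 t).
have cdeta : continuous deta.
  move=> t; apply: cvgD; apply: cvgM; try exact: continuous_max0_affine.
    exact: (cder _ _ (is_derive_pos2_affine 1 (d - b))).
  exact: (cder _ _ (is_derive_pos2_affine (-1) (d + b))).
have [Cf fE] := poisson_comp HF HG (is_derive_step a d) (continuous_dstep (a := a) (d := d)) de cdeta.
have eta_ge0 t : 0 <= (eta1 * eta2) t by rewrite mulr_ge0// pos2_ge0.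
have eta_eq0 t : d < `|t - b| -> (eta1 * eta2) t = 0.
  rewrite /eta1 /eta2 => dt; change (pos2 (1 * t + (d - b)) * pos2 (-1 * t + (d + b)) = 0).
  have [tb|tb] := leP 0 (t - b); [rewrite ger0_norm// in dt|rewrite ltr0_norm// in dt].
    by rewrite [X in _ * X]pos2_le0 ?mulr0//; lra.
  by rewrite [X in X * _]pos2_le0 ?mul0r//; lra.
have eta_b : 0 < (eta1 * eta2) b.
  by change (0 < eta1 b * eta2 b); rewrite mulr_gt0// pos2_gt0//; lra.
have f_ge0 x : 0 <= bracket (fun y => step a d (F y) * (eta1 * eta2) (G y)) G x.
  rewrite fE; have [Fx|Fx] := leP `|F x - a| d; last by rewrite dstep_eq0// !mul0r.
  have [Gx|Gx] := leP `|G x - b| d; last by rewrite eta_eq0// mulr0 mul0r.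
  by rewrite mulr_ge0 ?(ltW (Hd _ Fx Gx))// mulr_ge0// dstep_ge0.
have := poisson_ge0_eq0 Cf sG f_ge0 x0.
rewrite fE Fx0 Gx0 => /eqP; apply/negP; rewrite gt_eqF// mulr_gt0 ?pos//.
by rewrite mulr_gt0// dstep_gt0.
Qed.

(** Replacing [F] by [- F] changes the sign of the bracket and maps the fibre over [(a, b)] to the
    one over [(- a, b)]. *)
Lemma fiber_not_negative F G (a b : R) : C1 F -> smooth G ->
  (exists x, F x = a /\ G x = b) ->
  exists x, [/\ F x = a, G x = b & 0 <= bracket F G x].
Proof.
move=> HF sG [x [Fx Gx]].
have [HN NE] := poissonN HF (smooth_C1 sG).
have [|y [Fy Gy]] := @fiber_not_positive _ G (- a) b HN sG.
  by exists x; rewrite Fx.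
by rewrite NE oppr_le0 => h; exists y; split => //; exact: oppr_inj.
Qed.

End fibers.

(** * Areas of triangles *)

Section triangles.
Context {R : realType}.
Local Notation mu := (@lebesgue_measure R).
Local Notation RR := (measurableTypeR R).
Local Notation mu2 := (mu \x mu)%E.

Lemma lebesgue_measure2_swap (S : set (RR * RR)) : measurable S ->
  mu2 [set p | S (p.2, p.1)] = mu2 S.
Proof. by move=> mS; rewrite [RHS]lebesgue_measure2_xy. Qed.

Lemma lebesgue_measure2_shift_snd (k : R) (S : set (RR * RR)) : measurable S ->
  mu2 [set p | S (p.1, p.2 + k)] = mu2 S.
Proof.
move=> mS; apply: eq_integral => x _ /=.
by rewrite -(lebesgue_measure_shift k (measurable_xsection x mS)); congr mu.
Qed.

Lemma open_lt_fun (f g : R * R -> R) : continuous f -> continuous g -> open [set p | f p < g p].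
Proof.
move=> cf cg; rewrite (_ : [set p | _] = (fun p => g p - f p) @^-1` [set t | 0 < t]).
  apply: (@open_comp _ _ (fun p => g p - f p)) => [p _|]; last exact: open_gt.
  by apply: cvgB; [exact: cg|exact: cf].
by apply/seteqP; split => p /=; rewrite subr_gt0.
Qed.

Definition half_square (a b : R) : set (R * R) := [set p | a < p.1 /\ p.1 < p.2 /\ p.2 < b].

Lemma open_half_square a b : open (half_square a b).
Proof.
apply: openI; last apply: openI; apply: open_lt_fun;
  by [move=> p; exact: cvg_cst|move=> p; exact: cvg_fst|move=> p; exact: cvg_snd].
Qed.

(** The open square is the union of the half square, its mirror image and a piece of the diagonal,
    which is null because a shear makes it horizontal. *)
Lemma half_square_ge (a b : R) : a < b ->
  (((b - a) ^+ 2)%:E <= mu2 (half_square a b) + mu2 (half_square a b))%E.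
Proof.
move=> ab; pose L : set (RR * RR) := half_square a b.
have mL : measurable L by apply: open_measurable2; exact: open_half_square.
pose L' : set (RR * RR) := [set p | L (p.2, p.1)].
have mL' : measurable L'.
  rewrite -[X in measurable X]setTI.
  have ms : measurable_fun [set: RR * RR] (fun p : RR * RR => (p.2, p.1) : RR * RR).
    by apply/measurable_fun_pair; [exact: measurable_snd|exact: measurable_fst].
  exact: (ms measurableT _ mL).
pose Z : set (RR * RR) := `]a, b[%classic `*` [set 0].
have mZ : measurable Z by exact: measurableX.
pose D : set (RR * RR) := [set p | Z (p.1, p.2 + (-1) * p.1)].
have mD : measurable D.
  by rewrite -[X in measurable X]setTI; exact: (measurable_shear_snd (-1) measurableT mZ).
have D0 : mu2 D = 0%E.
  rewrite /D lebesgue_measure2_shear_snd//.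
  transitivity (mu `]a, b[%classic * mu [set 0%R])%E; first exact: product_measure1E.
  by rewrite lebesgue_measure_set1 mule0.
pose S : set (RR * RR) := `]a, b[%classic `*` `]a, b[%classic.
have -> : ((b - a) ^+ 2)%:E = mu2 S.
  transitivity (mu `]a, b[%classic * mu `]a, b[%classic)%E; last by symmetry; exact: product_measure1E.
  by rewrite lebesgue_measure_itv /= lte_fin ab -EFinD -EFinM expr2.
have LE : mu2 L' = mu2 L by exact: lebesgue_measure2_swap.
rewrite -[X in (_ <= _ + X)%E]LE -[leRHS]adde0 -{1}D0.
apply: (@le_trans _ _ (mu2 ((L `|` L') `|` D))).
  apply: le_measure; rewrite ?inE; [exact: measurableX|by apply: measurableU => //; exact: measurableU|].
  move=> p [/=]; rewrite !in_itv /= => /andP[a1 b1] /andP[a2 b2].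
  have [h|h|h] := ltgtP p.1 p.2; first by left; left.
    by left; right.
  by right; split => /=; rewrite ?in_itv /= ?a1// h; lra.
by apply: le_trans (leeD2r _ (measureU2 _ mL mL')); apply: measureU2 => //; exact: measurableU.
Qed.

Definition triangle (u v w : R) : set (R * R) := [set p | u < p.1 /\ v < p.2 /\ p.1 + p.2 < w].
Definition cotriangle (u v w : R) : set (R * R) := [set p | p.1 < u /\ p.2 < v /\ w < p.1 + p.2].

Lemma open_triangle u v w : open (triangle u v w).
Proof.
apply: openI; last apply: openI; apply: open_lt_fun => p;
  by [exact: cvg_cst|exact: cvg_fst|exact: cvg_snd|apply: cvgD; [exact: cvg_fst|exact: cvg_snd]].
Qed.

Lemma open_cotriangle u v w : open (cotriangle u v w).
Proof.
apply: openI; last apply: openI; apply: open_lt_fun => p;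
  by [exact: cvg_cst|exact: cvg_fst|exact: cvg_snd|apply: cvgD; [exact: cvg_fst|exact: cvg_snd]].
Qed.

(** A translation and a shear of slope -1 turn the triangle into a half square with legs of length
    [w - u - v]. *)
Lemma triangle_ge (u v w : R) : u + v < w ->
  (((w - u - v) ^+ 2)%:E <= mu2 (triangle u v w) + mu2 (triangle u v w))%E.
Proof.
move=> uvw; have mT : measurable (triangle u v w : set (RR * RR)).
  by apply: open_measurable2; exact: open_triangle.
have mT' : measurable ([set p | triangle u v w (p.1, p.2 + v)] : set (RR * RR)).
  apply: open_measurable2.
  rewrite (_ : [set p | _] = triangle u 0 (w - v)); first exact: open_triangle.
  by apply/seteqP; split => p [/= h1 [h2 h3]]; split => //=; split; rewrite /=; lra.
rewrite -(lebesgue_measure2_shift_snd v mT) -(lebesgue_measure2_shear_snd (-1) mT').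
rewrite (_ : [set p | _] = half_square u (w - v)).
  by rewrite (_ : w - u - v = w - v - u) ?half_square_ge//; lra.
by apply/seteqP; split => p /= [h1 [h2 h3]]; split => //=; split; move: h2 h3 => /=; lra.
Qed.

(** This triangle points the other way: the same moves lead to the mirror image of a half square. *)
Lemma cotriangle_ge (u v w : R) : w < u + v ->
  (((w - u - v) ^+ 2)%:E <= mu2 (cotriangle u v w) + mu2 (cotriangle u v w))%E.
Proof.
move=> uvw; have mT : measurable (cotriangle u v w : set (RR * RR)).
  by apply: open_measurable2; exact: open_cotriangle.
have mT' : measurable ([set p | cotriangle u v w (p.1, p.2 + v)] : set (RR * RR)).
  apply: open_measurable2.
  rewrite (_ : [set p | _] = cotriangle u 0 (w - v)); first exact: open_cotriangle.
  by apply/seteqP; split => p [/= h1 [h2 h3]]; split => //=; split; rewrite /=; lra.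
have mL : measurable (half_square (w - v) u : set (RR * RR)).
  by apply: open_measurable2; exact: open_half_square.
rewrite -(lebesgue_measure2_shift_snd v mT) -(lebesgue_measure2_shear_snd (-1) mT').
rewrite (_ : [set p | _] = [set p | half_square (w - v) u (p.2, p.1)]).
  rewrite lebesgue_measure2_swap// (_ : (w - u - v) ^+ 2 = (u - (w - v)) ^+ 2); last by ring.
  by apply: half_square_ge; lra.
apply/seteqP; split => p /= [h1 [h2 h3]]; split => //=; [|split|..|split] => //=; move: h1 h2 h3 => /=; lra.
Qed.

End triangles.

(** * The area of the image *)

Section image_area.
Context {R : realType} (M : closed_surface R) (omega : area_form M).
Local Notation mu := (@lebesgue_measure R).
Local Notation RR := (measurableTypeR R).
Local Notation mu2 := (mu \x mu)%E.
Variables F G : M -> R.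
Hypothesis F_smooth : smooth F.
Hypothesis G_smooth : smooth G.
Local Notation bracket := (poisson omega F G).
Implicit Types (Q B : set M) (s : seq (chart R M)).

Let FC1 := smooth_C1 F_smooth.
Let GC1 := smooth_C1 G_smooth.

Definition piece Q B (c : chart R M) : set (R * R) :=
  [set p | img c p /\ ~ B (of_plane c p) /\ Q (of_plane c p)].

(* Cut into the same pieces as [area_outside]. *)
Fixpoint wedge_mass Q B s : \bar R :=
  if s is c :: s' then
    (\int[mu2]_(p in piece Q B c) `|d_wedge_d F G c p|%:E + wedge_mass Q (B `|` dom c) s')%E
  else 0%E.

(** The surface carries no sigma-algebra of its own; Borel sets are tested in charts. *)
Definition chart_measurable Q :=
  forall c, measurable ([set p | img c p /\ Q (of_plane c p)] : set (RR * RR)).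

Lemma open_chart_measurable Q : open Q -> chart_measurable Q.
Proof. by move=> oQ c; apply: open_measurable2; exact: open_preimage_of_plane. Qed.

Lemma measurable_piece Q B c : chart_measurable Q -> open B ->
  measurable (piece Q B c : set (RR * RR)).
Proof.
move=> mQ oB; rewrite (_ : piece Q B c = [set p | img c p /\ Q (of_plane c p)] `\`
    [set p | img c p /\ B (of_plane c p)]).
  by apply: measurableD; [exact: mQ|exact: open_chart_measurable].
apply/seteqP; split => p /=; first by move=> [? [? ?]]; split => // -[].
by move=> [[cp Qp] nB]; split => //; split => // Bp; exact: nB.
Qed.

Lemma measurable_d_wedge_d c (A : set (RR * RR)) : atlas c -> measurable A -> A `<=` img c ->
  measurable_fun A (fun p : RR * RR => `|d_wedge_d F G c p|%:E).
Proof.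
move=> ac mA Ac; apply/measurable_EFinP; apply: (measurable_funS (measurable_img c)) => //.
apply: open_continuous_measurable_fun2; first exact: open_img.
by move=> p cp; apply: cvg_norm; exact: d_wedge_d_continuous.
Qed.

Lemma measurable_form c (A : set (RR * RR)) : atlas c -> measurable A -> A `<=` img c ->
  measurable_fun A (fun p : RR * RR => `|omega c p|%:E).
Proof.
move=> ac mA Ac; apply/measurable_EFinP; apply: (measurable_funS (measurable_img c)) => //.
apply: open_continuous_measurable_fun2; first exact: open_img.
by move=> p cp; apply: cvg_norm; exact: form_continuous.
Qed.

Lemma image_piece_le Q B c : atlas c -> chart_measurable Q -> open B ->
  (mu_ext mu2 ((fun p => (F (of_plane c p), G (of_plane c p))) @` piece Q B c) <=
    \int[mu2]_(p in piece Q B c) `|d_wedge_d F G c p|%:E)%E.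
Proof.
move=> ac mQ oB; have [fx [fy Gf]] := FC1 ac; have [gx [gy Gg]] := GC1 ac.
apply: (@image_le_integral _ (img c) (fun p => (F (of_plane c p), G (of_plane c p)))).
- exact: open_img.
- move=> p cp; split => /=.
  + exact: (grad_on_differentiable Gf cp).
  + exact: (grad_on_differentiable Gg cp).
  + exact: d_wedge_d_continuous.
- exact: measurable_piece.
- by move=> p [].
Qed.

(** [B] stands for the part covered by earlier charts: a point is counted in the first chart
    containing it, where the area inequality bounds the image of the piece. *)
Lemma image_le_wedge_mass Q s : chart_measurable Q ->
  (forall c, List.In c s -> atlas c) -> forall B, open B ->
  (mu_ext mu2 ((fun x => (F x, G x)) @`
      [set x | [/\ Q x, ~ B x & exists2 c, List.In c s & dom c x]]) <= wedge_mass Q B s)%E.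
Proof.
move=> mQ; elim: s => [|c s IH] sa B oB /=.
  rewrite (_ : [set x | _] = set0) ?image_set0 ?mu_ext0 ?measure0//.
  by apply/seteqP; split => // x [_ _ []].
have ac : atlas c by apply: sa; left.
have oBc : open (B `|` dom c) by apply: openU => //; exact: open_dom.
have {}IH := IH (fun c' c's => sa c' (or_intror c's)) _ oBc.
apply: le_trans (leeD (image_piece_le ac mQ oB) IH).
apply: le_trans (outer_measureU2 _ _ _).
apply: le_mu_ext => _ [x [Qx nBx [c' c's c'x]] <-].
have [cx|ncx] := pselect (dom c x).
  left; exists (to_plane c x); last by rewrite to_planeK.
  by split; [exact: to_planeP|rewrite to_planeK].
right; exists x => //; split => //; first by case.
by case: c's c'x => [<-|c's] c'x; [case: ncx|exists c'].
Qed.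

(** In a chart the density of [dF /\ dG] is at most the supremum norm of the bracket times that of
    the area, and disjoint regions use disjoint parts of the area. *)
Lemma wedge_mass_le Q1 Q2 s : chart_measurable Q1 -> chart_measurable Q2 ->
  Q1 `&` Q2 = set0 -> (0 <= sup_norm bracket)%E ->
  (forall c, List.In c s -> atlas c) -> forall B, open B ->
  (wedge_mass Q1 B s + wedge_mass Q2 B s <= sup_norm bracket * area_outside omega B s)%E.
Proof.
move=> m1 m2 Q12 S0; elim: s => [|c s IH] sa B oB /=; first by rewrite mule0 adde0.
have ac : atlas c by apply: sa; left.
have oBc : open (B `|` dom c) by apply: openU => //; exact: open_dom.
have {}IH := IH (fun c' c's => sa c' (or_intror c's)) _ oBc.
have area0 s' : forall B', (0 <= area_outside omega B' s')%E.
  elim: s' => [|c' s' IH'] B' //=; rewrite adde_ge0 ?IH'//.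
  by apply: integral_ge0 => p _; rewrite lee_fin.
have mp1 := measurable_piece c m1 oB; have mp2 := measurable_piece c m2 oB.
pose A : set (RR * RR) := [set p | img c p /\ ~ B (of_plane c p)].
have mA : measurable A.
  have mT : chart_measurable setT by apply: open_chart_measurable; exact: openT.
  rewrite (_ : A = piece setT B c); first exact: measurable_piece.
  by apply/seteqP; split => p [? h]; split => //; case: h.
rewrite addeACA ge0_muleDr//; last by apply: integral_ge0 => p _; rewrite lee_fin.
apply: leeD IH.
rewrite -ge0_integral_setU//; last 2 first.
- by apply: measurable_d_wedge_d => //; [exact: measurableU|move=> p [[]|[]]].
- apply/disj_setPS => p [[_ [_ Qp]] [_ [_ Qp']]].
  by have : (Q1 `&` Q2) (of_plane c p) by []; rewrite Q12.
apply: (@le_trans _ _ (\int[mu2]_(p in A) `|d_wedge_d F G c p|%:E)%E).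
  apply: ge0_subset_integral => //; first exact: measurableU.
    by apply: measurable_d_wedge_d => // p [].
  by move=> p [|] [? []].
have mw : measurable_fun A (fun p : RR * RR => `|omega c p|%:E).
  by apply: measurable_form => // p [].
rewrite -ge0_integralZl//; apply: ge0_le_integral => //.
- by apply: measurable_d_wedge_d => // p [].
- by apply: emeasurable_funM => //; exact: measurable_cst.
move=> p [cp _]; rewrite (normr_d_wedge_d omega FC1 GC1 ac cp) EFinM.
by apply: lee_wpmul2r => //; apply: ereal_sup_ubound; exists (of_plane c p).
Qed.

(** Combined with [image_le_wedge_mass], this makes the set of critical values null. *)
Lemma wedge_mass_critical s : (forall c, List.In c s -> atlas c) ->
  forall B, wedge_mass [set x | bracket x = 0] B s = 0%E.
Proof.
elim: s => [|c s IH] sa B //=; have ac : atlas c by apply: sa; left.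
rewrite IH ?adde0; last by move=> c' c's; apply: sa; right.
apply: integral0_eq => p [cp [_ /= h0]].
by rewrite (normr_d_wedge_d omega FC1 GC1 ac cp) h0 normr0 mul0r.
Qed.

(* Each value is taken at a critical point, or at points of both signs of the bracket. *)
Lemma image_measure_le (T : set (RR * RR)) : measurable T ->
  (forall p, T p -> exists x, F x = p.1 /\ G x = p.2) -> (0 <= sup_norm bracket)%E ->
  (mu2 T + mu2 T <= sup_norm bracket * area omega)%E.
Proof.
move=> mT HT S0.
pose s := map (@chart_at R M) (sval (cid (@finite_subatlas R M))).
have sa c : List.In c s -> atlas c.
  by move=> /List.in_map_iff[x [<- _]]; exact: atlas_chart_at.
have scov x : exists2 c, List.In c s & dom c x.
  have [y ys yx] := svalP (cid (@finite_subatlas R M)) x I.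
  exists (chart_at y) => //; apply/List.in_map_iff; exists y; split => //.
  move: ys => /=; elim: (sval _) => // z t IH; rewrite inE => /orP[/eqP ->|/IH]; by [left|right].
have cb : continuous bracket by exact: poisson_continuous.
pose pos := [set x | 0 < bracket x]; pose neg := [set x | bracket x < 0].
pose crit := [set x | bracket x = 0].
have opos : open pos.
  by apply: (@open_comp _ _ bracket [set t | 0 < t]) => [x _|]; [exact: cb|exact: open_gt].
have oneg : open neg.
  by apply: (@open_comp _ _ bracket [set t | t < 0]) => [x _|]; [exact: cb|exact: open_lt].
have mpos := open_chart_measurable opos; have mneg := open_chart_measurable oneg.
have mcrit : chart_measurable crit.
  move=> c; rewrite (_ : [set p | _] = img c `\`
     ([set p | img c p /\ pos (of_plane c p)] `|` [set p | img c p /\ neg (of_plane c p)])).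
    by apply: measurableD; [exact: measurable_img|exact: measurableU].
  apply/seteqP; split => p /=.
    by rewrite /crit /pos /neg /= => -[cp b0]; split => //; rewrite b0 ltxx => -[] [].
  move=> [cp H]; split => //; rewrite /crit /=.
  by have [h|h|//] := ltgtP (bracket (of_plane c p)) 0; case: H; [right|left].
pose im Q : set (RR * RR) := (fun x => (F x, G x)) @` Q.
have o0 : open (set0 : set M) by exact: open0.
have imE Q : chart_measurable Q -> (mu_ext mu2 (im Q) <= wedge_mass Q set0 s)%E.
  move=> mQ; apply: le_trans (image_le_wedge_mass mQ sa o0).
  by apply: le_mu_ext => _ [x Qx <-]; exists x => //; split => //; exact: scov.
(* Used once for [pos] and once for [neg]: each covers [T] up to critical values, whence the factor
   2. *)
have half Q : chart_measurable Q -> (forall p, T p -> im crit p \/ im Q p) ->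
    (mu2 T <= wedge_mass Q set0 s)%E.
  move=> mQ TQ; rewrite -(measurable_mu_extE _ mT).
  apply: (@le_trans _ _ (mu_ext mu2 (im crit `|` im Q))).
    by apply: le_mu_ext => p /TQ.
  apply: le_trans (outer_measureU2 _ _ _) _.
  rewrite -[leRHS]add0e -(wedge_mass_critical sa set0).
  by apply: leeD; exact: imE.
apply: le_trans (wedge_mass_le mpos mneg _ S0 sa o0); last first.
  by apply/seteqP; split => // x [/lt_trans H /H]; rewrite ltxx.
apply: leeD; apply: half => // -[p1 p2] /HT[x Hx].
  have [y [Fy Gy]] := fiber_not_negative omega FC1 G_smooth (ex_intro _ x Hx).
  rewrite -[p1]Fy -[p2]Gy le_eqVlt => /orP[/eqP h|h]; [left|right]; by exists y.
have [y [Fy Gy]] := fiber_not_positive omega FC1 G_smooth (ex_intro _ x Hx).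
rewrite -[p1]Fy -[p2]Gy le_eqVlt => /orP[/eqP h|h]; [left|right]; by exists y.
Qed.

End image_area.

(** * From simple to representable quasi-states *)

Section hulls.
Context {R : realType} {X : topologicalType}.
Local Notation C := (continuousType X R).
Implicit Types (S : set (C -> R)) (zeta : C -> R).

Lemma eval_continuous (H : C) : continuous (fun z : {ptws C -> R} => z H).
Proof. exact: (@proj_continuous _ (fun=> R) H). Qed.

(* The defect of additivity is linear and continuous in the functional, so that its   *)
(* sublevel sets are closed and convex.                                               *)
Lemma closed_convex_hull_additivity_defect S zeta (F G H : C) (k : \bar R) :
  (forall z, S z -> ((`|z H - z F - z G| ^+ 2)%:E <= k)%E) ->
  closed_convex_hull S zeta -> ((`|zeta H - zeta F - zeta G| ^+ 2)%:E <= k)%E.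
Proof.
pose A : set (C -> R) := [set z | ((`|z H - z F - z G| ^+ 2)%:E <= k)%E].
move=> SA; suff hA : closed (A : set {ptws C -> R}) /\ convex_set (A : set (convex_lmodType (C -> R^o))).
  exact: (@smallest_sub _ _ _ A hA SA zeta).
rewrite /A {SA A}.
case: k => [k| |].
- split.
  + pose d (z : {ptws C -> R}) : R := `|z H - z F - z G|.
    rewrite (_ : [set z | _] = (fun z => d z * d z) @^-1` [set t | t <= k]).
      apply: (@closed_comp _ _ (fun z => d z * d z)); last exact: closed_le.
      move=> z _.
      have ev (K : C) : ((fun w : {ptws C -> R} => w K) : _ -> R) @ z --> (z K : R).
        exact: eval_continuous.
      have cd : d w @[w --> z] --> d z by exact: (cvg_norm (cvgB (cvgB (ev H) (ev F)) (ev G))).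
      exact: (cvgM cd cd).
    by apply/seteqP; split => z /=; rewrite lee_fin expr2.
  + move=> x y t; rewrite !inE /= !lee_fin => xk yk.
    have cE (K : C) : (conv t x y : C -> R) K = t%:num * (x : C -> R) K + (1 - t%:num) * (y : C -> R) K.
      by [].
    rewrite !real_normK ?num_real// in xk yk *; rewrite !cE.
    have l0 : 0 <= t%:num :> R by [].
    have l1 : t%:num <= 1 :> R by [].
    set l := t%:num in l0 l1 *.
    set a := _ - _ - _ in xk; set b := _ - _ - _ in yk.
    rewrite (_ : _ - _ - _ = l * a + (1 - l) * b); last by rewrite /a /b; ring.
    clearbody a b l; clear cE.
    (* This is the gap between [l * a ^+ 2 + (1 - l) * b ^+ 2] and the square of
       [l * a + (1 - l) * b]. *)
    have h : l * (1 - l) * (a - b) ^+ 2 >= 0 by rewrite mulr_ge0 ?sqr_ge0// mulr_ge0// subr_ge0.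
    have h1 := ler_wpM2l l0 xk.
    have h2 : (1 - l) * b ^+ 2 <= (1 - l) * k by rewrite ler_wpM2l// subr_ge0.
    nra.
- rewrite (_ : [set z | _] = setT).
    by split; [exact: closedT|move=> x y t _ _; rewrite inE].
  by apply/seteqP; split => // z _ /=; rewrite leey.
- rewrite (_ : [set z | _] = set0).
    by split; [exact: closed0|move=> x y t; rewrite inE].
  by apply/seteqP; split.
Qed.
End hulls.

(** * The inequality for simple quasi-states *)

Section simple.
Context {R : realType} (M : closed_surface R) (omega : area_form M).
Local Notation C := (continuousType M R).
Local Notation RR := (measurableTypeR R).

(** Replacing [F] and [G] by their opposites reverses all inequalities, as [zeta] is odd by
    linearity on the algebra generated by one function. *)
Lemma simple_quasi_state_cotriangle (zeta : C -> R) (zs : simple_quasi_state zeta) (F G : C) (a b : R) :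
  a < zeta F -> b < zeta G -> zeta (F \+ G) < a + b -> exists x, F x = a /\ G x = b.
Proof.
pose N (H : C) : C := cst (-1) \* H.
have NE (H : C) : zeta (N H) = - zeta H.
  rewrite -(on_functionsE zeta (N H)) -(on_functionsE zeta H).
  have := on_functions_affine zs (-1) 0 (@cts_fun _ _ H); rewrite addr0 mulN1r => <-.
  by congr on_functions; apply/funext => x; rewrite addr0.
move=> Fa Gb FGab.
have [||||x [Fx Gx]] := @simple_quasi_state_triangle _ _ _ zs (N F) (N G) (N (F \+ G)) (- a) (- b)
  (@surface_compact _ M).
- by move=> x; rewrite /N /=; ring.
- by rewrite NE ltrN2.
- by rewrite NE ltrN2.
- by rewrite NE; lra.
by exists x; move: Fx Gx; rewrite /N /= !mulN1r => /oppr_inj -> /oppr_inj ->.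
Qed.

(** The squared defect is at most twice the area of a triangle of attained values, to which
    [image_measure_le] applies; the sign of the defect decides which way the triangle points. *)
Lemma simple_quasi_state_poisson (zeta : C -> R) (zs : simple_quasi_state zeta) (F G : C) :
  smooth F -> smooth G ->
  ((`|zeta (F \+ G) - zeta F - zeta G| ^+ 2)%:E <= area omega * sup_norm (poisson omega F G))%E.
Proof.
move=> sF sG.
(* On an empty surface all functions coincide, and linearity would give [1 = 1 + 1]. A point ensures
   that the supremum norm is not [-oo]. *)
have [x0 _] : exists x : M, True.
  apply: contrapT => M0; have := quasi_state1 zs.1.
  have gen (c : R) : generated_by (cst 0 : C) (cst c : C).
    by exists (fun=> c) => //; apply: continuous_subspaceT => t; exact: cvg_cst.
  have := quasi_state_linear zs.1 1 (gen 0) (gen 0).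
  have -> : cst 1 \* cst 0 \+ cst 0 = cst 0 :> C.
    by apply/continuousEP => x; case: M0; exists x.
  have -> : cst 0 = cst 1 :> C by apply/continuousEP => x; case: M0; exists x.
  by move=> + h1; rewrite h1; lra.
have S0 : (0 <= sup_norm (poisson omega F G))%E.
  by apply: (@le_trans _ _ `|poisson omega F G x0|%:E);
    [rewrite lee_fin|apply: ereal_sup_ubound; exists x0].
rewrite real_normK ?num_real// muleC.
have [h|h|h] := ltgtP (zeta (F \+ G)) (zeta F + zeta G); last first.
- rewrite h; have -> : zeta F + zeta G - zeta F - zeta G = 0 by ring.
  (* For a zero defect, the empty set of values shows that the right-hand side is nonnegative. *)
  have := @image_measure_le _ _ omega F G sF sG set0 measurable0 (fun p => False_ind _) S0.
  by rewrite measure0 adde0 expr0n.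
- apply: le_trans (triangle_ge h) _; apply: image_measure_le => //.
    by apply: open_measurable2; exact: open_triangle.
  move=> p [p1 [p2 p3]].
  exact: (simple_quasi_state_triangle zs (@surface_compact _ M) _ p1 p2 p3).
- apply: le_trans (cotriangle_ge h) _; apply: image_measure_le => //.
    by apply: open_measurable2; exact: open_cotriangle.
  by move=> p [p1 [p2 p3]]; exact: (simple_quasi_state_cotriangle zs p1 p2 p3).
Qed.
End simple.

Theorem mainTheorem5 (R : realType) (M : closed_surface R)
    (omega : area_form M) (zeta : continuousType M R -> R)
    (zeta_representable : representable zeta)
    (F G : continuousType M R) (F_smooth : smooth F) (G_smooth : smooth G) :
  ((`|zeta (F \+ G) - zeta F - zeta G| ^+ 2)%:E
    <= area omega * sup_norm (poisson omega F G))%E.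
Proof.
case: zeta_representable => _; apply: closed_convex_hull_additivity_defect => // z zs.
exact: simple_quasi_state_poisson.
Qed.
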